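(* Let $V$ be a finite even-dimensional real vector space with a fixed volume form, let $N$ be a closed connected manifold of dimension $d$ with universal cover $\widetilde{N}$ and $\Gamma=\pi_1(N)$, and let $\rho:\Gamma\to\mathrm{SL}(V)$ be a representation. Let $u:\widetilde{N}\to\mathrm{Gr}_d^{\mathrm{mix}}(\mathcal{Q})$ be a $\rho$-equivariant continuous map that admits a $\rho$-equivariant fitting flow. Then $u$ is an embedding; in particular it is a globally fitting map. Moreover $\rho:\Gamma\to \mathrm{SL}(V)$ is a quasi-isometric embedding.
   Context: $S^2V$ is the space of symmetric tensors and $\mathcal{Q}=S^2V^*$ its dual, the space of symmetric bilinear forms on $V$; the pairing is $q(s)=\mathrm{Tr}(q\circ s)$, so $q(v\otimes v)=q(v,v)$. $\mathrm{SL}(V)$ acts naturally on both. $S^2V^{>0}$, $S^2V^{\ge0}$ are the sets of positive definite, resp. positive semi-definite tensors (as forms on $V^*$); a form $q\in \mathcal{Q}$ is positive if positive definite. $\mathrm{Gr}_d(\mathcal{Q})$ is the Grassmannian of $d$-dimensional subspaces (pencils) of $\mathcal{Q}$; for a pencil $P$, $P^\circ=\{s\in S^2V: q(s)=0\ \forall q\in P\}$; $P$ is mixed if $P^\circ\cap S^2V^{>0}\neq\emptyset$, and $\mathrm{Gr}_d^{\mathrm{mix}}(\mathcal{Q})$ is the set of mixed pencils. Write $u^\circ(x)=(u(x))^\circ$. A continuous map $u:M\to\mathrm{Gr}_d^{\mathrm{mix}}(\mathcal{Q})$ from a $d$-manifold is globally fitting if the subsets $\mathbb{P}(u^\circ(x)\cap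 S^2V^{\ge0})\subset\mathbb{P}(S^2V)$, $x\in M$, are pairwise disjoint. For a continuous map $u:M\to\mathrm{Gr}_d(\mathcal{Q})$ let $u^*\mathcal{E}=\{(x,q):x\in M,\ q\in u(x)\}$ and let $\mathbb{S}u^*\mathcal{E}$ be the sphere bundle obtained by removing the zero section and quotienting by positive scalars. A fitting flow for $u$ is a continuous flow $(\Phi_t)_{t\in\mathbb{R}}$ on $\mathbb{S}u^*\mathcal{E}$ such that for all $(x,[q])$ and all $t>0$, writing $\Phi_t(x,[q])=(x',[q'])$, one can choose representatives with $q'-q$ positive. It is $\rho$-equivariant if it commutes with $\gamma\cdot(x,[q])=(\gamma x,[\rho(\gamma)\cdot q])$. $\rho$ is a quasi-isometric embedding for a word metric on $\Gamma$ and a left-invariant Riemannian metric on $\mathrm{SL}(V)$ (equivalently, orbit maps into the symmetric space $\mathbb{P}(S^2V^{>0})$ are quasi-isometric embeddings). *)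

(* Defs.v *)
From HB Require Import structures.
From mathcomp Require Import all_boot all_order all_algebra.
From mathcomp Require Import all_classical all_reals all_analysis.
Import Order.TTheory GRing.Theory Num.Theory.
Import numFieldNormedType.Exports.

Set Implicit Arguments.
Unset Strict Implicit.
Unset Printing Implicit Defensive.

Local Open Scope classical_set_scope.
Local Open Scope ring_scope.

(* A basis of volume 1 identifies V with R^n (column vectors) and SL(V) with
   the matrices of determinant 1.  An element of S^2 V is the symmetric matrix
   of the form it induces on V^* (row vectors), an element of Q = S^2 V^* is
   the Gram matrix of a form on V; v \otimes v is v *m v^T. *)

Section FormsAndTensors.
Variables (R : realType) (n : nat).
Implicit Types (q s g : 'M[R]_n) (P : {vspace 'M[R]_n}).

Definition symmetric_forms : {vspace 'M[R]_n} := fixedSpace (linfun trmx).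

Lemma mem_symmetric_forms q : (q \in symmetric_forms) = (q^T == q).
Proof. by apply/fixedSpaceP/eqP; rewrite lfunE. Qed.

Definition symmetric_tensors : set 'M[R]_n := [set s | s^T = s].

Definition pairing q s : R := \tr (q *m s).

Lemma pairing_pure q (v : 'cV[R]_n) :
  pairing q (v *m v^T) = (v^T *m q *m v) 0 0.
Proof. by rewrite /pairing mulmxA mxtrace_mulC mulmxA trace_mx11. Qed.

Definition positive_form q :=
  q^T = q /\ forall v : 'cV[R]_n, v != 0 -> 0 < (v^T *m q *m v) 0 0.

Definition positive_tensors : set 'M[R]_n :=
  [set s | symmetric_tensors s /\
     forall l : 'rV[R]_n, l != 0 -> 0 < (l *m s *m l^T) 0 0].

Definition semipositive_tensors : set 'M[R]_n :=
  [set s | symmetric_tensors s /\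
     forall l : 'rV[R]_n, 0 <= (l *m s *m l^T) 0 0].

(* (g . q)(v, w) = q(g^-1 v, g^-1 w) *)
Definition form_action g q : 'M[R]_n := (invmx g)^T *m q *m invmx g.

Definition annihilator P : set 'M[R]_n :=
  [set s | symmetric_tensors s /\ forall q, q \in P -> pairing q s = 0].

Definition mixed P := annihilator P `&` positive_tensors !=set0.

(* The image in the projective space, whose points are the lines <[s]>. *)
Definition projectivization (A : set 'M[R]_n) : set {vspace 'M[R]_n} :=
  [set <[s]>%VS | s in A `\ 0].

End FormsAndTensors.

Section Grassmannian.
Variables (R : realType) (n d : nat).

Definition is_pencil (P : {vspace 'M[R]_n}) :=
  (P <= symmetric_forms R n)%VS && (\dim P == d).

Record grassmannian := Pencil {
  pencil_space :> {vspace 'M[R]_n};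
  _ : is_pencil pencil_space }.

HB.instance Definition _ := [isSub for pencil_space].
HB.instance Definition _ := [Choice of grassmannian by <:].

(* Bases of pencils: d matrices spanning a space of dimension d. *)
Definition frames : set {ptws 'I_d -> 'M[R]_n} :=
  [set F | is_pencil <<codom F>>%VS].

Definition frame_span (F : frames) : grassmannian :=
  Pencil (set_mem (valP F)).

(* The quotient topology of the space of frames. *)
Definition grassmannian_open (U : set grassmannian) :=
  open (frame_span @^-1` U).

Fact grassmannian_openT : grassmannian_open setT.
Proof. by rewrite /grassmannian_open preimage_setT; exact: openT. Qed.

Fact grassmannian_openI : setI_closed grassmannian_open.
Proof. by move=> U W; exact: openI. Qed.

Fact grassmannian_open_bigU (I : Type) (f : I -> set grassmannian) :
  (forall i, grassmannian_open (f i)) -> grassmannian_open (\bigcup_i f i).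
Proof.
by move=> of_; apply: bigcup_open => i _; exact: of_.
Qed.

HB.instance Definition _ := isOpenTopological.Build grassmannian
  grassmannian_openT grassmannian_openI grassmannian_open_bigU.

End Grassmannian.

Section FittingMaps.
Variables (R : realType) (n d : nat) (M : topologicalType).
Implicit Type u : M -> grassmannian R n d.

Definition embedding (X Y : topologicalType) (f : X -> Y) :=
  [/\ continuous f, injective f &
      forall U, open U -> exists2 W, open W & f @` U = W `&` range f].

Definition globally_fitting u :=
  [/\ continuous u, forall x, mixed (u x) &
      trivIset setT (fun x =>
        projectivization (annihilator (u x) `&` @semipositive_tensors R n))].

(* u^*E without its zero section *)
Definition punctured_bundle u : set (M * 'M[R]_n) :=
  [set p | p.2 \in pencil_space (u p.1) /\ p.2 != 0].

Definition same_ray u (p p' : punctured_bundle u) : bool :=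
  `[< (val p).1 = (val p').1 /\
      exists2 c : R, 0 < c & (val p').2 = c *: (val p).2 >].

Fact same_ray_refl u : reflexive (@same_ray u).
Proof. by move=> p; apply/asboolP; split=> //; exists 1; rewrite ?scale1r. Qed.

Fact same_ray_sym u : symmetric (@same_ray u).
Proof.
suff imp p p' : same_ray p p' -> @same_ray u p' p.
  by move=> p p'; apply/idP/idP; exact: imp.
move=> /asboolP[e [c c0 qc]]; apply/asboolP; split; first by rewrite e.
exists c^-1; first by rewrite invr_gt0.
by rewrite qc scalerA mulVf ?scale1r// gt_eqF.
Qed.

Fact same_ray_trans u : transitive (@same_ray u).
Proof.
move=> p2 p1 p3 /asboolP[e [c c0 qc]] /asboolP[e' [c' c'0 qc']].
apply/asboolP; split; first by rewrite e.
by exists (c' * c); rewrite ?mulr_gt0// qc' qc scalerA.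
Qed.

Canonical same_ray_equiv u :=
  EquivRel (@same_ray u)
    (@same_ray_refl u) (@same_ray_sym u) (@same_ray_trans u).

Definition sphere_bundle u : topologicalType :=
  quotient_topology {eq_quot (same_ray_equiv u)}%qT.

Definition ray u (p : punctured_bundle u) : sphere_bundle u :=
  (\pi_({eq_quot (same_ray_equiv u)}%qT) p)%qT.

Definition continuous_flow (X : topologicalType) (Phi : R -> X -> X) :=
  [/\ continuous (fun p : R * X => Phi p.1 p.2),
      forall x, Phi 0 x = x &
      forall s t x, Phi (s + t) x = Phi s (Phi t x)].

Definition fitting_flow u (Phi : R -> sphere_bundle u -> sphere_bundle u) :=
  continuous_flow Phi /\
  forall z t, 0 < t -> exists p p' : punctured_bundle u,
    [/\ ray p = z, ray p' = Phi t z &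
        positive_form ((val p').2 - (val p).2)].

Variables (Gamma : groupType) (act : Gamma -> M -> M).
Variable rho : Gamma -> 'M[R]_n.

Definition equivariant_map u := forall g x,
  [set` u (act g x)] = form_action (rho g) @` [set` u x].

Definition bundle_action g (p : M * 'M[R]_n) : M * 'M[R]_n :=
  (act g p.1, form_action (rho g) p.2).

(* Phi_t [g . p] = g . Phi_t [p], where p' represents Phi_t [p], and pg, pg'
   are the points g . p, g . p' of the bundle (they exist when u is
   equivariant). *)
Definition equivariant_flow u (Phi : R -> sphere_bundle u -> sphere_bundle u) :=
  forall g t (p p' pg pg' : punctured_bundle u),
    ray p' = Phi t (ray p) ->
    val pg = bundle_action g (val p) -> val pg' = bundle_action g (val p') ->
    Phi t (ray pg) = ray pg'.

End FittingMaps.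

Section UniversalCover.
Variable R : realType.

Definition locally_euclidean (d : nat) (N : topologicalType) :=
  forall x : N, exists (U : set N) (f : N -> 'rV[R]_d) (h : 'rV[R]_d -> N),
    [/\ open U, U x & open (f @` U)] /\
    [/\ {within U, continuous f}, {within f @` U, continuous h} &
        forall y, U y -> h (f y) = y].

Definition closed_manifold d (N : topologicalType) :=
  [/\ hausdorff_space N, @second_countable N, locally_euclidean d N &
      compact [set: N]].

Definition is_path (T : topologicalType) (x y : T) (a : R -> T) :=
  [/\ {within `[0, 1], continuous a}, a 0 = x & a 1 = y].

Definition path_homotopic (T : topologicalType) (x y : T) (a b : R -> T) :=
  exists H : R * R -> T,
    [/\ {within `[0, 1]%classic `*` `[0, 1]%classic, continuous H},
        forall s, s \in `[0, 1] -> H (s, 0) = a s /\ H (s, 1) = b s &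
        forall t, t \in `[0, 1] -> H (0, t) = x /\ H (1, t) = y].

Definition concat_path (T : Type) (a b : R -> T) : R -> T :=
  fun t => if t <= 2^-1 then a (2 * t) else b (2 * t - 1).

Definition simply_connected (T : topologicalType) :=
  (forall x y : T, exists a, is_path x y a) /\
  (forall (x : T) a, is_path x x a -> path_homotopic x x a (cst x)).

(* Every point has an open neighbourhood U whose preimage is a disjoint union
   of open sheets A, each mapped homeomorphically to U (with inverse s). *)
Definition covering_map (M N : topologicalType) (p : M -> N) :=
  [/\ continuous p, range p = setT &
      forall y : N, exists (U : set N) (F : set (set M)),
        [/\ open U, U y & p @^-1` U = \bigcup_(A in F) A] /\
        [/\ forall A, F A -> open A, trivIset F id &
            forall A, F A -> exists s : N -> M,
              [/\ {within U, continuous s}, s @` U = A,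
                  forall z, U z -> p (s z) = z &
                  forall x, A x -> s (p x) = x]]].

Definition universal_cover (M N : topologicalType) (p : M -> N) :=
  covering_map p /\ simply_connected M.

(* Gamma is pi_1(N, y), through the map cls sending a loop to its class; the
   values of cls on functions that are not loops at y are irrelevant. *)
Definition fundamental_group (N : topologicalType) (y : N) (Gamma : groupType)
    (cls : (R -> N) -> Gamma) :=
  [/\ forall g, exists2 a, is_path y y a & cls a = g,
      forall a b, is_path y y a -> is_path y y b ->
        (cls a = cls b <-> path_homotopic y y a b) &
      forall a b, is_path y y a -> is_path y y b ->
        cls (concat_path a b) = (cls a * cls b)%g].

(* The action by deck transformations: the class of a loop a at p x0 sends x0
   to the endpoint of the lift c of a starting at x0. *)
Definition deck_action (M N : topologicalType) (p : M -> N) (x0 : M)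
    (Gamma : groupType) (cls : (R -> N) -> Gamma) (act : Gamma -> M -> M) :=
  [/\ (forall x, act 1%g x = x) /\
        (forall g h x, act (g * h)%g x = act g (act h x)),
      forall g, continuous (act g),
      forall g x, p (act g x) = p x &
      forall x c, is_path x0 x c -> p x = p x0 -> act (cls (p \o c)) x0 = x].

End UniversalCover.

Section QuasiIsometricEmbedding.
Variable R : realType.

Definition quasi_isometric_embedding (X Y : Type) (dX : X -> X -> R)
    (dY : Y -> Y -> R) (f : X -> Y) :=
  exists K C : R, [/\ 1 <= K, 0 <= C &
    forall x y, K^-1 * dX x y - C <= dY (f x) (f y) <= K * dX x y + C].

Section WordMetric.
Variable Gamma : groupType.
Implicit Types (S w : seq Gamma) (g h : Gamma).

Definition words S g : set (seq Gamma) :=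
  [set w | all (fun x => (x \in S) || (x^-1%g \in S)) w /\
           (\prod_(x <- w) x)%g = g].

Definition generates S := forall g, words S g !=set0.

Definition word_dist S g h : R :=
  inf [set (size w)%:R | w in words S (g^-1 * h)%g].

End WordMetric.

Variable n : nat.

Definition SL_representation (Gamma : groupType) (rho : Gamma -> 'M[R]_n) :=
  [/\ forall g, \det (rho g) = 1, rho 1%g = 1%:M &
      forall g h, rho (g * h)%g = rho g *m rho h].

(* An inner product on the Lie algebra sl_n(R) of traceless matrices; the
   values of B on other matrices play no role in the induced metric. *)
Definition sl_inner_product (B : 'M[R]_n -> 'M[R]_n -> R) :=
  [/\ forall (a : R) X Y Z, B (a *: X + Y) Z = a * B X Z + B Y Z,
      forall X Y, B X Y = B Y X &
      forall X, \tr X = 0 -> X != 0 -> 0 < B X X].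

Definition SL_path (g h : 'M[R]_n) (c : R -> 'M[R]_n) :=
  [/\ forall t, derivable c t 1, continuous (derive1 c),
      forall t, t \in `[0, 1] -> \det (c t) = 1, c 0 = g & c 1 = h].

(* The length for the left-invariant Riemannian metric that is B at 1. *)
Definition SL_length (B : 'M[R]_n -> 'M[R]_n -> R) (c : R -> 'M[R]_n) : R :=
  let X t := invmx (c t) *m derive1 c t in
  \int[lebesgue_measure]_(t in `[0, 1]) Num.sqrt (B (X t) (X t)).

Definition SL_dist (B : 'M[R]_n -> 'M[R]_n -> R) (g h : 'M[R]_n) : R :=
  inf [set SL_length B c | c in SL_path g h].

(* All word metrics of a finitely generated group, and all left-invariant
   Riemannian metrics on SL_n(R), are quasi-isometric. *)
Definition quasi_isometrically_embedded (Gamma : groupType)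
    (rho : Gamma -> 'M[R]_n) :=
  (exists S : seq Gamma, generates S) /\
  forall (S : seq Gamma) (B : 'M[R]_n -> 'M[R]_n -> R),
    generates S -> sl_inner_product B ->
    quasi_isometric_embedding (word_dist S) (SL_dist B) rho.

End QuasiIsometricEmbedding.

(* Main.v *)
(* Along the flow a form grows by positive forms.  Hence a semi-definite tensor
   annihilated by u(x) is positive on the forms issued from u(x) at all later
   times, and cannot be annihilated by u(y) if y is reached from x.  By
   cocompactness the growth is uniform, at least by a fixed factor in each unit
   of time; so if s and s', annihilated by u(x) and u(y), satisfy s <= D s' and
   s' <= D s, the flow passes from x to y in a time O(1 + log D).

   Every y <> x is reached from x.  Let exp(v), for v in the pencil u(x), be the
   base point of v flowed for the time |v|.  If exp misses y, consider for a path
   a from x to y positive tensors s_t annihilated by u(a(t)), and the section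
   v -> s_t restricted to u(exp(v)), transported to u(x).  Together with t it
   is homotopic to the identity on a large sphere of R^d x R, so it has zeros
   with t replaced by any function of (v, t) with the same boundary values.  The
   zeros over exp(v) = a(t) and the others are two closed sets, because the flow
   is locally surjective, and a function separating them leaves no zero.  The
   only topological input is that the identity of a ball cannot be deformed off 0
   relatively to the sphere, which follows from the lemma of Sperner.

   So u is injective and globally fitting, and the bound on the time makes it
   proper onto its image.  If y = g x, the time is O(1 + log |rho(g)|) and bounds
   the word length of g, as the flow lines of length 1 issued from a compact
   fundamental set meet finitely many translates of it. *)

Require Import Defs.
From HB Require Import structures.
From mathcomp Require Import all_boot.
From mathcomp Require Import perm boolp zify.

Set Implicit Arguments.
Unset Strict Implicit.
Unset Printing Implicit Defensive.

(** * The lemma of Sperner for the Kuhn triangulation of a cube *)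

Section Sperner.

(** Neither [u] nor the flow is differentiable and no degree theory is at hand, so maps are compared
    only through being essential. Homotopies preserve this, but that a composite [sg \o f] is
    essential does not at once force [f] to reach a given value: pushing [f] away from a missed
    value onto a sphere is harmless only if [sg] has no zeros there. As a sphere has one dimension
    less than the target of [sg], a small perturbation removes these zeros; it is built with the hat
    functions of a Kuhn triangulation, so that it reduces to linear algebra.

    Local surjectivity has to precede the global one: it says that two distinct nearby points never
    share a nonzero semi-definite tensor, which is what keeps the zeros over [a t] apart from the
    others. The pencils along the exponential map are not trivialized as a bundle; projecting from
    each to the next suffices, because only the zeros of a section matter.

    For the metric statement, words are turned into C1 paths in the special linear group made of
    transvections, and paths are turned into inequalities between tensors by a logarithmic
    derivative. *)

Lemma even_card_involution (T : finType) (A : {set T}) (f : T -> T) :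
  {in A, forall x, f x \in A} -> {in A, forall x, f (f x) = x} ->
  {in A, forall x, f x != x} -> ~~ odd #|A|.
Proof.
have [c] := ubnP #|A|; elim: c A => // c IH A cA fA fK fN.
case: (set_0Vmem A) => [->|[x xA]]; first by rewrite cards0.
have fxA := fA x xA.
have fxAx : f x \in A :\ x by rewrite !inE fN.
have B1 : #|A| = #|A :\ x :\ f x|.+2 by rewrite (cardsD1 x A) (cardsD1 (f x) (A :\ x)) xA fxAx.
rewrite B1 /= negbK; apply: IH.
- by rewrite B1 ltnS in cA; exact: ltnW.
- move=> y; rewrite !inE => /and3P[yfx yx yA].
  rewrite fA // andbT; apply/andP; split.
    by apply: contra yx => /eqP e; rewrite -(fK y yA) e fK.
  by apply: contra yfx => /eqP e; rewrite -e fK.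
- by move=> y; rewrite !inE => /and3P[_ _ yA]; exact: fK.
- by move=> y; rewrite !inE => /and3P[_ _ yA]; exact: fN.
Qed.

(* The Kuhn simplex (v, t) has the vertices [vertex (v, t) j], j <= m: the
   coordinates are incremented one at a time, coordinate [i] being the
   [t i]-th one to be. *)
Definition kuhn m k : finType :=
  ({ffun 'I_m -> 'I_k} * {ffun 'I_m -> 'I_m})%type.

(** Vertices are functions on all of [nat], zero from [m] on, so that one labelling serves for the
    cube and for its faces in the induction on the dimension. *)
Definition vertex m k (s : kuhn m k) (j : nat) : nat -> nat := fun i =>
  oapp (fun i : 'I_m => s.1 i + (s.2 i < j)) 0 (insub i).

Lemma vertexE m k (s : kuhn m k) j (i : 'I_m) :
  vertex s j i = s.1 i + (s.2 i < j).
Proof. by rewrite /vertex insubT //= => im; rewrite (_ : Sub _ _ = i) //; apply: val_inj. Qed.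

Lemma vertex_out m k (s : kuhn m k) j i : m <= i -> vertex s j i = 0.
Proof. by move=> mi; rewrite /vertex insubF // ltnNge mi. Qed.

Lemma eq_vertex m k k' (s : kuhn m k) (s' : kuhn m k') j j' :
  (forall i, s.1 i + (s.2 i < j) = s'.1 i + (s'.2 i < j')) ->
  vertex s j = vertex s' j'.
Proof.
move=> e; apply/funext => i; have [im|mi] := ltnP i m.
  by rewrite (vertexE s j (Ordinal im)) (vertexE s' j' (Ordinal im)).
by rewrite !vertex_out.
Qed.

Variable lam : (nat -> nat) -> nat.

(** The boundary condition is asymmetric: the face where coordinate [i] is 0 carries only labels up
    to [i], the opposite face misses the label [i]. Hence, in dimension [m.+1], the labels below
    [m.+1] can all occur only on the face where the last coordinate is 0. *)
Definition kuhn_labelling m k :=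
  forall z : nat -> nat, (forall i, i < m -> z i <= k) ->
    (forall i, m <= i -> z i = 0) ->
  [/\ lam z <= m, forall i, i < m -> z i = 0 -> lam z <= i &
      forall i, i < m -> z i = k -> lam z != i].

Definition full m k : {set kuhn m k} :=
  [set s : kuhn m k | injectiveb s.2 &&
    [forall l : 'I_m.+1, exists j : 'I_m.+1, lam (vertex s j) == l]].

(** A facet is recorded by its simplex and the opposite vertex, so that an inner facet occurs twice,
    once for each of its sides. *)
Definition doors m k : {set kuhn m k * 'I_m.+1} :=
  [set d : kuhn m k * 'I_m.+1 | injectiveb d.1.2 &&
    [forall l : 'I_m, exists j : 'I_m.+1,
        (j != d.2) && (lam (vertex d.1 j) == l)]].

(** If the vertices other than [j0] carry the labels below [m], then either [j0] has the label [m]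
    and is the only vertex that may be omitted, or it repeats the label of one other vertex and
    exactly these two may be omitted. *)
Lemma doors_of_labels m (a : 'I_m.+1 -> 'I_m.+1) :
  odd #|[pred j | [forall l : 'I_m, exists j' : 'I_m.+1,
        (j' != j) && (a j' == l :> nat)]]| =
  [forall l : 'I_m.+1, exists j : 'I_m.+1, a j == l].
Proof.
set P := [pred j | _].
have wl (l : 'I_m) : widen_ord (leqnSn m) l = l :> nat by [].
case: (pickP P) => [j0 Pj0|P0]; last first.
  rewrite (eq_card0 P0) /=; apply/esym/negbTE/negP => /forallP full_a.
  have ainj : injective a.
    have /image_injP ai : #|codom a| == #|'I_m.+1|.
      apply/eqP/eq_card => l; rewrite !inE.
      by apply/codomP; have /existsP[j /eqP <-] := full_a l; exists j.
    by move=> j j' e; apply: ai.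
  have /existsP[j /eqP aj] := full_a ord_max.
  have /negP[] := P0 j; apply/forallP => l.
  have /existsP[j' /eqP aj'] := full_a (widen_ord (leqnSn m) l).
  apply/existsP; exists j'; rewrite aj' eqxx andbT.
  apply/eqP => jj'; have := ltn_ord l; rewrite -(wl l) -aj' jj' aj /= ltnn //.
have /forallP/= Pj := Pj0.
have cov (l : 'I_m) : {j | j != j0 /\ a j = l :> nat}.
  by apply: cid; have /existsP[j /andP[jj0 /eqP]] := Pj l; exists j.
pose g l := sval (cov l).
have gj0 l : g l != j0 by rewrite /g; case: (cov l) => ? [].
have ag l : a (g l) = l :> nat by rewrite /g; case: (cov l) => ? [].
have ginj : injective g by move=> l l' gl; apply: val_inj; rewrite /= -ag gl ag.
have gsur j : j != j0 -> exists l, j = g l.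
  move=> jj0; have : j \in codom g.
    have cg : #|codom g| = #|predC1 j0|.
      by rewrite card_codom // card_ord cardC1 card_ord.
    have sg : codom g \subset predC1 j0.
      by apply/fintype.subsetP => _ /codomP[l ->]; rewrite inE gj0.
    by move/(subset_cardP cg): sg => ->; rewrite inE.
  by move=> /codomP.
case: (eqVneq (a j0) ord_max) => [aj0|aj0].
  have -> : [forall l : 'I_m.+1, exists j, a j == l].
    apply/forallP => l; apply/existsP.
    case: (eqVneq l ord_max) => [->|lm]; first by exists j0; rewrite aj0.
    have lm' : l < m by rewrite ltn_neqAle -ltnS ltn_ord andbT.
    by exists (g (Ordinal lm')); apply/eqP/val_inj; rewrite /= ag.
  rewrite (@eq_card1 _ j0) // => j; rewrite [RHS]inE; apply/idP/eqP => [|->//].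
  move=> /forallP/= Pj'; apply/eqP; apply: contraT => /gsur[l jl].
  have /existsP[j' /andP[j'j /eqP aj']] := Pj' l.
  case: (eqVneq j' j0) => [e|/gsur[l' e]].
    by have := ltn_ord l; rewrite -aj' e aj0 ltnn.
  by move: j'j; rewrite e jl -(inj_eq val_inj) in aj' *; move: aj'; rewrite ag => /val_inj ->;
    rewrite eqxx.
have aj0m : a j0 < m by rewrite ltn_neqAle -ltnS ltn_ord andbT.
pose l0 := Ordinal aj0m.
have -> : [forall l : 'I_m.+1, exists j, a j == l] = false.
  apply/negbTE/negP => /forallP/(_ ord_max)/existsP[j /eqP aj].
  case: (eqVneq j j0) => [e|/gsur[l e]]; first by rewrite e in aj; rewrite aj eqxx in aj0.
  by have := ltn_ord l; rewrite -ag -e aj ltnn.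
rewrite (eq_card (B := pred2 j0 (g l0))); last first.
  move=> j; rewrite [RHS]inE /=; apply/idP/orP => [|[/eqP->//|/eqP->]].
    move=> /forallP/= Pj'; case: (eqVneq j j0) => [_|jj0]; [by left|right].
    have [l jl] := gsur _ jj0.
    have /existsP[j' /andP[j'j /eqP aj']] := Pj' l.
    case: (eqVneq j' j0) => [e|/gsur[l' e]].
      by rewrite jl; apply/eqP; congr (g _); apply: val_inj; rewrite /= -aj' e.
    move: j'j; rewrite e jl; rewrite e ag in aj'.
    by rewrite (val_inj aj') eqxx.
  apply/forallP => l; apply/existsP.
  case: (eqVneq l l0) => [->|ll0].
    by exists j0; rewrite eq_sym gj0 /=.
  by exists (g l); rewrite ag eqxx andbT; apply: contra ll0 => /eqP/ginj ->.
by rewrite card2 eq_sym gj0.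
Qed.

Lemma odd_card_pair (T1 T2 : finType) (A : {set T1}) (D : {set T1 * T2}) :
  (forall x, odd #|[pred y | (x, y) \in D]| = (x \in A)) ->
  odd #|D| = odd #|A|.
Proof.
move=> h; rewrite -sum1_card -[in RHS]sum1_card.
rewrite (eq_bigl (fun p : T1 * T2 => predT p.1 && ((p.1, p.2) \in D))); last by case.
rewrite -(pair_big_dep predT (fun x y => (x, y) \in D) (fun _ _ => 1)) /=.
rewrite [in RHS]big_mkcond /= !(big_morph odd oddD (erefl : odd 0 = false)).
apply: eq_bigr => x _; rewrite sum1_card h; by case: ifP.
Qed.

Lemma odd_doors m k : 0 < k -> kuhn_labelling m k -> odd #|doors m k| = odd #|full m k|.
Proof.
move=> k0 lamP; apply: odd_card_pair => s.
have lam_le (j : 'I_m.+1) : lam (vertex s j) < m.+1.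
  have [||//] := lamP (vertex s j); last by move=> i; exact: vertex_out.
  move=> i im; rewrite (vertexE s j (Ordinal im)).
  by case: (_ < _); rewrite ?addn0 ?addn1 //; apply: ltnW.
rewrite inE -(doors_of_labels (fun j => Ordinal (lam_le j))).
case: (boolP (injectiveb s.2)) => inj /=; last first.
  by rewrite eq_card0 // => j; rewrite !inE (negbTE inj).
congr odd; apply: eq_card => j; rewrite !inE inj /=.
by apply/eq_forallb => l; apply/eq_existsb => j'.
Qed.

Definition swap_pred (j x : nat) : nat :=
  if x == j.-1 then j else if x == j then j.-1 else x.

Lemma swap_predK j : involutive (swap_pred j).
Proof. by move=> x; rewrite /swap_pred; repeat case: eqP; lia. Qed.

Lemma swap_pred_lt j j' x : j' != j -> (swap_pred j x < j') = (x < j').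
Proof. by rewrite /swap_pred; repeat case: eqP; lia. Qed.

Definition swap_pos m (j : nat) (x : 'I_m.+1) : 'I_m.+1 :=
  inord (swap_pred j x).

Lemma val_swap_pos m j (x : 'I_m.+1) : j <= m ->
  swap_pos j x = swap_pred j x :> nat.
Proof.
move=> jm; rewrite inordK // /swap_pred; have := ltn_ord x.
by repeat case: eqP; lia.
Qed.

(** The pivoting rule of the Kuhn triangulation, which passes to the other simplex with the same
    facet. Omitting the first vertex moves the first increment to the end, omitting the last vertex
    does the converse, and omitting an inner vertex [j] exchanges the increments [j.-1] and [j]. *)
Definition flip m k (d : kuhn m.+1 k.+1 * 'I_m.+2) :
    kuhn m.+1 k.+1 * 'I_m.+2 :=
  let: ((v, t), j) := d in
  if j == 0 :> nat then
    (([ffun i => inord (v i + (t i == 0 :> nat))], [ffun i => ord_pred (t i)]),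
     ord_max)
  else if j == m.+1 :> nat then
    (([ffun i => inord (v i - (t i == m :> nat))], [ffun i => ordS (t i)]),
     ord0)
  else ((v, [ffun i => swap_pos j (t i)]), j).

(** Coordinate [i] starts at 0 and is the last to be incremented, so it is 0 on the whole facet
    opposite to the last vertex: these are the facets on which [flip] would leave the cube. *)
Definition boundary_door m k (d : kuhn m.+1 k.+1 * 'I_m.+2) :=
  (d.2 == ord_max) && [exists i, (d.1.2 i == ord_max) && (d.1.1 i == ord0)].

Lemma val_ord_pred m (x : 'I_m.+1) :
  ord_pred x = (if x == 0 :> nat then m else x.-1) :> nat.
Proof.
case: x => -[|x] xm /=; first by rewrite modn_small.
by rewrite modnDr modn_small // ltnW.
Qed.

Lemma val_ordS m (x : 'I_m.+1) :
  ordS x = (if x == m :> nat then 0 else x.+1) :> nat.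
Proof.
case: x => x xm /=; case: eqP => [->|xm']; first by rewrite modnn.
by rewrite modn_small //; lia.
Qed.

Section Flip.
Variables m k : nat.
Hypothesis lamP : kuhn_labelling m.+1 k.+1.

Lemma kuhn_labelling_vertex (s : kuhn m.+1 k.+1) j :
  [/\ lam (vertex s j) <= m.+1,
     forall i : 'I_m.+1, vertex s j i = 0 -> lam (vertex s j) <= i &
     forall i : 'I_m.+1, vertex s j i = k.+1 -> lam (vertex s j) != i].
Proof.
have [|i|h1 h2 h3] := lamP (z := vertex s j); last by split => // i; [apply: h2|apply: h3].
- move=> i im; rewrite (vertexE s j (Ordinal im)).
  by case: (_ < _); rewrite ?addn0 ?addn1 //; apply: ltnW.
- exact: vertex_out.
Qed.

(** Otherwise coordinate [i] would be [k.+1] at all vertices but the first, and the label [i] would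
    be missing on the facet. Thus [flip] does not leave the cube through an upper face. *)
Lemma door_bound (v : {ffun 'I_m.+1 -> 'I_k.+1}) t i :
  ((v, t), ord0) \in doors m.+1 k.+1 -> t i = 0 :> nat -> v i < k.
Proof.
rewrite inE => /andP[_ /forallP/(_ i)/existsP[j /andP[j0 /eqP lj]]] ti.
have [_ _ /(_ i)] := kuhn_labelling_vertex (v, t) j.
rewrite vertexE /= ti lj eqxx lt0n -(inj_eq val_inj) /= in j0 * => h.
have := ltn_ord (v i); rewrite ltnS leq_eqVlt => /orP[/eqP vk|//].
by move: h; rewrite vk j0 addn1 => /(_ erefl).
Qed.

Lemma flip_vertex d : d \in doors m.+1 k.+1 -> ~~ boundary_door d ->
  injectiveb (flip d).1.2 /\
  exists r : 'I_m.+2 -> 'I_m.+2,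
    forall j, j != d.2 -> r j != (flip d).2 /\
      vertex (flip d).1 (r j) = vertex d.1 j.
Proof.
case: d => -[v t] j dD; have := dD; rewrite inE => /andP[/= /injectiveP tinj dl].
rewrite /boundary_door /= => nb.
case: (eqVneq (j : nat) 0) => [j0|j0].
  have ej : j = ord0 by apply: val_inj.
  rewrite ej in dD *; split => /=.
    apply/injectiveP => i i'; rewrite !ffunE => /(can_inj (@ord_predK _)).
    exact: tinj.
  exists (fun j => inord j.-1) => j'; rewrite -(inj_eq val_inj) /= => j'0.
  have j'm := ltn_ord j'.
  split; first by rewrite -(inj_eq val_inj) /= inordK; lia.
  apply: eq_vertex => i /=; rewrite !ffunE val_ord_pred.
  have := ltn_ord (t i) => tm.
  case: eqP => ti; last by rewrite addn0 inord_val !inordK; lia.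
  have vk := door_bound dD ti.
  rewrite !inordK; lia.
case: (eqVneq (j : nat) m.+1) => [jm|jm].
  have ej : j = ord_max by apply: val_inj.
  rewrite ej eqxx /= in nb *; split => /=.
    apply/injectiveP => i i'; rewrite !ffunE => /(can_inj (@ordSK _)).
    exact: tinj.
  exists (fun j => inord j.+1) => j'; rewrite -(inj_eq val_inj) /= => j'm.
  have j'm' := ltn_ord j'.
  split; first by rewrite -(inj_eq val_inj) /= inordK; lia.
  apply: eq_vertex => i /=; rewrite !ffunE val_ordS.
  have tm := ltn_ord (t i); have vk := ltn_ord (v i).
  case: eqP => ti; last by rewrite subn0 inord_val !inordK; lia.
  have v0 : (v i : nat) != 0.
    apply: contraNneq nb => v0; apply/existsP; exists i.
    by rewrite -!(inj_eq val_inj) /= ti v0 !eqxx.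
  rewrite subn1 !inordK; move: v0 vk tm ti j'm j'm'; set a := nat_of_ord (v i);
    set b := nat_of_ord (t i); lia.
have jm' : j <= m by have jm' := ltn_ord j; clear -jm' jm; lia.
split=> /=.
  apply/injectiveP => i i'; rewrite !ffunE => /(congr1 val)/=.
  by rewrite !val_swap_pos // => /(can_inj (@swap_predK j))/val_inj/tinj.
exists id => j' j'j; split => //.
by apply: eq_vertex => i /=; rewrite ffunE val_swap_pos // swap_pred_lt.
Qed.

Lemma flipK d : d \in doors m.+1 k.+1 -> ~~ boundary_door d ->
  flip (flip d) = d.
Proof.
case: d => -[v t] j dD nb; rewrite /= .
case: (eqVneq (j : nat) 0) => [j0|j0].
  have ej : j = ord0 by apply: val_inj.
  rewrite ej in dD *; rewrite /= eqxx; congr (_, _, _).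
  - apply/ffunP => i; rewrite !ffunE; apply: val_inj; rewrite val_ord_pred.
    have tm := ltn_ord (t i); have vm := ltn_ord (v i).
    case: (eqVneq (t i : nat) 0) => ti.
      have vk := door_bound dD ti.
      by rewrite eqxx addn1 /= inordK ?inordK ?subn1.
    have tm' : (t i).-1 < m by case: (nat_of_ord (t i)) ti tm.
    by rewrite addn0 inord_val ltn_eqF ?subn0 ?inord_val.
  - by apply/ffunP => i; rewrite !ffunE ord_predK.
case: (eqVneq (j : nat) m.+1) => [jm|jm].
  have ej : j = ord_max by apply: val_inj.
  rewrite ej /=; congr (_, _, _).
  - apply/ffunP => i; rewrite !ffunE; apply: val_inj; rewrite val_ordS.
    have tm := ltn_ord (t i); have vm := ltn_ord (v i).
    case: (eqVneq (t i : nat) m) => ti; last by rewrite /= subn0 addn0 !inord_val.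
    have v0 : (v i : nat) != 0.
      apply: contraNneq nb => v0; rewrite /boundary_door ej eqxx /=.
      by apply/existsP; exists i; rewrite -!(inj_eq val_inj) /= ti v0 !eqxx.
    have vm' : (v i).-1 < k.+1 by apply: leq_ltn_trans vm; exact: leq_pred.
    by rewrite eqxx subn1 /= inordK inordK // ?addn1 ?prednK ?lt0n.
  - by apply/ffunP => i; rewrite !ffunE ordSK.
rewrite /= ?(negbTE j0) ?(negbTE jm); congr (_, _, _).
apply/ffunP => i; rewrite !ffunE; apply: val_inj.
have jm' : j <= m by have jm' := ltn_ord j; clear -jm' jm; lia.
by rewrite /= !val_swap_pos // swap_predK.
Qed.

Lemma flip_neq d : d \in doors m.+1 k.+1 -> flip d != d.
Proof.
case: d => -[v t] j dD /=.
have := dD; rewrite inE => /andP[/= /injectiveP tinj _].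
case: (eqVneq (j : nat) 0) => [j0|j0].
  by apply/eqP => -[_ _ /(congr1 val)] /=; lia.
case: (eqVneq (j : nat) m.+1) => [jm|jm].
  by apply/eqP => -[_ _ /(congr1 val)] /=; lia.
apply/eqP => -[/ffunP h].
have jm' : j <= m by have jm' := ltn_ord j; clear -jm' jm; lia.
have [i ti] : exists i, t i = inord j.
  by have [g _ gK] := injF_bij tinj; exists (g (inord j)); rewrite gK.
have := congr1 val (h i); rewrite ffunE /= val_swap_pos // ti inordK //.
rewrite /swap_pred; clear -j0; case: eqP; [lia|rewrite eqxx; lia].
Qed.

Lemma flip_door d : d \in doors m.+1 k.+1 -> ~~ boundary_door d ->
  flip d \in doors m.+1 k.+1 /\ ~~ boundary_door (flip d).
Proof.
move=> dD nb; have [finj [r rP]] := flip_vertex dD nb; split.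
  rewrite inE finj /=; apply/forallP => l; apply/existsP.
  have := dD; rewrite inE => /andP[_ /forallP/(_ l)/existsP[j /andP[jd /eqP lj]]].
  by have [rj vj] := rP j jd; exists (r j); rewrite rj vj lj /=.
apply/negP => /andP[]; case: d dD nb {finj r rP} => -[v t] j dD nb /=.
case: (eqVneq (j : nat) 0) => [j0 _|j0].
  have ej : j = ord0 by apply: val_inj.
  rewrite ej in dD; move/existsP=> /= [i]; rewrite !ffunE -!(inj_eq val_inj) /=.
  rewrite -/(ord_pred _) => /andP[].
  have := val_ord_pred (t i); rewrite /= => ->.
  have tm := ltn_ord (t i); have vm := ltn_ord (v i).
  case: ifP => [/eqP ti _|ti /eqP tm'].
    have vk := door_bound dD ti.
    by rewrite addn1 inordK.
  by move: tm ti tm'; case: (nat_of_ord (t i)) => //= b + _ e; rewrite e ltnn.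
case: (eqVneq (j : nat) m.+1) => [jm|jm]; first by rewrite -(inj_eq val_inj) /=.
by rewrite -(inj_eq val_inj) /= (negbTE jm).
Qed.

(** The doors that are not on the boundary are paired by the fixed-point free involution [flip]. *)
Lemma odd_boundary_doors :
  odd #|doors m.+1 k.+1| =
  odd #|[set d in doors m.+1 k.+1 | boundary_door d]|.
Proof.
rewrite -(cardsID [set d | boundary_door d]) oddD.
rewrite (_ : doors _ _ :&: _ = [set d in doors m.+1 k.+1 | boundary_door d]); last first.
  by apply/setP => d; rewrite !inE.
rewrite [X in _ (+) X](_ : _ = false) ?addbF //; apply/negbTE.
apply: (@even_card_involution _ _ (@flip m k)).
- move=> d; rewrite in_setD in_set => /andP[nb dD].
  by rewrite in_setD in_set; have [-> ->] := flip_door dD nb.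
- by move=> d; rewrite in_setD in_set => /andP[nb dD]; exact: flipK.
- by move=> d; rewrite in_setD in_set => /andP[nb dD]; exact: flip_neq.
Qed.

End Flip.

(** The new coordinate starts at 0 and is incremented last, so that all vertices but the last one
    are those of [s]. *)
Definition kuhn_extend m k (s : kuhn m k.+1) : kuhn m.+1 k.+1 :=
  ([ffun i => oapp s.1 ord0 (unlift ord_max i)],
   [ffun i => oapp (fun i => lift ord_max (s.2 i)) ord_max (unlift ord_max i)]).

Lemma vertex_extend m k (s : kuhn m k.+1) j : j <= m ->
  vertex (kuhn_extend s) j = vertex s j.
Proof.
move=> jm; apply/funext => i; have [im|mi] := ltnP i m.
  have ei : i = lift ord_max (Ordinal im) :> nat by rewrite lift_max.
  rewrite (vertexE s j (Ordinal im)) [in LHS]ei vertexE /= !ffunE liftK /=.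
  by rewrite -/(bump _ _) -[bump _ _]/(nat_of_ord (lift ord_max _)) lift_max.
rewrite (vertex_out s) //; move: mi; rewrite leq_eqVlt => /orP[/eqP <-|mi].
  by rewrite (vertexE _ j ord_max) !ffunE unlift_none /= ltnNge jm.
by rewrite vertex_out.
Qed.

(** A door has a vertex with the label [m], and on the face where coordinate [i] is 0 labels are at
    most [i]; hence [i] is the last coordinate, and the doors of that face are its fully labelled
    simplices. *)
Lemma card_boundary_doors m k : kuhn_labelling m.+1 k.+1 ->
  #|[set d in doors m.+1 k.+1 | boundary_door d]| = #|full m k.+1|.
Proof.
move=> lamP.
pose emb (s : kuhn m k.+1) : kuhn m.+1 k.+1 * 'I_m.+2 := (kuhn_extend s, ord_max).
have emb_inj : injective emb.
  move=> [v t] [v' t'] [/ffunP ev /ffunP et]; congr (_, _); apply/ffunP => i.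
    by have := ev (lift ord_max i); rewrite !ffunE liftK.
  by have := et (lift ord_max i); rewrite !ffunE liftK => /lift_inj.
rewrite -(card_imset _ emb_inj); apply: eq_card => -[[v t] j].
rewrite in_set; apply/andP/imsetP => [[dD]|[s]]; last first.
  rewrite inE => /andP[/injectiveP sinj /forallP sfull] [-> -> ->].
  rewrite /boundary_door eqxx /=; split; last first.
    by apply/existsP; exists ord_max; rewrite !ffunE unlift_none !eqxx.
  rewrite inE; apply/andP; split.
    apply/injectiveP => i i'; rewrite !ffunE.
    case: (unliftP ord_max i) => [i1|] ->; case: (unliftP ord_max i') => [i2|] -> //=.
    - by move=> /lift_inj/sinj ->.
    - by move/eqP; rewrite eq_sym (negbTE (neq_lift _ _)).
    - by move/eqP; rewrite (negbTE (neq_lift _ _)).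
  apply/forallP => l; have /existsP[j' lj'] := sfull l.
  apply/existsP; exists (widen_ord (leqnSn _) j').
  rewrite -(inj_eq val_inj) /= ltn_eqF //=.
  by rewrite (vertex_extend s) // -ltnS.
move=> /andP[/= /eqP ej /existsP[i /andP[/eqP ti /eqP vi]]].
have := dD; rewrite ej inE => /andP[/= /injectiveP tinj /forallP dl].
have ltm (j' : 'I_m.+2) : j' != ord_max -> j' <= m.
  by rewrite -(inj_eq val_inj) /= => h; rewrite -ltnS ltn_neqAle h -ltnS /=.
have ei : i = ord_max.
  have /existsP[j' /andP[/ltm j'm /eqP lj']] := dl ord_max.
  have [_ h _] := kuhn_labelling_vertex lamP (v, t) j'.
  apply: val_inj; apply/eqP; rewrite eqn_leq -ltnS ltn_ord /=.
  suff : lam (vertex (v, t) j') <= i by rewrite lj'.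
  by apply: h; rewrite vertexE /= ti vi /= ltnNge j'm.
rewrite {}ei in ti vi.
have ht i' : {x | t (lift ord_max i') = lift ord_max x}.
  apply: cid; case: (unliftP ord_max (t (lift ord_max i'))) => [x ->|]; first by exists x.
  move=> e; have /tinj/eqP := etrans e (esym ti).
  by rewrite eq_sym (negbTE (neq_lift _ _)).
pose s : kuhn m k.+1 :=
  ([ffun i' => v (lift ord_max i')], [ffun i' => sval (ht i')]).
have es : (v, t) = kuhn_extend s.
  congr (_, _); apply/ffunP => i'; rewrite !ffunE;
    case: (unliftP ord_max i') => [i1|] -> //=; rewrite !ffunE //.
  by case: (ht i1).
exists s; last by rewrite /emb -es.
rewrite inE; apply/andP; split.
  apply/injectiveP => i1 i2; rewrite !ffunE => e; apply: (@lift_inj _ ord_max).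
  by apply: tinj; rewrite (svalP (ht i1)) (svalP (ht i2)) e.
apply/forallP => l; have /existsP[j' /andP[/ltm j'm lj']] := dl l.
apply/existsP; exists (Ordinal (j'm : j' < m.+1)).
by rewrite -(vertex_extend s) // -es.
Qed.

Lemma sperner_kuhn m k : kuhn_labelling m k.+1 -> odd #|full m k.+1|.
Proof.
elim: m => [|m IH] lamP; last first.
  rewrite -odd_doors // odd_boundary_doors // card_boundary_doors //; apply: IH.
  move=> z zk z0; have [||h1 h2 h3] := lamP z.
  - by move=> i; rewrite ltnS leq_eqVlt => /orP[/eqP->|/zk//]; rewrite z0.
  - by move=> i /ltnW; exact: z0.
  split => [|i im|i im]; first by apply: h2; rewrite ?z0.
    by apply: h2; exact: ltnW.
  by apply: h3; exact: ltnW.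
rewrite (_ : full 0 k.+1 = setT).
  by rewrite cardsT card_prod !card_ffun !card_ord !expn0.
apply/setP => s; rewrite !inE; apply/andP; split; first by apply/injectiveP => -[].
apply/forallP => l; apply/existsP; exists ord0.
have [|i|h _ _] := lamP (vertex s (ord0 : 'I_1)) => //; first exact: vertex_out.
by case: l => -[|//] l0; rewrite -leqn0.
Qed.

End Sperner.

From HB Require Import structures.
From mathcomp Require Import all_order all_algebra.
From mathcomp Require Import all_classical all_reals all_analysis.
From mathcomp Require Import ring lra.
Import Order.TTheory GRing.Theory Num.Theory.
Import numFieldNormedType.Exports.

Local Open Scope classical_set_scope.
Local Open Scope ring_scope.

(** * Essential maps *)

Section MatrixNorm.
Variable R : realType.

Lemma mx_norm_leP m n (x : 'M[R]_(m, n)) (c : R) : 0 <= c ->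
  `|x| <= c <-> forall i j, `|x i j| <= c.
Proof.
move=> c0; rewrite [leLHS]/Num.norm /= mx_normrE; split=> [xc i j|h].
  by apply: le_trans xc; apply: (le_bigmax _ (fun ij => `|x ij.1 ij.2|) (i, j)).
by apply: bigmax_le => // -[i j] _; exact: h.
Qed.

Lemma mx_norm_ltP m n (x : 'M[R]_(m, n)) (c : R) : 0 < c ->
  `|x| < c <-> forall i j, `|x i j| < c.
Proof.
move=> c0; rewrite [ltLHS]/Num.norm /= mx_normrE; split=> [xc i j|h].
  by apply: le_lt_trans xc; apply: (le_bigmax _ (fun ij => `|x ij.1 ij.2|) (i, j)).
by apply: bigmax_lt => // -[i j] _; exact: h.
Qed.

Lemma le_mx_norm m n (x : 'M[R]_(m, n)) i j : `|x i j| <= `|x|.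
Proof. by apply/mx_norm_leP: i j. Qed.

End MatrixNorm.

Section Compactness.
Variable R : realType.

(** Stated for an arbitrary filter, because it is applied not only to small radii and large
    constants but also to large compact sets and to large lists of group elements. *)
Lemma compact_near (X : topologicalType) (K : set X) (I : Type)
    (F : set_system I) (P : I -> X -> Prop) : compact K -> Filter F ->
  (forall x, K x -> \forall x' \near x & i \near F, P i x') ->
  \forall i \near F, forall x, K x -> P i x.
Proof. by move=> /compact_near_coveringP cK FF h; exact: cK. Qed.

Lemma near_dist (V : normedModType R) (x : V) (e : R) : 0 < e ->
  \forall x' \near x, `|x - x'| < e.
Proof. by move=> e0; apply: cvgr_dist_lt => //; exact: cvg_id. Qed.

Lemma compact_unif_continuous (X Y : normedModType R) (K : set X) (f : X -> Y)
    (e : R) : compact K -> continuous f -> 0 < e ->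
  exists2 r : R, 0 < r & forall x x', K x -> `|x - x'| < r ->
    `|f x - f x'| < e.
Proof.
move=> cK cf e0.
have : \forall r \near (0:R)^'+, forall x, K x ->
    forall x', `|x - x'| < r -> `|f x - f x'| < e.
  apply: compact_near => // x Kx.
  have /cvgrPdist_lt/(_ (e / 2)) := cf x.
  move=> /(_ ltac:(by rewrite divr_gt0)) /nbhs_ballP[r /= r0 rP].
  near=> x0 s.
  have sr : s < r / 2 by near: s; apply: nbhs_right_lt; exact: divr_gt0.
  have x0r : `|x - x0| < r / 2.
    by near: x0; apply: near_dist; exact: divr_gt0.
  move=> x' xx'.
  have fx0 : `|f x - f x0| < e / 2.
    apply: rP; rewrite -ball_normE /=; apply: lt_le_trans x0r _.
    by rewrite ler_pdivrMr// ler_pMr// ler1n.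
  have fx' : `|f x - f x'| < e / 2.
    apply: rP; rewrite -ball_normE /=.
    rewrite -(subrK x0 x) -addrA (le_lt_trans (ler_normD _ _))//.
    by rewrite [ltRHS]splitr ltrD// (lt_trans xx').
  rewrite -(subrK (f x) (f x0)) -addrA (le_lt_trans (ler_normD _ _))//.
  by rewrite [ltRHS]splitr ltrD// distrC.
move=> h; near (0:R)^'+ => r; exists r; near: r; [exact: nbhs_right_gt|].
by apply: filterS h => s sP x x' Kx; exact: sP.
Unshelve. all: by end_near. Qed.

Lemma continuous_normf (X : topologicalType) (V : normedModType R) (f : X -> V) :
  continuous f -> continuous (fun x => `|f x|).
Proof. by move=> cf x; apply: cvg_norm; exact: cf. Qed.

Lemma closed_preimage (X Y : topologicalType) (f : X -> Y) (A : set Y) :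
  continuous f -> closed A -> closed (f @^-1` A).
Proof. by move=> cf cA; apply: preimage_closed => // x _; exact: cf. Qed.

Lemma closed_dist_le (V : normedModType R) (c : V) (r : R) :
  closed [set b : V | `|b - c| <= r].
Proof.
apply: (closed_preimage (f := fun b : V => `|b - c|) _ (@closed_le _ r)) => b.
by apply: cvg_norm; apply: cvgB; [exact: cvg_id|exact: cvg_cst].
Qed.

Lemma compact_rV_ball m (c : 'rV[R]_m) (r : R) :
  compact [set b : 'rV[R]_m | `|b - c| <= r].
Proof.
apply: bounded_closed_compact.
  exists (`|c| + r); split; first exact: num_real.
  move=> M rM x /= xr; apply/ltW/(le_lt_trans _ rM).
  by rewrite -(subrK c x) addrC (le_trans (ler_normD _ _))// lerD2l.
exact: closed_dist_le.
Qed.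

Lemma compact_rV_unit_ball m : compact [set b : 'rV[R]_m | `|b| <= 1].
Proof.
by have := @compact_rV_ball m 0 1; under eq_fun do rewrite subr0.
Qed.

End Compactness.

(* A map of the unit ball is essential if it cannot be deformed off [0] without
   moving its boundary values. *)
Definition essential (R : realType) (V : normedModType R) (h : V -> V) :=
  forall g : V -> V, continuous g -> (forall b, `|b| = 1 -> g b = h b) ->
  exists2 b, `|b| <= 1 & g b = 0.

Section Brouwer.
Variables (R : realType) (m : nat).
Variable g : 'rV[R]_m -> 'rV[R]_m.

Definition grid_point k (z : nat -> nat) : 'rV[R]_m :=
  \row_i (2 * (z i)%:R / k.+1%:R - 1).

(** [find] returns the length [m] of the enumeration if no coordinate is negative, so the largest
    label marks the points where [g] is nonnegative. *)
Definition sign_label k (z : nat -> nat) : nat :=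
  find (fun i => g (grid_point k z) 0 i < 0) (enum 'I_m).

Lemma grid_point_ball k z : (forall i, (i < m)%N -> (z i <= k.+1)%N) ->
  `|grid_point k z| <= 1.
Proof.
move=> zk; apply/mx_norm_leP => // i j; rewrite mxE ler_norml.
rewrite lerBrDr addrC subrr divr_ge0 ?mulr_ge0//=.
rewrite lerBlDr -[1 + 1]/(2 : R) ler_pdivrMr ?ltr0n// ler_pM2l// ler_nat.
exact: zk.
Qed.

(** The norm is the maximum norm, so a grid point with an extreme coordinate lies on the unit
    sphere; there [g] is the identity and that coordinate of its value is -1 or 1. *)
Lemma sign_label_labelling k : (forall b, `|b| = 1 -> g b = b) ->
  kuhn_labelling (sign_label k) m k.+1.
Proof.
move=> g1 z zk z0.
have k0 : (0 : R) < k.+1%:R by rewrite ltr0n.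
have gle := grid_point_ball zk.
split.
- by rewrite (leq_trans (find_size _ _))// size_enum_ord.
- move=> i im zi; rewrite leqNgt; apply/negP => /(before_find (Ordinal im)).
  rewrite -[X in nth _ _ X]/(nat_of_ord (Ordinal im)) nth_ord_enum.
  have gi : grid_point k z 0 (Ordinal im) = -1.
    by rewrite mxE /= zi mulr0 mul0r sub0r.
  rewrite g1 ?gi ?ltrN10//; apply/eqP; rewrite eq_le gle /=.
  by rewrite (le_trans _ (le_mx_norm _ 0 (Ordinal im)))// gi normrN1.
- move=> i im zi; apply/eqP => fi.
  have : has (fun i => g (grid_point k z) 0 i < 0) (enum 'I_m).
    by rewrite has_find -/(sign_label k z) fi size_enum_ord.
  move=> /(nth_find (Ordinal im)); rewrite -/(sign_label k z) fi.
  rewrite -[X in nth _ _ X]/(nat_of_ord (Ordinal im)) nth_ord_enum.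
  have gi : grid_point k z 0 (Ordinal im) = 1.
    by rewrite mxE /= zi mulfK ?gt_eqF// -[2]/(1 + 1 : R) addrK.
  rewrite g1 ?gi ?ltr10//; apply/eqP; rewrite eq_le gle /=.
  by rewrite (le_trans _ (le_mx_norm _ 0 (Ordinal im)))// gi normr1.
Qed.

Lemma grid_point_dist k (s : kuhn m k.+1) j j' :
  `|grid_point k (vertex s j) - grid_point k (vertex s j')| <= 2 / k.+1%:R.
Proof.
have k0 : (0 : R) < k.+1%:R by rewrite ltr0n.
apply/mx_norm_leP => [|i i']; first by rewrite divr_ge0.
rewrite !mxE opprB addrA subrK -mulrBl -mulrBr !normrM normfV.
rewrite (gtr0_norm k0) ler_pM2r ?invr_gt0// ger0_norm// -[leRHS]mulr1 ler_pM2l//.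
rewrite !vertexE; case: (_ < j)%N; case: (_ < j')%N;
  rewrite ?addn0 ?addn1 ?subrr ?normr0 ?ler01// -natr1.
  by rewrite addrAC subrr add0r normr1.
by rewrite opprD addrA subrr sub0r normrN normr1.
Qed.

End Brouwer.

(** In a fully labelled simplex, [g] is nonnegative at the vertex labelled [m], while each of its
    coordinates is negative at some other vertex. If the mesh is small against the modulus of
    continuity, all coordinates of [g] at the first vertex are less than the minimum [c] of the norm
    of [g], a contradiction. *)
Lemma essential_id_rV (R : realType) m : essential (fun b : 'rV[R]_m => b).
Proof.
move=> g cg g1; apply: contrapT => nz.
have gn0 b : `|b| <= 1 -> `|g b| > 0.
  by move=> b1; rewrite normr_gt0; apply: contra_notN nz => /eqP gb0; exists b.
have [c c0 cP] : exists2 c : R, 0 < c & forall b, `|b| <= 1 -> c <= `|g b|.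
  have [||b /set_mem /= b1 bP] := @compact_EVT_min _ R (fun b => `|g b|)
    [set b : 'rV[R]_m | `|b| <= 1] _ (@compact_rV_unit_ball R m).
  - by exists 0; rewrite /= normr0.
  - by apply: continuous_subspaceT; exact: continuous_normf.
  by exists `|g b|; [exact: gn0|move=> b' b'1; exact/bP/mem_set].
have [r r0 rP] := compact_unif_continuous (@compact_rV_unit_ball R m) cg c0.
have [k kr] : exists k : nat, 2 / k.+1%:R < r.
  exists (Num.trunc (2 / r)).
  rewrite ltr_pdivrMr ?ltr0n// mulrC -ltr_pdivrMr//.
  by have /trunc_itv/andP[] : 0 <= 2 / r by rewrite divr_ge0// ltW.
have lamP := sign_label_labelling (k := k) g1.
have /card_gt0P[s] : (0 < #|full (sign_label g k) m k.+1|)%N.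
  by rewrite lt0n; apply: contraTneq (sperner_kuhn lamP) => ->.
rewrite inE => /andP[_ /forallP sfull].
have gle (j : 'I_m.+1) : `|grid_point R m k (vertex s j)| <= 1.
  apply: grid_point_ball => i im; rewrite (vertexE s j (Ordinal im)).
  by case: (_ < j)%N; rewrite ?addn0 ?addn1//; apply: ltnW.
have /existsP[j0 /eqP lj0] := sfull ord_max.
have := cP _ (gle j0); apply/negP; rewrite -ltNge; apply/mx_norm_ltP => // i0 i.
rewrite ord1 {i0}.
have g0i : 0 <= g (grid_point R m k (vertex s j0)) 0 i.
  rewrite leNgt; apply/negP => gi.
  have : has (fun i => g (grid_point R m k (vertex s j0)) 0 i < 0) (enum 'I_m).
    by apply/hasP; exists i => //; rewrite mem_enum.
  by rewrite has_find -/(sign_label g k _) lj0 size_enum_ord ltnn.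
have /existsP[j /eqP lj] := sfull (widen_ord (leqnSn m) i).
have gi : g (grid_point R m k (vertex s j)) 0 i < 0.
  have : has (fun i => g (grid_point R m k (vertex s j)) 0 i < 0) (enum 'I_m).
    by rewrite has_find -/(sign_label g k _) lj size_enum_ord /=.
  move=> /(nth_find i); rewrite -/(sign_label g k _) lj.
  by rewrite -[X in nth _ _ X]/(nat_of_ord i) nth_ord_enum.
have := rP _ _ (gle j0) (le_lt_trans (grid_point_dist R s j0 j) kr).
move=> /(le_lt_trans (le_mx_norm _ 0 i)); rewrite !mxE.
rewrite !ger0_norm//; last by rewrite subr_ge0 ltW// (lt_le_trans gi).
by apply: le_lt_trans; rewrite lerDl oppr_ge0 ltW.
Qed.

Section Essential.
Variable R : realType.

Lemma continuous_maxf (X : topologicalType) (f g : X -> R) :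
  continuous f -> continuous g -> continuous (fun x => Num.max (f x) (g x)).
Proof. by move=> cf cg x; apply: continuous_max; [exact: cf|exact: cg]. Qed.

Lemma continuous_minf (X : topologicalType) (f g : X -> R) :
  continuous f -> continuous g -> continuous (fun x => Num.min (f x) (g x)).
Proof. by move=> cf cg x; apply: continuous_min; [exact: cf|exact: cg]. Qed.

Lemma continuousDf (X : topologicalType) (V : normedModType R) (f g : X -> V) :
  continuous f -> continuous g -> continuous (fun x => f x + g x).
Proof. by move=> cf cg x; apply: cvgD; [exact: cf|exact: cg]. Qed.

Lemma continuousBf (X : topologicalType) (V : normedModType R) (f g : X -> V) :
  continuous f -> continuous g -> continuous (fun x => f x - g x).
Proof. by move=> cf cg x; apply: cvgB; [exact: cf|exact: cg]. Qed.

Lemma continuousNf (X : topologicalType) (V : normedModType R) (f : X -> V) :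
  continuous f -> continuous (fun x => - f x).
Proof. by move=> cf x; apply: cvgN; exact: cf. Qed.

Lemma continuousZf (X : topologicalType) (V : normedModType R) (k : X -> R)
    (f : X -> V) :
  continuous k -> continuous f -> continuous (fun x => k x *: f x).
Proof. by move=> ck cf x; apply: cvgZ; [exact: ck|exact: cf]. Qed.

Lemma continuousMf (X : topologicalType) (f g : X -> R) :
  continuous f -> continuous g -> continuous (fun x => f x * g x).
Proof. by move=> cf cg x; apply: cvgM; [exact: cf|exact: cg]. Qed.

Lemma continuousVf (X : topologicalType) (f : X -> R) :
  continuous f -> (forall x, f x != 0) -> continuous (fun x => (f x)^-1).
Proof. by move=> cf f0 x; apply: cvgV; [exact: f0|exact: cf]. Qed.

Lemma continuous_pairf (X Y Z : topologicalType) (f : X -> Y) (g : X -> Z) :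
  continuous f -> continuous g -> continuous (fun x => (f x, g x)).
Proof. by move=> cf cg x; apply: cvg_pair; [exact: cf|exact: cg]. Qed.

Lemma continuous_compf (X Y Z : topologicalType) (f : X -> Y) (g : Y -> Z) :
  continuous f -> continuous g -> continuous (fun x => g (f x)).
Proof. by move=> cf cg x; apply: continuous_comp; [exact: cf|exact: cg]. Qed.

Lemma continuous_cstf (X Y : topologicalType) (y : Y) :
  continuous (fun _ : X => y).
Proof. by move=> x; exact: cvg_cst. Qed.

Lemma continuous_idf (X : topologicalType) : continuous (fun x : X => x).
Proof. by move=> x; exact: cvg_id. Qed.

Lemma continuous_fstf (X Y : topologicalType) : continuous (fun p : X * Y => p.1).
Proof. by move=> p; exact: cvg_fst. Qed.

Lemma continuous_sndf (X Y : topologicalType) : continuous (fun p : X * Y => p.2).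
Proof. by move=> p; exact: cvg_snd. Qed.

(** The radial retraction onto the ball of radius [r]. *)
Definition clip (V : normedModType R) (r : R) (x : V) : V :=
  (r / Num.max r `|x|) *: x.

Lemma clip_continuous (V : normedModType R) (r : R) : 0 < r ->
  continuous (@clip V r).
Proof.
move=> r0; have m0 x : Num.max r `|x : V| != 0 by rewrite gt_eqF// lt_max r0.
apply: continuousZf; last exact: continuous_idf.
apply: continuousMf; first exact: continuous_cstf.
apply: continuousVf => //; apply: continuous_maxf; first exact: continuous_cstf.
by apply: continuous_normf; exact: continuous_idf.
Qed.

Lemma clip_id (V : normedModType R) (r : R) (x : V) : 0 < r -> `|x| <= r ->
  clip r x = x.
Proof. by move=> r0 xr; rewrite /clip max_l// divff ?scale1r// gt_eqF. Qed.

Lemma clip_le (V : normedModType R) (r : R) (x : V) : 0 < r -> `|clip r x| <= r.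
Proof.
move=> r0; have m0 : 0 < Num.max r `|x| by rewrite lt_max r0.
have q0 : 0 <= r / Num.max r `|x| by apply: divr_ge0; exact: ltW.
rewrite normrZ ger0_norm// mulrAC ler_pdivrMr// ler_pM2l//.
by rewrite le_max lexx orbT.
Qed.

Lemma clip_ge (V : normedModType R) (r : R) (x : V) : 0 < r -> r <= `|x| ->
  `|clip r x| = r.
Proof.
move=> r0 rx; have m0 : 0 < `|x| by exact: lt_le_trans rx.
have q0 : 0 <= r / `|x| by apply: divr_ge0; exact: ltW.
by rewrite /clip max_r// normrZ ger0_norm// divfK// gt_eqF.
Qed.

(** A map [g] with the boundary values of [H (b, 1)] is shrunk into the ball of radius 1/2, and the
    homotopy is run backwards in the remaining shell. The result has the boundary values of
    [H (b, 0)], and its zeros are not in the shell. *)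
Lemma essential_homotopy (V : normedModType R) (H : V * R -> V) :
  continuous H ->
  (forall b r, `|b| = 1 -> 0 <= r <= 1 -> H (b, r) != 0) ->
  essential (fun b => H (b, 0)) -> essential (fun b => H (b, 1)).
Proof.
move=> cH H0 ess0 g cg g1.
pose s (b : V) : R := Num.max 0 (Num.min 1 (2 - 2 * `|b|)).
pose c (b : V) := clip 1 (2 *: b).
(* In the shell [c b] has norm 1 and the first term cancels the last; in the inner ball [s b] is 1
   and the bracket vanishes. The single formula makes continuity immediate. *)
pose g' (b : V) := g (c b) + (H (c b, s b) - H (c b, 1)).
have cc : continuous c.
  apply: (continuous_compf (g := @clip V 1)); last exact: clip_continuous.
  by apply: continuousZf; [exact: continuous_cstf|exact: continuous_idf].
have cs : continuous s.
  apply: continuous_maxf; first exact: continuous_cstf.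
  apply: continuous_minf; first exact: continuous_cstf.
  apply: continuousBf; first exact: continuous_cstf.
  apply: continuousMf; first exact: continuous_cstf.
  by apply: continuous_normf; exact: continuous_idf.
have cg' : continuous g'.
  apply: continuousDf; first exact: continuous_compf cc cg.
  apply: continuousBf; apply: continuous_compf cH; apply: continuous_pairf => //.
  exact: continuous_cstf.
have n2 (b : V) : `|2 *: b| = 2 * `|b| by rewrite normrZ ger0_norm.
have outer b : 2^-1 <= `|b| -> g' b = H (c b, s b) /\ `|c b| = 1.
  move=> b2; have c1 : `|c b| = 1.
    by apply: clip_ge => //; rewrite n2 mulrC -ler_pdivrMr// mul1r.
  by split=> //; rewrite /g' g1// addrC subrK.
have g1' b : `|b| = 1 -> g' b = H (b, 0).
  move=> b1; have [|-> _] := outer b; first by rewrite b1 invf_le1// ler1n.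
  rewrite /s b1 mulr1 subrr min_r// maxxx /c; congr (H (_, _)).
  rewrite /clip max_r; last by rewrite n2 b1 mulr1 ler1n.
  by rewrite n2 b1 mulr1 mul1r scalerA mulVf ?scale1r.
have [b b1 gb0] := ess0 g' cg' g1'.
have [b2|b2] := leP (2^-1) `|b|.
  have [e c1] := outer b b2; move/eqP: gb0; rewrite e (negbTE (H0 _ _ c1 _))//.
  by rewrite /s le_max lexx ge_max ler01 ge_min lexx.
exists (c b); first exact: clip_le.
move: gb0; rewrite /g' /s (min_l (y := 2 - _)); last first.
  rewrite lerBrDr -lerBrDl -[2 - 1]/(1 + 1 - 1) addrK mulrC -ler_pdivlMr// mul1r.
  exact: ltW.
by rewrite max_r// subrr addr0.
Qed.

Lemma essential_segment (V : normedModType R) (h h' : V -> V) :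
  continuous h -> continuous h' ->
  (forall b r, `|b| = 1 -> 0 <= r <= 1 -> (1 - r) *: h b + r *: h' b != 0) ->
  essential h -> essential h'.
Proof.
move=> ch ch' hh' eh.
pose H (p : V * R) := (1 - p.2) *: h p.1 + p.2 *: h' p.1.
have e0 : (fun b => H (b, 0)) = h.
  by apply/funext => b; rewrite /H/= subr0 scale1r scale0r addr0.
have e1 : (fun b => H (b, 1)) = h'.
  by apply/funext => b; rewrite /H/= subrr scale1r scale0r add0r.
rewrite -e1; apply: essential_homotopy; rewrite ?e0//.
apply: continuousDf; apply: continuousZf.
- by apply: continuousBf; [exact: continuous_cstf|exact: continuous_sndf].
- exact: continuous_compf (@continuous_fstf _ _) ch.
- exact: continuous_sndf.
- exact: continuous_compf (@continuous_fstf _ _) ch'.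
Qed.

Lemma continuous_coordf (X : topologicalType) m n (f : X -> 'M[R]_(m, n)) i j :
  continuous f -> continuous (fun x => f x i j).
Proof.
move=> cf; apply: (continuous_compf (g := fun M : 'M[R]_(m, n) => M i j)) => //.
exact: coord_continuous.
Qed.

Lemma continuous_mxP (X : topologicalType) m n (f : X -> 'M[R]_(m, n)) :
  (forall i j, continuous (fun x => f x i j)) -> continuous f.
Proof.
move=> cf x; apply/cvgrPdist_lt => e e0.
have : \forall y \near x, forall ij : 'I_m * 'I_n,
    `|f x ij.1 ij.2 - f y ij.1 ij.2| < e.
  apply: filter_forall => -[i j] /=.
  by have /cvgrPdist_lt := cf i j x; apply.
apply: filterS => y h; apply/mx_norm_ltP => // i j; rewrite !mxE.
exact: (h (i, j)).
Qed.

Lemma essential_id_rV_prod d :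
  essential (fun b : ('rV[R]_d * R)%type => b).
Proof.
move=> g cg g1.
pose psi (w : 'rV[R]_(d + 1)) : ('rV[R]_d * R)%type := (lsubmx w, rsubmx w 0 0).
pose phi (b : ('rV[R]_d * R)%type) : 'rV[R]_(d + 1) := row_mx b.1 (const_mx b.2).
have phiK : cancel phi psi.
  by case=> a t; rewrite /psi /phi row_mxKl row_mxKr mxE.
have psiK : cancel psi phi.
  move=> w; rewrite /phi /= -[RHS]hsubmxK; congr row_mx.
  by apply/matrixP => i j; rewrite !ord1 mxE.
have cpsi : continuous psi.
  apply: continuous_pairf.
    apply: continuous_mxP => i j.
    rewrite (_ : (fun x => _) = fun w : 'rV[R]_(d + 1) => w i (lshift 1 j)).
      by apply: continuous_coordf; exact: continuous_idf.
    by apply/funext => w; rewrite mxE.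
  rewrite (_ : (fun x => _) = fun w : 'rV[R]_(d + 1) => w 0 (rshift d 0)).
    by apply: continuous_coordf; exact: continuous_idf.
  by apply/funext => w; rewrite mxE.
have cphi : continuous phi.
  apply: continuous_mxP => i j; case: (split_ordP j) => k ->.
    rewrite (_ : (fun x => _) = fun b : 'rV[R]_d * R => b.1 i k).
      by apply: continuous_coordf; exact: continuous_fstf.
    by apply/funext => b; rewrite row_mxEl.
  rewrite (_ : (fun x => _) = fun b : 'rV[R]_d * R => b.2).
    exact: continuous_sndf.
  by apply/funext => b; rewrite row_mxEr mxE.
have psiN w : `|psi w| = `|w|.
  apply/eqP; rewrite eq_le; apply/andP; split.
    rewrite prod_normE ge_max /=; apply/andP; split.
      by apply/mx_norm_leP => // i j; rewrite mxE; exact: le_mx_norm.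
    by rewrite mxE; exact: le_mx_norm.
  apply/mx_norm_leP => // i j; rewrite prod_normE le_max ord1.
  case: (split_ordP j) => k -> /=; apply/orP; [left|right].
    by have := le_mx_norm (lsubmx w) 0 k; rewrite mxE.
  by rewrite mxE ord1.
have [||w w1 gw] := @essential_id_rV R (d + 1) (fun w => phi (g (psi w))).
- exact: continuous_compf (continuous_compf cpsi cg) cphi.
- by move=> w w1; rewrite g1 ?psiN// psiK.
exists (psi w); first by rewrite psiN.
apply: (can_inj phiK); rewrite gw; apply/rowP => j; rewrite /phi /=.
by case: (split_ordP j) => k ->; rewrite ?row_mxEl ?row_mxEr !mxE.
Qed.

Lemma continuous_sumf (X : topologicalType) (V : normedModType R) (I : Type)
    (r : seq I) (f : I -> X -> V) :
  (forall i, continuous (f i)) -> continuous (fun x => \sum_(i <- r) f i x).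
Proof.
move=> cf; elim: r => [|i r IH].
  rewrite (_ : (fun x => _) = fun=> 0); first exact: continuous_cstf.
  by apply/funext => x; rewrite big_nil.
rewrite (_ : (fun x => _) = fun x => f i x + \sum_(i <- r) f i x).
  exact: continuousDf.
by apply/funext => x; rewrite big_cons.
Qed.

Lemma continuous_bigmaxf (X : topologicalType) (I : Type)
    (r : seq I) (f : I -> X -> R) :
  (forall i, continuous (f i)) ->
  continuous (fun x => \big[Num.max/0]_(i <- r) f i x).
Proof.
move=> cf; elim: r => [|i r IH].
  rewrite (_ : (fun x => _) = fun=> 0); first exact: continuous_cstf.
  by apply/funext => x; rewrite big_nil.
rewrite (_ : (fun x => _) = fun x => Num.max (f i x) (\big[Num.max/0]_(i <- r) f i x)).
  exact: continuous_maxf.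
by apply/funext => x; rewrite big_cons.
Qed.

End Essential.

(** * Approximation by maps without zeros on a sphere *)

(** Only the eigenvalues of the matrices [- A i] have to be avoided, and the product of their
    characteristic polynomials has fewer roots than there are candidates for [h]. *)
Lemma small_nonsingular_shift (R : realType) d (F : finType) (A : F -> 'M[R]_d) (e : R) :
  0 < e -> exists2 h : R, 0 < h < e &
    forall (i : F) (x : 'rV[R]_d), x *m (A i + h%:M) = 0 -> x = 0.
Proof.
move=> e0; pose P := \prod_(i : F) char_poly (- A i).
have P0 : P != 0 by apply/prodf_neq0 => i _; rewrite monic_neq0// char_poly_monic.
pose rs := [seq e / k.+2%:R | k <- iota 0 (size P)].
have rs_uniq : uniq rs.
  rewrite map_inj_uniq ?iota_uniq// => k k' /(mulfI (lt0r_neq0 e0))/invr_inj/eqP.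
  by rewrite eqr_nat => /eqP[].
have /allPn[h /mapP[k _ hk] hP] : ~~ all (root P) rs.
  apply/negP => ar; have := max_poly_roots P0 ar rs_uniq.
  by rewrite size_map size_iota ltnn.
exists h.
  by rewrite hk divr_gt0// ltr_pdivrMr// ltr_pMr// ltr1n.
move=> i x xA; apply/eqP; apply: contraNT hP => x0.
have : root (char_poly (- A i)) h.
  rewrite -eigenvalue_root_char; apply/eigenvalueP; exists x => //.
  move: xA; rewrite mulmxDr mul_mx_scalar => /eqP; rewrite addr_eq0 => /eqP xA.
  by rewrite mulmxN xA opprK.
by rewrite !rootE /P (bigD1 i)//= hornerM => /eqP ->; rewrite mul0r.
Qed.

Section KuhnHats.
Variables (R : realType) (d : nat).

Definition spread (y : 'rV[R]_d) : R :=
  \big[Num.max/0]_i y 0 i + \big[Num.max/0]_i - y 0 i.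

(** The piecewise linear function on the Kuhn triangulation of the integer lattice that is 1 at the
    origin and 0 at the other vertices; [spread] is the norm whose unit ball is the star of the
    origin. *)
Definition hat (y : 'rV[R]_d) : R := Num.max 0 (1 - spread y).

Lemma hat_ge0 y : 0 <= hat y. Proof. by rewrite le_max lexx. Qed.

Lemma hat_continuous : continuous hat.
Proof.
apply: continuous_maxf; first exact: continuous_cstf.
apply: continuousBf; first exact: continuous_cstf.
apply: continuousDf; apply: continuous_bigmaxf => i.
  by apply: continuous_coordf; exact: continuous_idf.
by apply: continuousNf; apply: continuous_coordf; exact: continuous_idf.
Qed.

Lemma hat_gt0P (y : 'rV[R]_d) : 0 < hat y ->
  (forall i, `|y 0 i| < 1) /\ (forall i j, y 0 i - y 0 j < 1).
Proof.
rewrite lt_max ltxx /= subr_gt0 /spread => y1.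
have a0 : 0 <= \big[Num.max/0]_i y 0 i by exact: bigmax_ge_id.
have b0 : 0 <= \big[Num.max/0]_i - y 0 i by exact: bigmax_ge_id.
have ai i : y 0 i <= \big[Num.max/0]_i y 0 i.
  by apply: (le_bigmax _ (fun i => y 0 i)).
have bi i : - y 0 i <= \big[Num.max/0]_i - y 0 i.
  by apply: (le_bigmax _ (fun i => - y 0 i)).
split=> [i|i j].
  by rewrite ltr_norml; have := ai i; have := bi i; lra.
by have := ai i; have := bi j; lra.
Qed.

Lemma hat_gt0 (y : 'rV[R]_d) : (forall i, 0 <= y 0 i < 1) -> 0 < hat y.
Proof.
move=> yi; rewrite lt_max ltxx /= subr_gt0 /spread.
rewrite [X in _ + X](_ : _ = 0) ?addr0.
  by apply: bigmax_lt => // i _; have /andP[] := yi i.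
apply/eqP; rewrite eq_le bigmax_ge_id andbT; apply: bigmax_le => // i _.
by rewrite oppr_le0; have /andP[] := yi i.
Qed.

End KuhnHats.

Lemma int_lt1 (R : realType) (a b : int) : `|a%:~R - b%:~R| < 1 :> R -> a = b.
Proof.
rewrite -intrB -intr_norm -[1]/(1%:~R : R) ltr_int => ab.
by apply/eqP; rewrite -subr_eq0 -normr_eq0; lia.
Qed.

Section KuhnActive.
Variables (R : realType) (d : nat).
Implicit Types (y : 'rV[R]_d) (z : {ffun 'I_d -> int}).

Definition lattice_point z : 'rV[R]_d := \row_i (z i)%:~R.

Definition active y z := 0 < hat (y - lattice_point z).

Lemma active_near y z i : active y z -> `|y 0 i - (z i)%:~R| < 1.
Proof. by move=> /hat_gt0P[/(_ i) + _]; rewrite !mxE. Qed.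

(** The active lattice points are thus totally ordered: adding the two inequalities of [hat_gt0P]
    bounds by 2 a sum of two integers that are each at least 1. *)
Lemma active_chain y z z' i j : active y z -> active y z' ->
  (z i < z' i)%R -> (z' j < z j)%R -> False.
Proof.
move=> /hat_gt0P[_ /(_ i j)] + /hat_gt0P[_ /(_ j i)]; rewrite !mxE.
have h a b : (a < b)%R -> (a%:~R + 1 <= b%:~R :> R).
  by move=> ab; rewrite -[1]/(1%:~R : R) -intrD ler_int lezD1.
by move=> + + /h zi /h zj; lra.
Qed.

(* On a face of a lattice cube the active lattice points form a chain of length
   at most [d], so that [d] colors suffice to tell them apart. *)
Lemma active_color y z z' i0 (a : int) : y 0 i0 = a%:~R ->
  active y z -> active y z' ->
  (\sum_i z i = \sum_i z' i %[mod d])%Z -> z = z'.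
Proof.
move=> ya az az' ezz'.
wlog le : z z' az az' ezz' / forall i, (z i <= z' i)%R.
  move=> W; case: (pselect (forall i, (z i <= z' i)%R)) => [|/existsNP[i /negP]].
    exact: W.
  rewrite -ltNge => zi; apply/esym; apply: W => // j.
  by rewrite leNgt; apply/negP => zj; apply: (active_chain az az' zj zi).
have zz' i : (z' i - z i < 2)%R.
  rewrite -(@ltr_int R) intrB -[X in _ < X]/(2 : R).
  have := active_near i az; have := active_near i az'.
  by rewrite !ltr_norml => /andP[h1 h2] /andP[h3 h4]; lra.
have zi0 : z i0 = z' i0.
  have /int_lt1 <- : `|a%:~R - (z i0)%:~R| < 1 :> R.
    by rewrite -ya; exact: active_near az.
  by apply: (@int_lt1 R); rewrite -ya; exact: active_near az'.
have d0 : (0 < d)%N by exact: leq_ltn_trans (leq0n _) (ltn_ord i0).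
(* Each coordinate of the difference is 0 or 1, and that of index [i0] is 0; so [D] lies between 0
   and [d.-1], and divisibility by [d] makes it 0. *)
pose D := \sum_i (z' i - z i).
have D0 : 0 <= D by apply: sumr_ge0 => i _; rewrite subr_ge0.
have Dd : D < d%:Z.
  rewrite /D (bigD1 i0)//= zi0 subrr add0r.
  apply: (@le_lt_trans _ _ (\sum_(i < d | i != i0) 1)).
    by apply: ler_sum => i _; have := zz' i; lia.
  rewrite sumr_const (_ : #|_| = d.-1); last by rewrite cardC1 card_ord.
  by move: d0; case: (d) => // n _; rewrite -[_ *+ _]/(n%:R) natz ltz_nat ltnS.
have : (d %| D)%Z.
  rewrite /D sumrB; move/eqP: ezz'; rewrite eqz_mod_dvd.
  by rewrite -opprB dvdzE abszN.
move=> /dvdzP[q Dq].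
have D00 : D = 0.
  have q0 : q = 0 by move: D0 Dd; rewrite Dq; nia.
  by rewrite Dq q0 mul0r.
apply/ffunP => i; have /eqP := D00; rewrite /D psumr_eq0; last first.
  by move=> j _; rewrite subr_ge0.
by move=> /allP/(_ i (mem_index_enum _)); rewrite /= subr_eq0 => /eqP.
Qed.

Lemma active_floor y : active y [ffun i => Num.floor (y 0 i)].
Proof.
apply: hat_gt0 => i; rewrite !mxE ffunE subr_ge0 floor_le /=.
by rewrite ltrBlDl; have := floorD1_gt (y 0 i); rewrite intrD.
Qed.

End KuhnActive.

Section Approximation.
Variables (R : realType) (d : nat).

(** Interpolate [sg] between the points of a fine lattice, after adding to the value at each of them
    [h] times the basis vector of its colour. For the maximum norm a point of the unit sphere lies
    on a face of a lattice cube, so its active lattice points have distinct colours; for a generic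
    [h] the perturbed values at these points are linearly independent, and no combination with
    positive weights vanishes. *)
Lemma avoiding_approximation (sg : 'rV[R]_d.+1 -> 'rV[R]_d.+1) (M e : R) :
  continuous sg -> 1 <= M -> 0 < e -> exists sg1 : 'rV[R]_d.+1 -> 'rV[R]_d.+1,
  [/\ continuous sg1, forall w, `|w| <= M -> `|sg1 w - sg w| < e &
      forall w, `|w| = 1 -> sg1 w != 0].
Proof.
move=> csg M1 e0; have M0 : 0 < M by exact: lt_le_trans M1.
have e20 : 0 < e / 2 by rewrite divr_gt0.
have cB : compact [set b : 'rV[R]_d.+1 | `|b| <= M].
  by have := @compact_rV_ball R d.+1 0 M; under eq_fun do rewrite subr0.
have [r r0 rP] := compact_unif_continuous cB csg e20.
pose k := (Num.trunc r^-1).+1.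
have k0 : (0 : R) < k%:R by rewrite ltr0n.
have kr : k%:R^-1 < r.
  rewrite -[ltRHS]invrK ltf_pV2 ?posrE ?invr_gt0//.
  by have /trunc_itv/andP[] : 0 <= r^-1 by rewrite invr_ge0 ltW.
pose N := (Num.trunc (k%:R * M)).+1.
have kMN : k%:R * M < N%:R.
  by have /trunc_itv/andP[] : 0 <= k%:R * M by rewrite mulr_ge0 ?ltW.
pose Z := {ffun 'I_d.+1 -> 'I_(2 * N).+1}.
pose zi (z : Z) : {ffun 'I_d.+1 -> int} := [ffun i => (z i)%:Z - N%:Z].
pose a (z : Z) := sg (k%:R^-1 *: lattice_point R (zi z)).
have colP (z : Z) : (absz ((\sum_i zi z i) %% d.+1)%Z < d.+1)%N.
  rewrite -ltz_nat gez0_abs ?modz_ge0//; exact: ltz_pmod.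
pose col z : 'I_d.+1 := Ordinal (colP z).
(* [E] selects for each colour a lattice point or none. There are finitely many selections, so one
   [h] is good for all of them, and hence for every [w]. *)
pose A (E : {ffun 'I_d.+1 -> option Z}) : 'M[R]_d.+1 :=
  \matrix_(i, j) oapp (fun z => a z 0 j) 0 (E i).
have [h /andP[h0 he] hA] := small_nonsingular_shift A e20.
pose b z := a z + h *: delta_mx 0 (col z).
pose S (w : 'rV[R]_d.+1) := \sum_z hat (k%:R *: w - lattice_point R (zi z)) *: b z.
pose T (w : 'rV[R]_d.+1) := \sum_z hat (k%:R *: w - lattice_point R (zi z)).
have ch z : continuous (fun w : 'rV[R]_d.+1 => hat (k%:R *: w - lattice_point R (zi z))).
  apply: (continuous_compf (g := @hat R d.+1)); last exact: hat_continuous.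
  apply: continuousBf; last exact: continuous_cstf.
  by apply: continuousZf; [exact: continuous_cstf|exact: continuous_idf].
have cS : continuous S.
  apply: continuous_sumf => z; apply: continuousZf => //; exact: continuous_cstf.
have cT : continuous T by exact: continuous_sumf.
have act w : `|w| <= M -> exists z, active (k%:R *: w) (zi z).
  move=> wM; have fl i : `|Num.floor (k%:R * w 0 i)| <= N%:Z.
    have : `|k%:R * w 0 i| < N%:R.
      rewrite normrM (gtr0_norm k0); apply: le_lt_trans kMN.
      by rewrite ler_pM2l// (le_trans (le_mx_norm _ _ _)).
    rewrite ltr_norml => /andP[h1 h2]; rewrite ler_norml; apply/andP; split.
      by rewrite floor_ge_int mulrNz; exact: ltW.
    by rewrite -(@ler_int R) (le_trans (floor_le _))// ltW.
  pose z : Z := [ffun i => inord (absz (Num.floor (k%:R * w 0 i) + N%:Z))].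
  exists z; rewrite (_ : zi z = [ffun i => Num.floor ((k%:R *: w) 0 i)]).
    exact: active_floor.
  apply/ffunP => i; rewrite !ffunE mxE; have := fl i.
  move: (Num.floor _) => q; clear; rewrite ler_norml => /andP[q1 q2].
  have q0 : 0 <= q + N%:Z by rewrite -lerBlDr sub0r.
  rewrite inordK; first by rewrite gez0_abs// addrK.
  by rewrite -ltz_nat gez0_abs// -addn1 PoszD ltzD1 mul2n -addnn PoszD lerD2r.
have T0 w : `|w| <= M -> 0 < T w.
  move=> /act[z za]; rewrite /T (bigD1 z)//= ltr_pwDl//.
  by apply: sumr_ge0 => ? _; exact: hat_ge0.
pose sg1 w := (T (clip M w))^-1 *: S (clip M w).
have cc : continuous (@clip _ 'rV[R]_d.+1 M) by exact: clip_continuous.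
exists sg1; split.
- apply: continuousZf; last exact: continuous_compf cc cS.
  apply: continuousVf; first exact: continuous_compf cc cT.
  by move=> w; rewrite gt_eqF// T0// clip_le.
- move=> w wM; rewrite /sg1 clip_id//.
  have Tw := T0 _ wM.
  have -> : (T w)^-1 *: S w - sg w =
     (T w)^-1 *: \sum_z hat (k%:R *: w - lattice_point R (zi z)) *: (b z - sg w).
    rewrite -[X in _ - X](scalerK (lt0r_neq0 Tw)) -scalerBr; congr (_ *: _).
    rewrite /S [in X in _ - X]/T scaler_suml -sumrB.
    by apply: eq_bigr => z _; rewrite scalerBr.
  rewrite normrZ gtr0_norm ?invr_gt0// mulrC ltr_pdivrMr//.
  apply: (@le_lt_trans _ _ (\sum_z hat (k%:R *: w - lattice_point R (zi z)) * (e / 2 + h))).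
    apply: (le_trans (ler_norm_sum _ _ _)); apply: ler_sum => z _.
    rewrite normrZ ger0_norm ?hat_ge0//.
    have := hat_ge0 (k%:R *: w - lattice_point R (zi z)).
    rewrite le_eqVlt => /orP[/eqP <-|za]; first by rewrite !mul0r.
    rewrite ler_pM2l// /b addrAC (le_trans (ler_normD _ _))// lerD//.
      rewrite distrC; apply/ltW/rP => //.
      apply: le_lt_trans kr; apply/mx_norm_leP => [|i j]; first by rewrite invr_ge0 ltW.
      rewrite ord1 !mxE -[w 0 j](mulKf (lt0r_neq0 k0)) -mulrBr normrM.
      rewrite gtr0_norm ?invr_gt0// ler_piMr ?invr_ge0 ?(ltW k0)//.
      by apply/ltW; have := active_near j za; rewrite mxE.
    rewrite normrZ gtr0_norm// ler_piMr ?(ltW h0)//.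
    by apply/mx_norm_leP => // i j; rewrite mxE; case: (_ && _); rewrite ?normr1 ?normr0.
  rewrite -mulr_suml mulrC ltr_pM2r//.
  by rewrite [ltRHS]splitr ltrD2l.
- move=> w w1; have wM : `|w| <= M by rewrite w1.
  rewrite /sg1 clip_id// scaler_eq0 invr_eq0 gt_eqF ?T0//=.
  apply/eqP => Sw.
  have [i0 wi0] : exists i0, `|w 0 i0| = 1.
    apply: contrapT => /forallNP no.
    have : `|w| < 1.
      apply/mx_norm_ltP => // i j; rewrite ord1 lt_neqAle.
      by rewrite (introN eqP (no j)) -w1 le_mx_norm.
    by rewrite w1 ltxx.
  have [c yc] : exists c : int, (k%:R *: w) 0 i0 = c%:~R.
    rewrite mxE; have [w0|w0] := leP 0 (w 0 i0).
      by exists k%:Z; move: wi0; rewrite ger0_norm// => ->; rewrite mulr1.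
    exists (- k%:Z); move: wi0; rewrite ltr0_norm// => wi.
    rewrite -[w 0 i0]opprK wi; by rewrite mulrN1 mulrNz.
  have [z0 z0a] := act w wM.
  have col_inj z z' : active (k%:R *: w) (zi z) -> active (k%:R *: w) (zi z') ->
      col z = col z' -> z = z'.
    move=> za za' /(congr1 val)/= ec.
    have /ffunP ezi : zi z = zi z'.
      apply: (active_color yc za za').
      by rewrite -[LHS]gez0_abs ?modz_ge0// -[RHS]gez0_abs ?modz_ge0// ec.
    apply/ffunP => i; apply: val_inj; by have := ezi i; rewrite !ffunE /= => /addIr[].
  pose actb z := active (k%:R *: w) (zi z).
  pose E : {ffun 'I_d.+1 -> option Z} := [ffun i => [pick z | actb z && (col z == i)]].
  pose x : 'rV[R]_d.+1 := \row_i oapp (fun z => hat (k%:R *: w - lattice_point R (zi z))) 0 (E i).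
  (* As each colour occurs at most once among the active points, the sum over these points is a sum
     over colours, that is, a combination of the rows of [A E + h%:M]. *)
  have xS : x *m (A E + h%:M) = S w.
    rewrite /S (bigID actb)/= [X in _ = _ + X]big1 ?addr0; last first.
      move=> z; rewrite /actb /active -leNgt => z0'.
      rewrite (_ : hat _ = 0) ?scale0r//; apply/eqP.
      by rewrite eq_le hat_ge0 andbT.
    rewrite (partition_big col predT)//= mulmx_sum_row; apply: eq_bigr => i _.
    rewrite mxE /E ffunE; case: pickP => [z /andP[za /eqP zc]|no] /=; last first.
      by rewrite scale0r big_pred0// => z; have := no z.
    rewrite (big_pred1 z) => [|z']; last first.
      apply/andP/eqP => [[za' /eqP zc']|->]; last by rewrite zc.
      by apply: col_inj => //; rewrite zc.
    congr (_ *: _); apply/rowP => j; rewrite !mxE /E ffunE.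
    case: pickP => [z' /andP[za' /eqP zc']|/(_ z)]; last by rewrite za zc eqxx.
    have -> : z' = z by apply: col_inj => //; rewrite zc zc'.
    by rewrite /= zc eq_sym mulr_natr.
  have x0 := hA E x (etrans xS Sw).
  have := congr1 (fun x : 'rV[R]_d.+1 => x 0 (col z0)) x0; rewrite !mxE /E ffunE.
  case: pickP => [z /andP[za /eqP zc]|/(_ z0)]; last by rewrite /actb z0a eqxx.
  by rewrite (col_inj z z0)//= => z00; move: z0a; rewrite /active z00 ltxx.
Qed.

End Approximation.

(* If the value [c] were missed, pushing the image radially away from [c] onto
   the sphere of radius [r], where an approximation of [sg] has no zeros, would
   deform [sg \o f] off [0]. *)
Lemma essential_comp_surj (R : realType) d (f sg : 'rV[R]_d -> 'rV[R]_d)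
    (c : 'rV[R]_d) (r : R) : 0 < r -> continuous f -> continuous sg ->
  (forall v, `|v| <= 1 -> sg (f v) = 0 -> `|f v - c| < r) ->
  (forall v, `|v| = 1 -> r < `|f v - c|) ->
  essential (fun v => sg (f v)) -> exists2 v, `|v| <= 1 & f v = c.
Proof.
case: d f sg c => [|d] f sg c r0 cf csg fr f1 ess.
  by exists 0; rewrite ?normr0//; apply/rowP => -[].
apply: contrapT => nf.
have nfc v : `|v| <= 1 -> f v != c by move=> v1; apply/eqP => fv; apply: nf; exists v.
pose B : set 'rV[R]_d.+1 := [set v | `|v| <= 1].
have cB : compact B := @compact_rV_unit_ball R d.+1.
have [M M0 fM] : exists2 M : R, 0 < M & forall v, B v -> `|f v - c| <= M.
  have [||v _ vP] := @compact_EVT_max _ R (fun v => `|f v - c|) B _ cB.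
  - by exists 0; rewrite /B /= normr0.
  - apply: continuous_subspaceT; apply: continuous_normf.
    by apply: continuousBf => //; exact: continuous_cstf.
  exists (`|f v - c| + 1) => [|w Bw]; first by rewrite ltr_wpDl.
  by rewrite (le_trans (vP _ (mem_set Bw)))// lerDl.
pose A := [set v | B v /\ r <= `|f v - c|].
have [e e0 eP] : exists2 e : R, 0 < e & forall v, A v -> e <= `|sg (f v)|.
  have [A0|A0] := pselect (A !=set0); last by exists 1 => // v Av; exfalso; apply: A0; exists v.
  have cA : compact A.
    apply: (subclosed_compact _ cB); last by move=> v [].
    rewrite (_ : A = B `&` (fun v => `|f v - c|) @^-1` [set x | r <= x]) //.
    apply: closedI.
      by apply: compact_closed cB; exact: norm_hausdorff.
    apply: closed_preimage; last exact: closed_ge.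
    by apply: continuous_normf; apply: continuousBf => //; exact: continuous_cstf.
  have [|v /set_mem[v1 vr] vP] := @compact_EVT_min _ R (fun v => `|sg (f v)|) A A0 cA.
    by apply: continuous_subspaceT; apply: continuous_normf; exact: continuous_compf csg.
  exists `|sg (f v)|; last by move=> w Aw; exact/vP/mem_set.
  by rewrite normr_gt0; apply/eqP => /(fr v v1); rewrite ltNge vr.
have c0 : continuous (fun w : 'rV[R]_d.+1 => c + r *: w).
  apply: continuousDf; first exact: continuous_cstf.
  by apply: continuousZf; [exact: continuous_cstf|exact: continuous_idf].
(* The substitution [w |-> c + r *: w] turns the sphere of radius [r] around [c] into the unit
   sphere and the image of [f] into a part of the ball of radius [M / r], where the approximation
   has to hold. *)
have M'1 : 1 <= Num.max 1 (M / r) by rewrite le_max lexx.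
have [h [ch hsg h0]] := avoiding_approximation (continuous_compf c0 csg) M'1 e0.
pose sg1 w := h (r^-1 *: (w - c)).
have c1 : continuous (fun w : 'rV[R]_d.+1 => r^-1 *: (w - c)).
  apply: continuousZf; first exact: continuous_cstf.
  by apply: continuousBf; [exact: continuous_idf|exact: continuous_cstf].
have csg1 : continuous sg1 by exact: continuous_compf c1 ch.
have rK w : c + r *: (r^-1 *: (w - c)) = w.
  by rewrite scalerA divff ?gt_eqF// scale1r addrC subrK.
have nr w : `|r^-1 *: (w - c)| = `|w - c| / r.
  by rewrite normrZ gtr0_norm ?invr_gt0// mulrC.
have sg1sg v : B v -> `|sg1 (f v) - sg (f v)| < e.
  move=> Bv; rewrite -[X in sg X](rK (f v)); apply: hsg.
  by rewrite nr le_max ler_pM2r ?invr_gt0// fM// orbT.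
have sg10 w : `|w - c| = r -> sg1 w != 0.
  by move=> wr; apply: h0; rewrite nr wr divff// gt_eqF.
(* On the unit sphere [sg (f v)] has norm at least [e], more than the error of the approximation, so
   the segment between the two maps avoids 0. *)
have ess1 : essential (fun v => sg1 (f v)).
  apply: (essential_segment (continuous_compf cf csg) (continuous_compf cf csg1) _ ess).
  move=> v t v1 /andP[t0 t1]; apply/eqP => E0.
  have Bv : B v by rewrite /B /= v1.
  have := eP v (conj Bv (ltW (f1 v v1))); apply/negP; rewrite -ltNge.
  have -> : sg (f v) = - (t *: (sg1 (f v) - sg (f v))).
    apply/eqP; rewrite -addr_eq0 -[X in _ == X]E0.
    by rewrite scalerBr scalerBl scale1r addrA addrAC.
  rewrite normrN normrZ ger0_norm//.
  apply: le_lt_trans (sg1sg v Bv); by rewrite ler_piMl.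
pose u v := f (clip 1 v) - c.
have cu : continuous u.
  apply: continuousBf; last exact: continuous_cstf.
  by apply: continuous_compf cf; exact: clip_continuous.
have u0 v : 0 < `|u v|.
  by rewrite normr_gt0 subr_eq0 nfc// clip_le.
pose g v := sg1 (c + Num.max 1 (r / `|u v|) *: u v).
have cg : continuous g.
  apply: continuous_compf csg1; apply: continuousDf; first exact: continuous_cstf.
  apply: continuousZf => //; apply: continuous_maxf; first exact: continuous_cstf.
  apply: continuousMf; first exact: continuous_cstf.
  apply: continuousVf; first exact: continuous_normf.
  by move=> v; rewrite gt_eqF.
have [v1|v v1 gv] := ess1 g cg.
  move=> v1'; rewrite /g /u clip_id ?v1'// max_l ?scale1r; last first.
    rewrite ler_pdivrMr ?mul1r; first by exact/ltW/f1.
    exact: lt_trans (f1 _ v1').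
  by rewrite addrC subrK.
have Bv : B v by [].
have [ur|ur] := leP r `|u v|.
  move: gv; rewrite /g max_l ?scale1r; last by rewrite ler_pdivrMr ?mul1r.
  rewrite /u clip_id// addrC subrK => sv0.
  have := sg1sg v Bv; rewrite sv0 sub0r normrN ltNge eP//; split => //.
  by move: ur; rewrite /u clip_id.
move/eqP: gv; rewrite /g max_r ?(negbTE (sg10 _ _))//; last first.
  by rewrite ler_pdivlMr// mul1r ltW.
rewrite addrC addKr normrZ ger0_norm ?divfK ?gt_eqF//.
by apply: divr_ge0 => //; exact: ltW.
Qed.

(** * Definite forms and tensors *)

Section Definite.
Variables (R : realType) (n : nat).
Implicit Types (q s x : 'M[R]_n) (l k : 'rV[R]_n).

Definition qform s l : R := (l *m s *m l^T) 0 0.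

Lemma qformD s x l : qform (s + x) l = qform s l + qform x l.
Proof. by rewrite /qform mulmxDr mulmxDl mxE. Qed.

Lemma qformZ (a : R) s l : qform (a *: s) l = a * qform s l.
Proof. by rewrite /qform -scalemxAr -scalemxAl mxE. Qed.

Lemma qformN s l : qform (- s) l = - qform s l.
Proof. by rewrite -scaleN1r qformZ mulN1r. Qed.

Lemma qform_scale s (a : R) l : qform s (a *: l) = a ^+ 2 * qform s l.
Proof.
by rewrite /qform linearZ /= -!scalemxAl -scalemxAr scalerA mxE expr2.
Qed.

Lemma qform_sum s l : qform s l = \sum_i \sum_j l 0 i * s i j * l 0 j.
Proof.
rewrite /qform mxE exchange_big; apply: eq_bigr => j _.
by rewrite !mxE mulr_suml.
Qed.

Definition bform s l k : R := (l *m s *m k^T) 0 0.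

Lemma bform_delta s l i : bform s l (delta_mx 0 i) = (l *m s) 0 i.
Proof. by rewrite /bform trmx_delta -colE mxE. Qed.

Lemma bform_sym s l k : s^T = s -> bform s l k = bform s k l.
Proof.
by move=> sT; rewrite /bform -[l *m s *m k^T]trmxK mxE !trmx_mul trmxK sT mulmxA.
Qed.

Lemma qformD_scale s l (a : R) k : s^T = s ->
  qform s (l + a *: k) = qform s l + 2 * a * bform s l k + a ^+ 2 * qform s k.
Proof.
move=> sT; have e : qform s (l + a *: k) =
    bform s l l + a * bform s l k + (a * bform s k l + a * (a * bform s k k)).
  rewrite /qform /bform linearD /= linearZ /= !mulmxDl !mulmxDr.
  by rewrite -!scalemxAl -!scalemxAr !mxE !mulrA.
rewrite e (bform_sym k l sT) /qform -/(bform s l l) -/(bform s k k); ring.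
Qed.

Lemma qform_delta s i : qform s (delta_mx 0 i) = s i i.
Proof. by rewrite -[LHS]/(bform s _ _) bform_delta -rowE mxE. Qed.

Lemma positive_formP q : positive_form q <-> positive_tensors q.
Proof.
split=> -[qT q0]; split=> // v v0.
  have := q0 v^T; rewrite trmxK; apply.
  by apply: contra v0 => /eqP/(canRL (@trmxK _ _ _)) ->; rewrite trmx0.
have := q0 v^T; rewrite trmxK; apply.
by apply: contra v0 => /eqP/(canRL (@trmxK _ _ _)) ->; rewrite trmx0.
Qed.

Lemma positive_semipositive s : positive_tensors s -> semipositive_tensors s.
Proof.
move=> [sT s0]; split=> // l; have [->|/s0/ltW//] := eqVneq l 0.
by rewrite !mul0mx mxE.
Qed.

Lemma positive_tensorsD s x : positive_tensors s -> semipositive_tensors x ->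
  positive_tensors (s + x).
Proof.
move=> [sT s0] [xT x0]; split; first by rewrite /symmetric_tensors /= linearD /= sT xT.
by move=> l l0; rewrite [X in 0 < X]qformD ltr_pwDl// ?s0// x0.
Qed.

Lemma semipositive_tensorsD s x : semipositive_tensors s -> semipositive_tensors x ->
  semipositive_tensors (s + x).
Proof.
move=> [sT s0] [xT x0]; split; first by rewrite /symmetric_tensors /= linearD /= sT xT.
by move=> l; rewrite [X in 0 <= X]qformD addr_ge0// ?s0// x0.
Qed.

Lemma positive_tensorsZ (a : R) s : 0 < a -> positive_tensors s ->
  positive_tensors (a *: s).
Proof.
move=> a0 [sT s0]; split; first by rewrite /symmetric_tensors /= linearZ /= sT.
by move=> l l0; rewrite [X in 0 < X]qformZ mulr_gt0// s0.
Qed.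

Lemma semipositive_tensorsZ (a : R) s : 0 <= a -> semipositive_tensors s ->
  semipositive_tensors (a *: s).
Proof.
move=> a0 [sT s0]; split; first by rewrite /symmetric_tensors /= linearZ /= sT.
by move=> l; rewrite [X in 0 <= X]qformZ mulr_ge0// s0.
Qed.

Lemma semipositive_diag0 s i j : semipositive_tensors s -> s i i = 0 -> s i j = 0.
Proof.
move=> [sT s0] sii; apply/eqP; apply: contraT => sij.
have e (t : R) : qform s (delta_mx 0 j + t *: delta_mx 0 i) = s j j + 2 * t * s i j.
  rewrite qformD_scale// !qform_delta bform_delta -rowE mxE sii mulr0 addr0.
  by rewrite -[in s j i]sT mxE.
(* The form is affine in the coefficient of [delta_mx 0 i]; this coefficient gives it the value
   -1. *)
have := s0 (delta_mx 0 j + (- (s j j + 1) / (2 * s i j)) *: delta_mx 0 i).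
rewrite [X in 0 <= X]e.
have -> : 2 * (- (s j j + 1) / (2 * s i j)) * s i j = - (s j j + 1).
  by field.
by rewrite opprD addrA subrr sub0r lerNr oppr0 ler10.
Qed.

(* Lagrange's reduction to a sum of squares *)
Lemma semipositive_sum_squares s : semipositive_tensors s ->
  exists vs : seq 'cV[R]_n, s = \sum_(v <- vs) v *m v^T.
Proof.
have [c] := ubnP #|[pred i | s i i != 0]|; elim: c s => // c IH s sc sP.
have [i sii|diag0] := pickP (fun i => s i i != 0); last first.
  exists [::]; rewrite big_nil; apply/matrixP => i j; rewrite mxE.
  by apply: semipositive_diag0 => //; apply/eqP/negPn; rewrite diag0.
have sT := sP.1; have s0 := sP.2.
have sii0 : 0 < s i i.
  rewrite lt_neqAle eq_sym sii /=; have := s0 (delta_mx 0 i).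
  by rewrite [X in 0 <= X]qform_delta.
have sji j : s j i = s i j by rewrite -[in LHS]sT mxE.
pose w : 'cV[R]_n := (Num.sqrt (s i i))^-1 *: col i s.
pose s' := s - w *m w^T.
have wE (j k : 'I_n) : (w *m w^T) j k = (s i i)^-1 * (s i j * s i k).
  rewrite mxE big_ord1 !mxE !sji mulrACA -expr2 exprVn sqr_sqrtr//; exact: ltW.
have s'E (j k : 'I_n) : s' j k = s j k - (s i i)^-1 * (s i j * s i k).
  by rewrite -wE mxE [X in _ + X]mxE.
have s'P : semipositive_tensors s'.
  split.
    by rewrite /symmetric_tensors /= linearB /= sT trmx_mul trmxK.
  move=> l; pose a := bform s l (delta_mx 0 i) / s i i.
  have := s0 (l + (- a) *: delta_mx 0 i); congr (0 <= _).
  rewrite -[RHS]/(qform s' l) -[LHS]/(qform s _) qformD_scale// /s' qformD qformN.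
  have -> : qform (w *m w^T) l = bform s l (delta_mx 0 i) ^+ 2 / s i i.
    rewrite /qform mulmxA -mulmxA -trmx_mul mxE big_ord1 [(_^T) _ _]mxE.
    have -> : (l *m w) 0 0 = (Num.sqrt (s i i))^-1 * bform s l (delta_mx 0 i).
      by rewrite /w -scalemxAr mxE /bform trmx_delta colE mulmxA.
    by rewrite mulrACA -expr2 exprVn sqr_sqrtr ?(ltW sii0)// mulrC expr2.
  rewrite qform_delta /a; field; exact: lt0r_neq0.
have [|vs vsE] := IH s' _ s'P; last first.
  by exists (w :: vs); rewrite big_cons -vsE /s' addrC subrK.
rewrite ltnS in sc; apply: leq_trans sc; apply: proper_card; apply/properP; split.
  apply/fintype.subsetP => j; rewrite !inE; apply: contra => /eqP sjj.
  by rewrite s'E -sji (semipositive_diag0 i sP sjj) sjj mul0r mulr0 subr0.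
exists i; rewrite inE// negbK s'E.
by rewrite mulrA mulVf// mul1r subrr.
Qed.

(** On a sum of squares the pairing is the sum of the values of [q] at the vectors, one of which is
    nonzero. All monotonicity along the flow rests on this. *)
Lemma pairing_gt0 q s : positive_form q -> semipositive_tensors s -> s != 0 ->
  0 < pairing q s.
Proof.
move=> [_ q0] /semipositive_sum_squares[vs ->].
have ge0 (v : 'cV[R]_n) : 0 <= pairing q (v *m v^T).
  rewrite pairing_pure; have [->|/q0/ltW//] := eqVneq v 0.
  by rewrite mulmx0 mxE.
have lin (r : seq 'cV[R]_n) : pairing q (\sum_(v <- r) v *m v^T) = \sum_(v <- r) pairing q (v
  *m v^T).
  by rewrite /pairing mulmx_sumr raddf_sum.
rewrite lin; elim: vs => [|v vs IH]; first by rewrite big_nil eqxx.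
rewrite !big_cons; have [->|v0 _] := eqVneq v 0.
  by rewrite mul0mx add0r => /IH; rewrite /pairing mulmx0 mxtrace0 add0r.
apply: ltr_pwDl; first by rewrite pairing_pure q0.
by apply: sumr_ge0.
Qed.

Lemma pairing_ge0 q s : positive_form q -> semipositive_tensors s -> 0 <= pairing q s.
Proof.
move=> qP sP; have [->|s0] := eqVneq s 0; last exact/ltW/pairing_gt0.
by rewrite /pairing mulmx0 mxtrace0.
Qed.

Lemma positive_tensors_neq0 s : (0 < n)%N -> positive_tensors s -> s != 0.
Proof.
move=> n0 [_ s0]; apply/eqP => sE; have := s0 (const_mx 1).
rewrite sE mulmx0 mul0mx mxE ltxx; suff -> : const_mx 1 != 0 :> 'rV[R]_n by move/(_ isT).
apply/eqP => /rowP/(_ (Ordinal n0)); rewrite !mxE => /eqP; by rewrite oner_eq0.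
Qed.

Lemma qform_bound x l : `|qform x l| <= n%:R ^+ 2 * `|x| * `|l| ^+ 2.
Proof.
rewrite qform_sum (le_trans (ler_norm_sum _ _ _))//.
apply: (@le_trans _ _ (\sum_(i < n) \sum_(j < n) `|x| * `|l| ^+ 2)).
  apply: ler_sum => i _; rewrite (le_trans (ler_norm_sum _ _ _))//.
  apply: ler_sum => j _; rewrite !normrM mulrAC expr2 mulrC.
  by rewrite !ler_pM ?mulr_ge0//; exact: le_mx_norm.
by rewrite !sumr_const !card_ord -mulrnA -[leLHS]mulr_natl natrM expr2 -!mulrA.
Qed.

(** The form has a positive minimum on the compact unit sphere, against which [qform_bound] makes
    [x] small. *)
Lemma positive_tensors_open s : positive_tensors s ->
  exists2 e : R, 0 < e & forall x, x^T = x -> `|x| < e -> positive_tensors (s + x).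
Proof.
move=> [sT s0]; pose S := [set l : 'rV[R]_n | `|l| = 1].
have cS : compact S.
  apply: (subclosed_compact _ (@compact_rV_unit_ball R n)); last by move=> l /= ->.
  apply: (closed_preimage (f := fun l : 'rV[R]_n => `|l|) (A := [set 1])) => //.
  by apply: continuous_normf; exact: continuous_idf.
have cq : continuous (qform s).
  rewrite (_ : qform s = fun l => \sum_i \sum_j l 0 i * s i j * l 0 j); last first.
    by apply/funext => l; exact: qform_sum.
  apply: continuous_sumf => i; apply: continuous_sumf => j.
  apply: continuousMf; last by apply: continuous_coordf; exact: continuous_idf.
  apply: continuousMf; last exact: continuous_cstf.
  by apply: continuous_coordf; exact: continuous_idf.
have [S0|S0] := pselect (S !=set0); last first.
  exists 1 => // x xT _; split; first by rewrite /symmetric_tensors /= linearD /= sT xT.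
  move=> l l0; exfalso; apply: S0; exists (`|l|^-1 *: l).
  by rewrite /S /= normrZ normfV normr_id mulVf// normr_eq0.
have [|l /set_mem lS lP] := @compact_EVT_min _ R (qform s) S S0 cS.
  exact: continuous_subspaceT.
have m0 : 0 < qform s l.
  by apply: s0; rewrite -normr_eq0 lS oner_neq0.
have N0 : 0 < n%:R ^+ 2 + 1 :> R by rewrite ltr_wpDl// exprn_ge0.
exists (qform s l / (n%:R ^+ 2 + 1)); first by rewrite divr_gt0.
move=> x xT xl; split; first by rewrite /symmetric_tensors /= linearD /= sT xT.
move=> k k0; rewrite [X in 0 < X]qformD.
have nk : 0 < `|k| by rewrite normr_gt0.
have kE : k = `|k| *: (`|k|^-1 *: k) by rewrite scalerA divff ?scale1r ?gt_eqF.
have kS : S (`|k|^-1 *: k).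
  by rewrite /S /= normrZ normfV normr_id mulVf// gt_eqF.
have h1 : qform s l * `|k| ^+ 2 <= qform s k.
  by rewrite [in leRHS]kE qform_scale mulrC ler_pM2l ?exprn_gt0//; exact/lP/mem_set.
have := qform_bound x k; rewrite ler_norml => /andP[h2 _].
have h3 : n%:R ^+ 2 * `|x| * `|k| ^+ 2 < qform s l * `|k| ^+ 2.
  rewrite ltr_pM2r ?exprn_gt0//; move: xl; rewrite ltr_pdivlMr// mulrC => xl.
  by apply: le_lt_trans xl; rewrite mulrDl mul1r lerDl.
lra.
Qed.

End Definite.

(** * Orthogonal projection onto a pencil *)

Section MatrixContinuity.
Variable R : realType.

Lemma continuous_prodf (X : topologicalType) (I : Type) (r : seq I)
    (f : I -> X -> R) :
  (forall i, continuous (f i)) -> continuous (fun x => \prod_(i <- r) f i x).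
Proof.
move=> cf; elim: r => [|i r IH].
  rewrite (_ : (fun x => _) = fun=> 1); first exact: continuous_cstf.
  by apply/funext => x; rewrite big_nil.
rewrite (_ : (fun x => _) = fun x => f i x * \prod_(i <- r) f i x).
  exact: continuousMf.
by apply/funext => x; rewrite big_cons.
Qed.

Lemma continuous_mulmxf (X : topologicalType) m n p (f : X -> 'M[R]_(m, n))
    (g : X -> 'M[R]_(n, p)) :
  continuous f -> continuous g -> continuous (fun x => f x *m g x).
Proof.
move=> cf cg; apply: continuous_mxP => i j.
rewrite (_ : (fun x => _) = fun x => \sum_k f x i k * g x k j).
  by apply: continuous_sumf => k; apply: continuousMf; exact: continuous_coordf.
by apply/funext => x; rewrite mxE.
Qed.

Lemma continuous_trmxf (X : topologicalType) m n (f : X -> 'M[R]_(m, n)) :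
  continuous f -> continuous (fun x => (f x)^T).
Proof.
move=> cf; apply: continuous_mxP => i j.
rewrite (_ : (fun x => _) = fun x => f x j i); first exact: continuous_coordf.
by apply/funext => x; rewrite mxE.
Qed.

Lemma continuous_mxvecf (X : topologicalType) m n (f : X -> 'M[R]_(m, n)) :
  continuous f -> continuous (fun x => mxvec (f x)).
Proof.
move=> cf; apply: continuous_mxP => i k; rewrite ord1.
case/mxvec_indexP: k => a b.
rewrite (_ : (fun x => _) = fun x => f x a b); first exact: continuous_coordf.
by apply/funext => x; rewrite mxvecE.
Qed.

Lemma continuous_vec_mxf (X : topologicalType) m n (f : X -> 'rV[R]_(m * n)) :
  continuous f -> continuous (fun x => vec_mx (f x)).
Proof.
move=> cf; apply: continuous_mxP => i j.
rewrite (_ : (fun x => _) = fun x => f x 0 (mxvec_index i j)).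
  exact: continuous_coordf.
by apply/funext => x; rewrite mxE.
Qed.

Lemma continuous_detf (X : topologicalType) n (f : X -> 'M[R]_n) :
  continuous f -> continuous (fun x => \det (f x)).
Proof.
move=> cf; apply: continuous_sumf => s; apply: continuousMf.
  exact: continuous_cstf.
by apply: continuous_prodf => i; exact: continuous_coordf.
Qed.

Lemma continuous_adjf (X : topologicalType) n (f : X -> 'M[R]_n) :
  continuous f -> continuous (fun x => \adj (f x)).
Proof.
move=> cf; apply: continuous_mxP => i j.
rewrite (_ : (fun x => _) =
    fun x => (-1) ^+ (j + i) * \det (\matrix_(a, b) f x (lift j a) (lift i b))).
  apply: continuousMf; first exact: continuous_cstf.
  apply: continuous_detf; apply: continuous_mxP => a b.
  rewrite (_ : (fun x => _) = fun x => f x (lift j a) (lift i b)).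
    exact: continuous_coordf.
  by apply/funext => x; rewrite mxE.
apply/funext => x; rewrite mxE /cofactor; congr (_ * \det _).
by apply/matrixP => a b; rewrite !mxE.
Qed.

Lemma continuous_invmxf (X : topologicalType) n (f : X -> 'M[R]_n) :
  continuous f -> (forall x, f x \in unitmx) -> continuous (fun x => invmx (f x)).
Proof.
move=> cf fu.
rewrite (_ : (fun x => _) = fun x => (\det (f x))^-1 *: \adj (f x)).
  apply: continuousZf; last exact: continuous_adjf.
  apply: continuousVf; first exact: continuous_detf.
  by move=> x; have := fu x; rewrite unitmxE unitfE.
by apply/funext => x; rewrite /invmx fu.
Qed.

Lemma continuous_mxtracef (X : topologicalType) n (f : X -> 'M[R]_n) :
  continuous f -> continuous (fun x => \tr (f x)).
Proof. by move=> cf; apply: continuous_sumf => i; exact: continuous_coordf. Qed.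

Lemma compact_mx_ball m n (r : R) : compact [set q : 'M[R]_(m, n) | `|q| <= r].
Proof.
rewrite (_ : [set _ | _] = vec_mx @` [set b : 'rV[R]_(m * n) | `|b - 0| <= r]).
  apply: continuous_compact; last exact: compact_rV_ball.
  apply: continuous_subspaceT.
  exact: continuous_vec_mxf (@continuous_idf _).
apply/seteqP; split => [q /= qr|_ [b /= br <-]].
  have r0 : 0 <= r by exact: le_trans qr.
  exists (mxvec q); last by rewrite mxvecK.
  rewrite subr0; apply/mx_norm_leP => // i k; rewrite ord1.
  by case/mxvec_indexP: k => a b; rewrite mxvecE; move/mx_norm_leP: qr; apply.
rewrite subr0 in br; have r0 : 0 <= r by exact: le_trans br.
by apply/mx_norm_leP => // i j; rewrite mxE; move/mx_norm_leP: br; apply.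
Qed.

Lemma compact_mx_sphere m n : compact [set q : 'M[R]_(m, n) | `|q| = 1].
Proof.
apply: (subclosed_compact _ (@compact_mx_ball m n 1)); last by move=> l /= ->.
apply: (closed_preimage (f := fun l : 'M[R]_(m, n) => `|l|) (A := [set 1])) => //.
by apply: continuous_normf; exact: continuous_idf.
Qed.

End MatrixContinuity.

Section OrthogonalProjection.
Variables (R : realType) (N : nat).

(** It acts on row vectors from the right; if the rows of [W] are independent, it is the orthogonal
    projection onto the space they span. *)
Definition oproj d (W : 'M[R]_(d, N)) : 'M[R]_N :=
  W^T *m invmx (W *m W^T) *m W.

Lemma mulmx_tr_eq0 (x : 'rV[R]_N) : x *m x^T = 0 -> x = 0.
Proof.
move=> /(congr1 (fun A : 'M[R]_1 => A 0 0)); rewrite !mxE => x0; apply/rowP => j; apply/eqP.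
have : \sum_j x 0 j ^+ 2 == 0.
  by rewrite -[X in _ == X]x0; apply/eqP; apply: eq_bigr => k _; rewrite mxE expr2.
rewrite psumr_eq0 => [/allP/(_ j (mem_index_enum _))|k _]; last exact: sqr_ge0.
by rewrite /= sqrf_eq0 mxE.
Qed.

Variables (d : nat) (W : 'M[R]_(d, N)).
Hypothesis fW : row_free W.

Lemma gram_unit : W *m W^T \in unitmx.
Proof.
rewrite -row_free_unit -kermx_eq0; apply/eqP/row_matrixP => i; rewrite row0.
set x := row i _; have : x *m (W *m W^T) = 0.
  by apply/eqP; rewrite -sub_kermx row_sub.
move=> xW; have /mulmx_tr_eq0 : (x *m W) *m (x *m W)^T = 0.
  by rewrite trmx_mul mulmxA -[x *m W *m _]mulmxA xW mul0mx.
by move=> /eqP; rewrite mulmx_free_eq0// => /eqP.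
Qed.

Lemma mulmx_oproj : W *m oproj W = W.
Proof. by rewrite /oproj !mulmxA mulmxV ?gram_unit// mul1mx. Qed.

Lemma oproj_sym : (oproj W)^T = oproj W.
Proof. by rewrite /oproj !trmx_mul trmxK trmx_inv trmx_mul trmxK mulmxA. Qed.

Lemma oproj_sub : (oproj W <= W)%MS.
Proof. exact: submxMl. Qed.

Lemma oproj_id m (q : 'M[R]_(m, N)) : (q <= W)%MS -> q *m oproj W = q.
Proof. by move=> /submxP[D ->]; rewrite -mulmxA mulmx_oproj. Qed.

End OrthogonalProjection.

(** Each projection fixes the rows of the other, and both are symmetric: transposing one of the two
    product identities identifies them. *)
Lemma eq_oproj (R : realType) N d d' (W : 'M[R]_(d, N)) (W' : 'M[R]_(d', N)) :
  row_free W -> row_free W' -> (W :=: W')%MS -> oproj W = oproj W'.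
Proof.
move=> fW fW' eW.
have e1 : oproj W *m oproj W' = oproj W.
  by apply: oproj_id => //; rewrite -eW oproj_sub.
have e2 : oproj W' *m oproj W = oproj W'.
  by apply: oproj_id => //; rewrite eW oproj_sub.
by rewrite -e1 -[LHS]trmxK trmx_mul !oproj_sym e2 oproj_sym.
Qed.

Section PencilProjection.
Variables (R : realType) (n d : nat).

Implicit Types (P : {vspace 'M[R]_n}) (q : 'M[R]_n).

Definition frame_mx k (F : 'I_k -> 'M[R]_n) : 'M[R]_(k, n * n) :=
  \matrix_(i < k) mxvec (F i).

Lemma mul_frame_mx k (F : 'I_k -> 'M[R]_n) (c : 'rV[R]_k) :
  vec_mx (c *m frame_mx F) = \sum_i c 0 i *: F i.
Proof.
rewrite mulmx_sum_row linear_sum; apply: eq_bigr => i _.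
by rewrite linearZ /= rowK mxvecK.
Qed.

Lemma frame_mx_free k (F : 'I_k -> 'M[R]_n) :
  free [tuple F i | i < k] -> row_free (frame_mx F).
Proof.
move=> /freeP Ff; rewrite -kermx_eq0; apply/eqP/row_matrixP => i; rewrite row0.
set x := row i _; have : x *m frame_mx F = 0.
  by apply/eqP; rewrite -sub_kermx row_sub.
move=> /(congr1 vec_mx); rewrite mul_frame_mx linear0 => xF.
apply/rowP => j; rewrite [RHS]mxE; apply: (Ff (fun j => x 0 j)); rewrite -[RHS]xF.
by apply: eq_bigr => l _; rewrite -tnth_nth tnth_mktuple.
Qed.

Lemma mem_frame_span k (F : 'I_k -> 'M[R]_n) q :
  (q \in <<[tuple F i | i < k]>>%VS) = (mxvec q <= frame_mx F)%MS.
Proof.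
have e (i : 'I_k) : [tuple F i | i < k]`_i = F i by rewrite -tnth_nth tnth_mktuple.
apply/idP/idP => [/coord_span|/submxP[c qc]].
  under eq_bigr do rewrite e.
  move=> ->; rewrite linear_sum; apply: summx_sub => i _; rewrite linearZ /=.
  apply: scalemx_sub.
  by rewrite -(rowK (fun i => mxvec (F i)) i); exact: row_sub.
rewrite -[q]mxvecK qc mul_frame_mx; apply: memv_suml => i _; apply: memvZ.
by apply: memv_span; apply/tnthP; exists i; rewrite tnth_mktuple.
Qed.

(** This embeds the Grassmannian continuously into a space of matrices; the norm of a difference of
    such projections will serve as the distance of two pencils. *)
Definition pencil_proj (P : {vspace 'M[R]_n}) : 'M[R]_(n * n) :=
  oproj (frame_mx (fun i : 'I_(\dim P) => (vbasis P)`_i)).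

Lemma vbasis_tuple (P : {vspace 'M[R]_n}) :
  [tuple (vbasis P)`_i | i < \dim P] = vbasis P.
Proof. by apply: eq_from_tnth => i; rewrite tnth_mktuple -tnth_nth. Qed.

Lemma pencil_frame_free (P : {vspace 'M[R]_n}) :
  row_free (frame_mx (fun i : 'I_(\dim P) => (vbasis P)`_i)).
Proof.
apply: frame_mx_free; rewrite vbasis_tuple.
exact: basis_free (vbasisP P).
Qed.

Lemma mem_pencil (P : {vspace 'M[R]_n}) q : (q \in P) =
  (mxvec q <= frame_mx (fun i : 'I_(\dim P) => (vbasis P)`_i))%MS.
Proof.
by rewrite -mem_frame_span vbasis_tuple (span_basis (vbasisP P)).
Qed.

Definition proj (P : {vspace 'M[R]_n}) (q : 'M[R]_n) : 'M[R]_n :=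
  vec_mx (mxvec q *m pencil_proj P).

Lemma proj_mem P q : proj P q \in P.
Proof.
by rewrite mem_pencil /proj vec_mxK; apply: submx_trans (submxMl _ _) (oproj_sub _).
Qed.

Lemma proj_id P q : q \in P -> proj P q = q.
Proof.
by rewrite mem_pencil /proj => qP; rewrite oproj_id ?mxvecK// pencil_frame_free.
Qed.

Lemma projP P q : reflect (proj P q = q) (q \in P).
Proof. by apply: (iffP idP) => [/proj_id//|<-]; exact: proj_mem. Qed.

Lemma projD P q q' : proj P (q + q') = proj P q + proj P q'.
Proof. by rewrite /proj linearD mulmxDl linearD. Qed.

Lemma projZ P (a : R) q : proj P (a *: q) = a *: proj P q.
Proof. by rewrite /proj linearZ /= -scalemxAl linearZ. Qed.

Lemma projB P q q' : proj P (q - q') = proj P q - proj P q'.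
Proof. by rewrite projD -scaleN1r projZ scaleN1r. Qed.

Lemma proj0 P : proj P 0 = 0.
Proof. by rewrite /proj linear0 mul0mx linear0. Qed.

Definition dot (q q' : 'M[R]_n) : R := (mxvec q *m (mxvec q')^T) 0 0.

Lemma dotE q q' : dot q q' = \tr (q *m q'^T).
Proof.
transitivity (\sum_i \sum_j q i j * q' i j).
  rewrite pair_bigA /dot mxE (reindex _ (curry_mxvec_bij _ _)) /=.
  by apply: eq_bigr => -[i j] _; rewrite /= [_^T _ _]mxE !mxvecE.
by apply: eq_bigr => i _; rewrite mxE; apply: eq_bigr => j _; rewrite mxE.
Qed.

Lemma dot_proj P q s : q \in P -> dot q (proj P s) = dot q s.
Proof.
move=> qP; rewrite /dot /proj vec_mxK trmx_mul oproj_sym mulmxA.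
by rewrite oproj_id// ?pencil_frame_free// -mem_pencil.
Qed.

Lemma dot_gt0 q : q != 0 -> 0 < dot q q.
Proof.
move=> q0; rewrite lt_neqAle; apply/andP; split.
  apply: contra q0 => /eqP e; apply/eqP; apply: (can_inj mxvecK); rewrite linear0.
  by apply: mulmx_tr_eq0; apply/matrixP => i j; rewrite !ord1 [RHS]mxE.
rewrite /dot mxE; apply: sumr_ge0 => i _; rewrite [_^T _ _]mxE -expr2.
exact: sqr_ge0.
Qed.

Lemma pencil_proj_inj P P' : pencil_proj P = pencil_proj P' -> P = P'.
Proof.
move=> e; apply/vspaceP => q; apply/projP/projP; by rewrite /proj e.
Qed.

Lemma proj_delta_bound P P' q : `|proj P q - proj P' q| <=
  (n * n)%:R * (`|q| * `|pencil_proj P - pencil_proj P'|).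
Proof.
rewrite /proj -linearB -mulmxBr; apply/mx_norm_leP => [|i j].
  by rewrite !mulr_ge0.
rewrite mxE; set A := _ - _; rewrite mxE (le_trans (ler_norm_sum _ _ _))//.
apply: (@le_trans _ _ (\sum_(k < n * n) `|q| * `|A|)); last first.
  by rewrite sumr_const card_ord mulr_natl.
apply: ler_sum => k _; rewrite normrM ler_pM//; last exact: le_mx_norm.
by case/mxvec_indexP: k => a b; rewrite mxvecE; exact: le_mx_norm.
Qed.

Lemma frame_span_proj (F : @frames R n d) :
  row_free (frame_mx (val F)) /\
  pencil_proj (frame_span F) = oproj (frame_mx (val F)).
Proof.
have /andP[/subvP sP /eqP dP] : is_pencil d <<codom (val F)>>%VS.
  exact: (set_mem (valP F)).
have cE : codom (val F) = [tuple val F i | i < d].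
  by rewrite /codom /image_mem /= ; congr map; rewrite val_ord_tuple enumT.
have fF : row_free (frame_mx (val F)).
  by apply: frame_mx_free; rewrite /free size_tuple; apply/eqP; rewrite -[RHS]dP cE.
split=> //; apply: eq_oproj => //; first exact: pencil_frame_free.
apply/eqmxP/rV_eqP => q.
by rewrite -[q]vec_mxK -mem_pencil -mem_frame_span /= cE.
Qed.

(** By the quotient topology it suffices to check frames. There the projection may be computed from
    the frame itself instead of the chosen basis of the pencil, and the formula of [oproj] is
    continuous where the Gram matrix is invertible. *)
Lemma pencil_proj_continuous :
  continuous (fun P : grassmannian R n d => pencil_proj P).
Proof.
apply/continuousP => U oU; rewrite /open /= /grassmannian_open.
rewrite (_ : _ @^-1` _ = (fun F : @frames R n d => oproj (frame_mx (val F))) @^-1` U); last first.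
  by apply/seteqP; split => F /=; rewrite (frame_span_proj F).2.
move: U oU; apply/continuousP.
have cW : continuous (fun F : @frames R n d => frame_mx (val F)).
  apply: continuous_mxP => i k; case/mxvec_indexP: k => a b.
  rewrite (_ : (fun x => _) = fun F : @frames R n d => val F i a b); last first.
    by apply/funext => F; rewrite mxE mxvecE.
  apply: continuous_coordf.
  apply: (@continuous_compf (@frames R n d) {ptws 'I_d -> 'M[R]_n} _ val (fun F => F i)).
    exact: initial_continuous.
  exact: (@proj_continuous 'I_d (fun=> 'M[R]_n) i).
have cT := continuous_trmxf cW.
apply: continuous_mulmxf => //; apply: continuous_mulmxf => //.
apply: continuous_invmxf; first exact: continuous_mulmxf.
by move=> F; apply: gram_unit; exact: (frame_span_proj F).1.
Qed.

End PencilProjection.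

(** * The flow in terms of unit forms *)

Section BundleFlow.
Variables (R : realType) (n d : nat) (M : topologicalType).
Variable u : M -> grassmannian R n d.
Variable Phi : R -> sphere_bundle u -> sphere_bundle u.
Hypothesis cu : continuous u.
Hypothesis fPhi : fitting_flow Phi.

Definition in_bundle (x : M) (q : 'M[R]_n) := q \in pencil_space (u x) /\ q != 0.

Lemma in_bundleP (p : punctured_bundle u) : in_bundle (val p).1 (val p).2.
Proof. exact: (set_mem (valP p)). Qed.

Definition bundle_point x q (xq : in_bundle x q) : punctured_bundle u :=
  SigSub (mem_set (xq : punctured_bundle u (x, q))).

Lemma in_bundleZ x q (c : R) : c != 0 -> in_bundle x q -> in_bundle x (c *: q).
Proof. by move=> c0 [qx q0]; split; [exact: memvZ|rewrite scaler_eq0 negb_or c0]. Qed.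

Lemma rayP (p p' : punctured_bundle u) : ray p = ray p' <->
  (val p).1 = (val p').1 /\ exists2 c : R, 0 < c & (val p').2 = c *: (val p).2.
Proof.
split=> [/eqmodP/asboolP//|h].
by apply/eqmodP/asboolP.
Qed.

Lemma rayK (z : sphere_bundle u) : exists p, ray p = z.
Proof. by exists (repr z); exact: reprK. Qed.

Definition base (z : sphere_bundle u) : M := (val (repr z : punctured_bundle u)).1.

Definition normalize (q : 'M[R]_n) : 'M[R]_n := `|q|^-1 *: q.

Definition unit_form (z : sphere_bundle u) : 'M[R]_n :=
  normalize (val (repr z : punctured_bundle u)).2.

Lemma normalizeZ (c : R) q : 0 < c -> normalize (c *: q) = normalize q.
Proof.
move=> c0; rewrite /normalize normrZ gtr0_norm// scalerA invfM mulrAC mulVf ?mul1r//.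
exact: lt0r_neq0.
Qed.

Lemma norm_normalize q : q != 0 -> `|normalize q| = 1.
Proof. by move=> q0; rewrite normrZ normfV normr_id mulVf// normr_eq0. Qed.

Lemma base_ray p : base (ray p) = (val p).1.
Proof. by have /rayP[] : ray (repr (ray p)) = ray p by exact: reprK. Qed.

Lemma unit_form_ray p : unit_form (ray p) = normalize (val p).2.
Proof.
have /rayP[_ [c c0 ->]] : ray (repr (ray p)) = ray p by exact: reprK.
by rewrite normalizeZ.
Qed.

Lemma ray_continuous : continuous (@ray R n d M u).
Proof. exact: pi_continuous. Qed.

Lemma val_punctured_continuous : continuous (val : punctured_bundle u -> M * 'M[R]_n).
Proof. exact: initial_continuous. Qed.

Lemma base_continuous : continuous base.
Proof.
apply/quotient_continuous.
rewrite (_ : _ \o _ = fun p : punctured_bundle u => (val p).1); last first.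
  by apply/funext => p; exact: base_ray.
exact: continuous_compf val_punctured_continuous (@continuous_fstf _ _).
Qed.

Lemma unit_form_continuous : continuous unit_form.
Proof.
apply/quotient_continuous.
rewrite (_ : _ \o _ = fun p : punctured_bundle u => normalize (val p).2); last first.
  by apply/funext => p; exact: unit_form_ray.
have c2 : continuous (fun p : punctured_bundle u => (val p).2).
  exact: continuous_compf val_punctured_continuous (@continuous_sndf _ _).
apply: continuousZf => //; apply: continuousVf; first exact: continuous_normf.
by move=> p; rewrite normr_eq0; exact: (in_bundleP p).2.
Qed.

Lemma proj_continuous : continuous (fun p : M * 'M[R]_n => proj (u p.1) p.2).
Proof.
apply: continuous_vec_mxf; apply: continuous_mulmxf.
  by apply: continuous_mxvecf; exact: continuous_sndf.
apply: (@continuous_compf _ M _ fst (fun x => pencil_proj (u x))).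
  exact: continuous_fstf.
apply: (@continuous_compf M (grassmannian R n d) _ u (fun P => pencil_proj P)) => //.
exact: pencil_proj_continuous.
Qed.

(** An open set containing the punctured bundle: on it, continuity of the extended flow can be
    stated at single points of a product, without subspace or quotient topologies. *)
Definition flow_domain : set (M * 'M[R]_n * R) :=
  [set a | proj (u a.1.1) a.1.2 != 0].

Lemma flow_domain_open : open flow_domain.
Proof.
have c : continuous (fun a : M * 'M[R]_n * R => proj (u a.1.1) a.1.2).
  apply: (@continuous_compf _ (M * 'M[R]_n)%type _ fst (fun p => proj (u p.1) p.2)).
    exact: continuous_fstf.
  exact: proj_continuous.
rewrite (_ : flow_domain = (fun a : M * 'M[R]_n * R =>
  `|proj (u a.1.1) a.1.2|) @^-1` [set x | 0 < x]).
  move: (continuous_normf c) => /continuousP; apply; exact: open_gt.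
by apply/seteqP; split => a /=; rewrite normr_gt0.
Qed.

Lemma proj_in_bundle x q : proj (u x) q != 0 -> in_bundle x (proj (u x) q).
Proof. by move=> q0; split; [exact: proj_mem|]. Qed.

(* The flow in terms of unit representatives, extended to the pairs [(x, q)]
   with [q] not orthogonal to [u x]. *)
Definition flow (a : M * 'M[R]_n * R) : M * 'M[R]_n :=
  if pselect (proj (u a.1.1) a.1.2 != 0) is left h then
    let z := Phi a.2 (ray (bundle_point (proj_in_bundle h))) in
    (base z, unit_form z)
  else (a.1.1, 0).

Lemma flow_continuous a : flow_domain a -> {for a, continuous flow}.
Proof.
move: a; have : {within flow_domain, continuous flow}.
  apply/subspace_sigL_continuousP.
  pose mk (a : flow_domain) : punctured_bundle u :=
    bundle_point (proj_in_bundle (set_mem (valP a) : proj (u (val a).1.1) (val a).1.2 != 0)).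
  have cval : continuous (val : flow_domain -> M * 'M[R]_n * R).
    exact: initial_continuous.
  have c1 : continuous (fun a : flow_domain => (val a).1).
    exact: continuous_compf cval (@continuous_fstf _ _).
  have cmk : continuous mk.
    apply: continuous_comp_initial.
    rewrite (_ : _ \o _ = fun a : flow_domain => ((val a).1.1,
      proj (u (val a).1.1) (val a).1.2)) //.
    apply: continuous_pairf; first exact: continuous_compf c1 (@continuous_fstf _ _).
    exact: continuous_compf c1 proj_continuous.
  have [[cPhi _ _] _] := fPhi.
  pose z (a : flow_domain) := Phi (val a).2 (ray (mk a)).
  have cz : continuous z.
    apply: (@continuous_compf _ (R * sphere_bundle u)%type _
      (fun a : flow_domain => ((val a).2, ray (mk a))) (fun p => Phi p.1 p.2)) => //.
    apply: continuous_pairf; first exact: continuous_compf cval (@continuous_sndf _ _).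
    exact: continuous_compf cmk ray_continuous.
  rewrite (_ : sigL _ _ = fun a => (base (z a), unit_form (z a))); last first.
    apply/funext => a; rewrite /sigL /= /flow; case: pselect => [h|].
      by rewrite /z /mk; congr (base (Phi _ (ray _)), unit_form (Phi _ (ray _))); apply: val_inj.
    by move=> h; exfalso; apply: h; exact: (set_mem (valP a)).
  apply: continuous_pairf; first exact: continuous_compf cz base_continuous.
  exact: continuous_compf cz unit_form_continuous.
move=> cw a aD; move: cw; rewrite continuous_open_subspace; last exact: flow_domain_open.
by apply; exact: mem_set.
Qed.

Lemma flowE x q t (xq : in_bundle x q) :
  flow (x, q, t) = (base (Phi t (ray (bundle_point xq))),
                    unit_form (Phi t (ray (bundle_point xq)))).
Proof.
have e := proj_id xq.1; rewrite /flow; case: pselect => [h|] /=; last first.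
  by case; rewrite e; exact: xq.2.
have -> // : bundle_point (proj_in_bundle h) = bundle_point xq.
by apply: val_inj; rewrite /= e.
Qed.

Lemma flow_in_bundle x q t : in_bundle x q ->
  in_bundle (flow (x, q, t)).1 (flow (x, q, t)).2 /\ `|(flow (x, q, t)).2| = 1.
Proof.
move=> xq; rewrite (flowE _ xq); have [p <-] := rayK (Phi t (ray (bundle_point xq))).
rewrite base_ray unit_form_ray; have pP := in_bundleP p; split.
  by apply: in_bundleZ => //; rewrite invr_eq0 normr_eq0; exact: pP.2.
by rewrite norm_normalize//; exact: pP.2.
Qed.

Lemma ray_unit_form (z : sphere_bundle u) (h : in_bundle (base z) (unit_form z)) :
  ray (bundle_point h) = z.
Proof.
have [p pz] := rayK z; rewrite -[RHS]pz; apply/rayP; split => /=.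
  by rewrite -pz base_ray.
exists `|(val p).2|; first by rewrite normr_gt0; exact: (in_bundleP p).2.
rewrite -pz unit_form_ray scalerA divff ?scale1r// normr_eq0.
exact: (in_bundleP p).2.
Qed.

Lemma flow0 x q : in_bundle x q -> flow (x, q, 0) = (x, normalize q).
Proof.
move=> xq; have [[_ P0 _] _] := fPhi.
by rewrite (flowE _ xq) P0 base_ray unit_form_ray.
Qed.

Lemma flowD x q s t : in_bundle x q ->
  flow (flow (x, q, s), t) = flow (x, q, s + t).
Proof.
move=> xq; have [[_ _ PD] _] := fPhi.
have [h _] := flow_in_bundle s xq; have e := flowE s xq; rewrite e in h *.
by rewrite (flowE _ h) ray_unit_form (flowE _ xq) addrC PD.
Qed.

Lemma flowZ x q (c : R) t : 0 < c -> in_bundle x q ->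
  flow (x, c *: q, t) = flow (x, q, t).
Proof.
move=> c0 xq; have xcq := in_bundleZ (lt0r_neq0 c0) xq.
rewrite (flowE _ xq) (flowE _ xcq).
have -> // : ray (bundle_point xcq) = ray (bundle_point xq).
apply/rayP; split => //=; exists c^-1; first by rewrite invr_gt0.
by rewrite scalerA mulVf ?scale1r// lt0r_neq0.
Qed.

Lemma flow_fitting x q t : in_bundle x q -> 0 < t ->
  exists2 c : R, 0 < c & positive_form (c *: (flow (x, q, t)).2 - q).
Proof.
move=> xq t0; have [p [p' [pz p'z pos]]] := fPhi.2 (ray (bundle_point xq)) t t0.
rewrite (flowE _ xq) /= -p'z unit_form_ray.
have /rayP[/= _ [a a0 qE]] := pz.
have p'0 : 0 < `|(val p').2| by rewrite normr_gt0; exact: (in_bundleP p').2.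
exists (a * `|(val p').2|); first exact: mulr_gt0.
have -> : (a * `|(val p').2|) *: normalize (val p').2 - q = a *: ((val p').2 - (val p).2).
  by rewrite qE /normalize scalerA -mulrA divff ?mulr1 ?gt_eqF// scalerBr.
by apply/positive_formP/positive_tensorsZ => //; apply/positive_formP.
Qed.

Variables (Gamma : groupType) (act : Gamma -> M -> M) (rho : Gamma -> 'M[R]_n).
Hypothesis rho_unit : forall g, rho g \in unitmx.
Hypothesis ePhi : equivariant_flow act rho Phi.
Hypothesis eu : equivariant_map act rho u.

Lemma form_action_neq0 (g q : 'M[R]_n) : g \in unitmx -> q != 0 -> form_action g q != 0.
Proof.
move=> gu; apply: contra => /eqP e; apply/eqP.
have : g^T *m form_action g q *m g = q.
  rewrite /form_action -!mulmxA mulVmx// mulmx1 mulmxA -trmx_mul mulVmx//.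
  by rewrite trmx1 mul1mx.
by rewrite e mulmx0 mul0mx.
Qed.

Lemma act_in_bundle g x q : in_bundle x q ->
  in_bundle (act g x) (form_action (rho g) q).
Proof.
move=> [qx q0]; split; last exact: form_action_neq0.
have : [set` u (act g x)] (form_action (rho g) q) by rewrite eu; exists q.
by [].
Qed.

Lemma form_actionZ (g : 'M[R]_n) (c : R) q : form_action g (c *: q) = c *: form_action g q.
Proof. by rewrite /form_action -scalemxAr -scalemxAl. Qed.

Lemma flow_equivariant g x q t : in_bundle x q ->
  flow (act g x, form_action (rho g) q, t) =
  (act g (flow (x, q, t)).1, normalize (form_action (rho g) (flow (x, q, t)).2)).
Proof.
move=> xq; have gxq := act_in_bundle g xq.
have [h _] := flow_in_bundle t xq; have gh := act_in_bundle g h.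
have E : Phi t (ray (bundle_point gxq)) = ray (bundle_point gh).
  apply: (@ePhi g t (bundle_point xq) (bundle_point h)) => //.
  have e := flowE t xq; have h' := h; rewrite e in h'.
  have -> : bundle_point h = bundle_point h' by apply: val_inj; rewrite /= e.
  by rewrite ray_unit_form.
by rewrite (flowE _ gxq) E base_ray unit_form_ray.
Qed.

End BundleFlow.

(** * Uniform expansion along the flow *)

Lemma continuous_atB (R : realType) (X : topologicalType) (V : normedModType R)
    (f g : X -> V) x : {for x, continuous f} -> {for x, continuous g} ->
  {for x, continuous (fun y => f y - g y)}.
Proof. by move=> cf cg; apply: cvgB. Qed.

Lemma continuous_atZ (R : realType) (X : topologicalType) (V : normedModType R)
    (c : R) (f : X -> V) x : {for x, continuous f} ->
  {for x, continuous (fun y => c *: f y)}.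
Proof. by move=> cf; apply: cvgZ => //; exact: cvg_cst. Qed.

Lemma near_continuous_at (R : realType) (X : topologicalType)
    (V : normedModType R) (f : X -> V) x (e : R) : {for x, continuous f} -> 0 < e ->
  \forall y \near x, `|f x - f y| < e.
Proof. by move=> /cvgrPdist_lt; apply. Qed.

Section FlowSpec.
Variables (R : realType) (n d : nat) (M : topologicalType).

(** What the geometric arguments use of the flow, in terms of pairs of a point and a form; the
    sphere bundle does not appear beyond this point except in the final theorem. *)
Record flow_spec (u : M -> grassmannian R n d) (F : M * 'M[R]_n * R -> M * 'M[R]_n) :
    Prop := FlowSpec {
  flow_spec_in : forall x q t, in_bundle u x q ->
    in_bundle u (F (x, q, t)).1 (F (x, q, t)).2;
  flow_spec_unit : forall x q t, in_bundle u x q -> `|(F (x, q, t)).2| = 1;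
  flow_spec0 : forall x q, in_bundle u x q -> F (x, q, 0) = (x, normalize q);
  flow_specD : forall x q s t, in_bundle u x q -> F (F (x, q, s), t) = F (x, q, s + t);
  flow_specZ : forall x q (c : R) t, 0 < c -> in_bundle u x q ->
    F (x, c *: q, t) = F (x, q, t);
  flow_spec_fit : forall x q t, in_bundle u x q -> 0 < t ->
    exists2 c : R, 0 < c & positive_form (c *: (F (x, q, t)).2 - q);
  flow_spec_cont : forall x q t, proj (u x) q != 0 -> {for (x, q, t), continuous F} }.

Lemma flow_flow_spec (u : M -> grassmannian R n d)
    (Phi : R -> sphere_bundle u -> sphere_bundle u) :
  continuous u -> fitting_flow Phi -> flow_spec u (flow Phi).
Proof.
move=> cu fPhi; split.
- by move=> x q t /(flow_in_bundle Phi t)[].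
- by move=> x q t /(flow_in_bundle Phi t)[].
- exact: flow0.
- exact: flowD.
- exact: flowZ.
- exact: flow_fitting.
- by move=> x q t xq; apply: flow_continuous.
Qed.

End FlowSpec.

Section PencilAnnihilator.
Variables (R : realType) (n d : nat).
Implicit Types (P : grassmannian R n d) (q s : 'M[R]_n).

Lemma pencil_sym P q : q \in pencil_space P -> q^T = q.
Proof.
case: P => P /=/andP[/subvP sP _] /sP; rewrite mem_symmetric_forms; exact/eqP.
Qed.

Lemma pairing_dot q s : s^T = s -> pairing q s = dot q s.
Proof. by move=> sT; rewrite dotE sT. Qed.

(** On symmetric tensors the pairing is the Euclidean scalar product, so annihilation means that the
    orthogonal projection vanishes. In this form it depends continuously on the pencil. *)
Lemma annihilatorP P s : annihilator P s <-> s^T = s /\ proj P s = 0.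
Proof.
split=> -[sT sP]; split=> //.
  apply/eqP; apply: contraT => p0; have := dot_gt0 p0.
  by rewrite dot_proj ?proj_mem// -pairing_dot// sP ?ltxx ?proj_mem.
move=> q qP; rewrite pairing_dot// -(dot_proj _ qP) sP.
by rewrite dotE trmx0 mulmx0 mxtrace0.
Qed.

Lemma pairingD q q' s : pairing (q + q') s = pairing q s + pairing q' s.
Proof. by rewrite /pairing mulmxDl mxtraceD. Qed.

Lemma pairingZ (c : R) q s : pairing (c *: q) s = c * pairing q s.
Proof. by rewrite /pairing -scalemxAl mxtraceZ. Qed.

Lemma pairingB q q' s : pairing (q - q') s = pairing q s - pairing q' s.
Proof. by rewrite pairingD -scaleN1r pairingZ mulN1r. Qed.

Lemma pairingDr q s s' : pairing q (s + s') = pairing q s + pairing q s'.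
Proof. by rewrite /pairing mulmxDr mxtraceD. Qed.

Lemma pairingZr (c : R) q s : pairing q (c *: s) = c * pairing q s.
Proof. by rewrite /pairing -scalemxAr mxtraceZ. Qed.

Lemma pairingBr q s s' : pairing q (s - s') = pairing q s - pairing q s'.
Proof. by rewrite pairingDr -scaleN1r pairingZr mulN1r. Qed.

End PencilAnnihilator.

Section FormAction.
Variables (R : realType) (n : nat).
Implicit Types g q s : 'M[R]_n.

Lemma form_actionD g q q' : form_action g (q + q') = form_action g q + form_action g q'.
Proof. by rewrite /form_action mulmxDr mulmxDl. Qed.

Lemma form_actionB g q q' : form_action g (q - q') = form_action g q - form_action g q'.
Proof. by rewrite form_actionD -scaleN1r form_actionZ scaleN1r. Qed.

Lemma positive_form_action g q : g \in unitmx ->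
  positive_form (form_action g q) -> positive_form q.
Proof.
move=> gu [qT q0].
have e : q = g^T *m form_action g q *m g.
  rewrite /form_action -!mulmxA mulVmx// mulmx1 mulmxA -trmx_mul mulVmx//.
  by rewrite trmx1 mul1mx.
move: (form_action g q) qT q0 e => r rT r0 ->.
split; first by rewrite !trmx_mul trmxK rT mulmxA.
move=> v v0; have gv0 : g *m v != 0.
  apply: contra v0 => /eqP gv; apply/eqP.
  by rewrite -[v]mul1mx -(mulVmx gu) -mulmxA gv mulmx0.
by have := r0 _ gv0; rewrite trmx_mul !mulmxA.
Qed.

Lemma pairing_form_action g q s : g \in unitmx ->
  pairing (form_action g q) (g *m s *m g^T) = pairing q s.
Proof.
move=> gu; rewrite /pairing /form_action.
rewrite mxtrace_mulC !mulmxA -[_ *m g^T *m _]mulmxA -trmx_mul mulVmx// trmx1 mulmx1.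
by rewrite mxtrace_mulC !mulmxA mulVmx// mul1mx mxtrace_mulC.
Qed.

Lemma positive_tensors_act g s : g \in unitmx -> positive_tensors s ->
  positive_tensors (g *m s *m g^T).
Proof.
move=> gu [sT s0]; split.
  by rewrite /symmetric_tensors /= !trmx_mul trmxK sT mulmxA.
move=> l l0; have lg0 : l *m g != 0.
  apply: contra l0 => /eqP lg; apply/eqP.
  by rewrite -[l]mulmx1 -(mulmxV gu) mulmxA lg mul0mx.
by have := s0 _ lg0; rewrite trmx_mul !mulmxA.
Qed.

End FormAction.

(* The quantitative form of the expansion along a fitting flow: passing from [q]
   to [q'] one gains a positive form dominating [q] up to the factor [C]. *)
Definition expands (R : realType) n (C : R) (q q' : 'M[R]_n) :=
  [/\ positive_form (q' - q), positive_form (C *: (q' - q) - q) &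
      positive_form (C *: (q' - q) + q)].

Section Expansion.
Variables (R : realType) (n d : nat) (M : topologicalType).
Variables (u : M -> grassmannian R n d) (F : M * 'M[R]_n * R -> M * 'M[R]_n).
Hypotheses (cu : continuous u) (Fs : flow_spec u F).

Lemma positive_formZ (a : R) (q : 'M[R]_n) : 0 < a -> positive_form q ->
  positive_form (a *: q).
Proof. by move=> a0 /positive_formP qP; apply/positive_formP/positive_tensorsZ. Qed.

Lemma unit_bundle_compact (K : set M) : compact K ->
  compact [set p : M * 'M[R]_n | [/\ K p.1, p.2 \in pencil_space (u p.1) & `|p.2| = 1]].
Proof.
move=> cK; pose S := [set q : 'M[R]_n | `|q| = 1].
have cKS : compact (K `*` S) := compact_setX cK (@compact_mx_sphere R n n).
pose A := [set p : M * 'M[R]_n | `|proj (u p.1) p.2 - p.2| <= 0].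
have clA : closed A.
  apply: (closed_preimage (f := fun p : M * 'M[R]_n =>
    `|proj (u p.1) p.2 - p.2|) _ (@closed_le _ 0)).
  apply: continuous_normf.
  by apply: continuousBf; [exact: proj_continuous|exact: continuous_sndf].
rewrite (_ : [set p | _] = (K `*` S) `&` A); first exact: compact_closedI.
apply/seteqP; split => -[x q] /=.
  by case=> Kx qx q1; split; [split|rewrite /A /= proj_id// subrr normr0].
by move=> [[Kx q1]]; rewrite /A /= normr_le0; rewrite subr_eq0 => /eqP qx; split => //;
  apply/projP.
Qed.

(** Near a unit form one factor [c] keeps the difference of the flowed and the initial form within
    [e / 2] of a fixed positive form. For [C > 2 / e], adding or subtracting the initial form
    divided by [C] leaves it positive. Compactness of the unit bundle over [K] then gives a common
    [C]. *)
Lemma uniform_expansion_compact (K : set M) : compact K ->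
  exists2 C : R, 0 < C & forall x q, K x -> q \in pencil_space (u x) -> `|q| = 1 ->
    exists2 c : R, 0 < c & expands C q (c *: (F (x, q, 1)).2).
Proof.
move=> cK.
pose P (C : R) (p : M * 'M[R]_n) := p.2 \in pencil_space (u p.1) -> `|p.2| = 1 ->
  exists2 c : R, 0 < c & expands C p.2 (c *: (F (p, 1)).2).
have : \forall C \near +oo, forall p : M * 'M[R]_n,
    [/\ K p.1, p.2 \in pencil_space (u p.1) & `|p.2| = 1] -> P C p.
  apply: compact_near; first exact: unit_bundle_compact.
  move=> [x0 q0] /= [Kx0 qx0 q01].
  have q00 : q0 != 0 by rewrite -normr_eq0 q01 oner_neq0.
  have [c c0 /positive_formP pos] := flow_spec_fit Fs (conj qx0 q00) ltr01.
  have [e e0 eP] := positive_tensors_open pos.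
  have cF : {for (x0, q0), continuous (fun p : M * 'M[R]_n => c *: (F (p, 1)).2 - p.2)}.
    apply: continuous_atB; last exact: continuous_sndf.
    apply: continuous_atZ.
    apply: (@continuous_comp _ _ _ (fun p : M * 'M[R]_n => F (p, 1)) snd);
      last exact: continuous_sndf.
    apply: (@continuous_comp _ _ _ (fun p : M * 'M[R]_n => (p, 1 : R)) F).
      exact: continuous_pairf (@continuous_idf _) (@continuous_cstf _ _ _) _.
    by apply: (flow_spec_cont Fs); rewrite proj_id.
  have near1 : \forall p \near (x0, q0),
      `|(c *: (F (x0, q0, 1)).2 - q0) - (c *: (F (p, 1)).2 - p.2)| < e / 2.
    apply: (near_continuous_at cF); exact: divr_gt0.
  near=> p C => qp q1.
  have C0 : 0 < C by near: C; exact: nbhs_pinfty_gt.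
  have Ce : 2 / e < C by near: C; apply: nbhs_pinfty_gt; exact: num_real.
  have p_near : `|(c *: (F (x0, q0, 1)).2 - q0) - (c *: (F (p, 1)).2 - p.2)| < e / 2.
    by near: p.
  have p20 : p.2 != 0 by rewrite -normr_eq0 q1 oner_neq0.
  have inF : in_bundle u (F (p, 1)).1 (F (p, 1)).2.
    by rewrite [p]surjective_pairing; exact: (flow_spec_in Fs).
  have inF0 : in_bundle u (F (x0, q0, 1)).1 (F (x0, q0, 1)).2.
    exact: (flow_spec_in Fs).
  have symB (P1 P2 : grassmannian R n d) (a : R) q q' : q \in pencil_space P1 ->
      q' \in pencil_space P2 -> (a *: q - q')^T = a *: q - q'.
    by move=> h1 h2; rewrite linearB linearZ /= (pencil_sym h1) (pencil_sym h2).
  pose x := (c *: (F (p, 1)).2 - p.2) - (c *: (F (x0, q0, 1)).2 - q0).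
  have xT : x^T = x by rewrite linearB /= (symB _ _ _ _ _ inF.1 qp) (symB _ _ _ _ _ inF0.1 qx0).
  have xe : `|x| < e / 2 by rewrite /x distrC.
  have pE y : c *: (F (p, 1)).2 - p.2 + y = (c *: (F (x0, q0, 1)).2 - q0) + (x + y).
    by rewrite addrA [X in _ = X + _]addrC /x subrK.
  have pos' y : y^T = y -> `|y| <= C^-1 -> positive_form (c *: (F (p, 1)).2 - p.2 + y).
    move=> yT yC; apply/positive_formP; rewrite pE; apply: eP.
      by rewrite linearD /= xT yT.
    rewrite (le_lt_trans (ler_normD _ _))// [ltRHS]splitr ltrD//.
    apply: le_lt_trans yC _; rewrite -[ltRHS]invrK ltf_pV2 ?posrE ?invr_gt0 ?divr_gt0//.
    by rewrite invf_div.
  have pT := pencil_sym qp.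
  have CC : C *: (C^-1 *: p.2) = p.2 by rewrite scalerA divff ?scale1r// gt_eqF.
  have nC : `|C^-1 *: p.2| = C^-1 by rewrite normrZ q1 mulr1 gtr0_norm// invr_gt0.
  exists c => //; split.
  - by rewrite -[_ - _]addr0; apply: pos'; rewrite ?trmx0// normr0 invr_ge0 ltW.
  - rewrite -[X in _ - X]CC -scalerBr; apply: positive_formZ => //; apply: pos'.
      by rewrite linearN /= linearZ /= pT.
    by rewrite normrN nC.
  - rewrite -[X in _ + X]CC -scalerDr; apply: positive_formZ => //; apply: pos'.
      by rewrite linearZ /= pT.
    by rewrite nC.
move=> h; near +oo_R => C; exists C; first by near: C; exact: nbhs_pinfty_gt.
move=> x q Kx qx q1.
have hC : forall p : M * 'M[R]_n,
  [/\ K p.1, p.2 \in pencil_space (u p.1) & `|p.2| = 1] -> P C p by near: C.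
exact: (hC (x, q) (And3 Kx qx q1) qx q1).
Unshelve. all: by end_near. Qed.

End Expansion.

Section UniformExpansion.
Variables (R : realType) (n d : nat) (M : topologicalType).
Variables (u : M -> grassmannian R n d) (F : M * 'M[R]_n * R -> M * 'M[R]_n).
Hypotheses (cu : continuous u) (Fs : flow_spec u F).
Variables (Gamma : groupType) (act : Gamma -> M -> M) (rho : Gamma -> 'M[R]_n).
Hypothesis rho_unit : forall g, rho g \in unitmx.
Hypothesis eu : equivariant_map act rho u.
Hypothesis eF : forall g x q t, in_bundle u x q ->
  F (act g x, form_action (rho g) q, t) =
  (act g (F (x, q, t)).1, normalize (form_action (rho g) (F (x, q, t)).2)).

Lemma expands_act (C a : R) (g q q' : 'M[R]_n) : 0 < a -> g \in unitmx ->
  expands C (a *: form_action g q) (a *: form_action g q') -> expands C q q'.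
Proof.
move=> a0 gu; rewrite -!form_actionZ => -[h1 h2 h3].
have a'0 : 0 < a^-1 by rewrite invr_gt0.
have back (r : 'M[R]_n) : positive_form (form_action g (a *: r)) -> positive_form r.
  move=> /(positive_form_action gu)/(positive_formZ a'0).
  by rewrite scalerA mulVf ?scale1r// gt_eqF.
split; apply: back.
- by rewrite scalerBr form_actionB.
- rewrite scalerBr form_actionB scalerA mulrC -scalerA form_actionZ.
  by rewrite scalerBr form_actionB.
- rewrite scalerDr form_actionD scalerA mulrC -scalerA form_actionZ.
  by rewrite scalerBr form_actionB.
Qed.

Lemma uniform_expansion (K : set M) : compact K -> (forall x, exists g, K (act g x)) ->
  exists2 C : R, 0 < C & forall x q, in_bundle u x q ->
    exists2 c : R, 0 < c & expands C q (c *: (F (x, q, 1)).2).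
Proof.
move=> cK coK; have [C C0 CP] := uniform_expansion_compact cu Fs cK.
exists C => // x q xq; have [g Kg] := coK x.
have [gq gq0] := act_in_bundle rho_unit eu g xq.
pose b := `|form_action (rho g) q|.
have b0 : 0 < b by rewrite normr_gt0.
have [c c0] := CP _ _ Kg (memvZ b^-1 gq) (norm_normalize gq0).
have b'0 : 0 < b^-1 by rewrite invr_gt0.
rewrite (flow_specZ Fs 1 b'0 (conj gq gq0)) eF//= /normalize scalerA => h.
have [_ F0] := act_in_bundle rho_unit eu g (flow_spec_in Fs 1 xq).
pose b' := `|form_action (rho g) (F (x, q, 1)).2|.
have bb0 : 0 < b' by rewrite normr_gt0.
(* The constant found over [K] is corrected by the two norms that normalization removes, before and
   after the flow. *)
exists (b * (c * b'^-1)); first by apply: mulr_gt0 => //; apply: mulr_gt0 => //; rewrite invr_gt0.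
apply: (@expands_act C b^-1 (rho g) _ _ b'0 (rho_unit g)).
by rewrite form_actionZ scalerA mulrA mulVf ?gt_eqF// mul1r.
Qed.

Variable C : R.
Hypothesis C0 : 0 < C.
Hypothesis CP : forall x q, in_bundle u x q ->
  exists2 c : R, 0 < c & expands C q (c *: (F (x, q, 1)).2).

Lemma expansion_chain x q : in_bundle u x q -> exists Q : nat -> 'M[R]_n,
  [/\ Q 0%N = q, forall i, expands C (Q i) (Q i.+1) &
      forall i, exists2 a : R, 0 < a & Q i = a *: (F (x, q, i%:R)).2].
Proof.
move=> xq.
have step (ia : nat * R) : exists b : R, 0 < ia.2 -> 0 < b /\
    expands C (ia.2 *: (F (x, q, ia.1%:R)).2) (b *: (F (x, q, ia.1.+1%:R)).2).
  case: ia => i a /=; have [a0|] := pselect (0 < a); last by exists 0.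
  have inF := flow_spec_in Fs i%:R xq.
  have [b b0] := CP (in_bundleZ (lt0r_neq0 a0) inF).
  rewrite (flow_specZ Fs)// -surjective_pairing (flow_specD Fs)// -natr1 => h.
  by exists b.
have [f fP] := choice step.
pose a i := iteri i (fun j a => f (j, a)) `|q|.
have a0 i : 0 < a i.
  elim: i => [|i IH]; first by rewrite /a /= normr_gt0; exact: xq.2.
  by have [] := fP (i, a i) IH.
exists (fun i => a i *: (F (x, q, i%:R)).2); split.
- rewrite (flow_spec0 Fs)// /a /= /normalize scalerA divff ?scale1r//.
  by rewrite normr_eq0; exact: xq.2.
- by move=> i; have [] := fP (i, a i) (a0 i).
- by move=> i; exists (a i).
Qed.

(** [A] stands for the pairings of a chain of forms with a tensor and [P] for their increments.
    After one step [A] exceeds [P 0], and since [A] is dominated by [C * P], the later increments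
    cannot fall below [P 0 / C]. *)
Lemma chain_growth (A P : nat -> R) : (forall i, A i.+1 = A i + P i) ->
  (forall i, 0 < P i) -> (forall i, A i < C * P i) -> forall i, 0 <= A 0%N ->
  P 0%N <= A i.+1 /\ P 0%N <= C * P i.+1.
Proof.
move=> AS P0 AP i A0; have h : P 0%N <= A i.+1.
  by elim: i => [|i IH]; rewrite AS ?lerDr// (le_trans IH)// lerDl ltW.
by split=> //; rewrite (le_trans h)// ltW.
Qed.

(** As long as the pairings are negative, each increment is more than [- B i / C], which makes [- B]
    shrink by a factor of at least [1 + C^-1] per step. The induction runs backwards from the last
    step, where [- B] is still at least [P k]. *)
Lemma chain_decay (B P : nat -> R) : (forall i, B i.+1 = B i + P i) ->
  (forall i, 0 < P i) -> (forall i, - B i < C * P i) -> forall k,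
  B k.+1 <= 0 -> (1 + C^-1) ^+ k * P k <= - B 0%N.
Proof.
move=> BS P0 BP k Bk.
have l0 : 0 <= 1 + C^-1 by rewrite addr_ge0 ?invr_ge0// ltW.
have h : forall j, (j <= k)%N -> (1 + C^-1) ^+ j * P k <= - B (k - j)%N.
  elim=> [_|j IH jk].
    by rewrite expr0 mul1r subn0; have := BS k; move: Bk; lra.
  have := IH (ltnW jk); have kj : (k - j = (k - j.+1).+1)%N by lia.
  rewrite kj BS; move: (k - j.+1)%N => i h.
  rewrite exprS -mulrA.
  have h' : - B i * (1 + C^-1)^-1 >= (1 + C^-1) ^+ j * P k.
    apply: le_trans h _; have := BP i; have := P0 i => Pi Bi.
    have l1 : 0 < 1 + C^-1 by rewrite ltr_pwDl// invr_ge0 ltW.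
    rewrite ler_pdivlMr//.
    have -> : - (B i + P i) * (1 + C^-1) =
      - B i + C^-1 * (- B i - C * P i) - P i - C^-1 * P i + C^-1 * C * P i by ring.
    rewrite mulVf ?gt_eqF//.
    have : C^-1 * (- B i - C * P i) < 0 by rewrite pmulr_rlt0 ?invr_gt0// subr_lt0.
    have : 0 < C^-1 * P i by rewrite mulr_gt0// invr_gt0.
    lra.
  have l1 : 0 < 1 + C^-1 by rewrite ltr_pwDl// invr_ge0 ltW.
  by move: h'; rewrite ler_pdivlMr// mulrC.
by have := h k (leqnn k); rewrite subnn.
Qed.

(* Along the flow the zero of [q] on the segment between two tensors moves away
   exponentially fast, hence the flow time is controlled by their distance. *)
Lemma flow_time_bound x q t (s s' : 'M[R]_n) (D : R) k :
  in_bundle u x q -> annihilator (u x) s -> annihilator (u (F (x, q, t)).1) s' ->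
  semipositive_tensors s -> s != 0 -> semipositive_tensors s' -> s' != 0 ->
  semipositive_tensors (D *: s - s') -> semipositive_tensors (D *: s' - s) ->
  k.+2%:R <= t -> (1 + C^-1) ^+ k.+1 <= C ^+ 2 * D ^+ 2.
Proof.
move=> xq [_ us] [_ us'] sP s0 s'P s'0 Dss' Ds's kt.
have [Q [Q0 QS QF]] := expansion_chain xq.
pose P (r : 'M[R]_n) i := pairing (Q i.+1 - Q i) r.
pose A (r : 'M[R]_n) i := pairing (Q i) r.
have AS r i : A r i.+1 = A r i + P r i by rewrite /A /P pairingB addrC subrK.
have P0 r i : semipositive_tensors r -> r != 0 -> 0 < P r i.
  by move=> rP r0; apply: pairing_gt0 => //; have [] := QS i.
have AC r i : semipositive_tensors r -> r != 0 -> A r i < C * P r i.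
  move=> rP r0; rewrite -subr_gt0 /A /P -pairingZ -pairingB.
  by apply: pairing_gt0 => //; have [] := QS i.
have ANC r i : semipositive_tensors r -> r != 0 -> - A r i < C * P r i.
  move=> rP r0; rewrite -subr_gt0 opprK /A /P -pairingZ -pairingD.
  by apply: pairing_gt0 => //; have [] := QS i.
have A0 : A s 0%N = 0 by rewrite /A Q0; apply: us; exact: xq.1.
(* The forms at time [t] annihilate [s'], and pairings with a semi-definite tensor grow along the
   flow; so they are nonpositive at the earlier time [k.+2]. *)
have Bk : A s' k.+2 <= 0.
  have [a a0 Qa] := QF k.+2; rewrite /A Qa.
  have inF := flow_spec_in Fs k.+2%:R xq.
  move: kt; rewrite le_eqVlt => /orP[/eqP tE|kt].
    by rewrite pairingZ us' ?mulr0// tE; exact: (flow_spec_in Fs t xq).1.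
  have kt0 : 0 < t - k.+2%:R by rewrite subr_gt0.
  have tE : k.+2%:R + (t - k.+2%:R) = t by lra.
  have [c c0] := flow_spec_fit Fs (in_bundleZ (lt0r_neq0 a0) inF) kt0.
  rewrite (flow_specZ Fs)// -surjective_pairing (flow_specD Fs)// tE => pos.
  have := pairing_ge0 pos s'P; rewrite pairingB pairingZ us' ?mulr0 ?sub0r ?oppr_ge0//.
  exact: (flow_spec_in Fs t xq).1.
have PD i : P s i <= D * P s' i.
  rewrite -subr_ge0 /P -pairingZr -pairingBr; apply: pairing_ge0 => //.
  by have [] := QS i.
have PD' i : P s' i <= D * P s i.
  rewrite -subr_ge0 /P -pairingZr -pairingBr; apply: pairing_ge0 => //.
  by have [] := QS i.
(* For [s] the increment at time [k.+1] is at least the initial one divided by [C]; for [s'] it is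
   at most [C] times the initial one, divided by the power. Comparing [s] and [s'] by [D] at both
   times gives the bound [C ^+ 2 * D ^+ 2]. *)
have := @chain_growth (A s) (P s) (AS s) (fun i => P0 s i sP s0)
  (fun i => AC s i sP s0) k; rewrite A0 => /(_ (lexx _))[_ h1].
have h2 := @chain_decay (A s') (P s') (AS s') (fun i => P0 s' i s'P s'0)
  (fun i => ANC s' i s'P s'0) k.+1 Bk.
have h3 := ltW (ANC s' 0%N s'P s'0).
have D0 : 0 < D by have := PD 0%N; have := P0 s' 0%N s'P s'0; have := P0 s 0%N sP s0; nra.
have e0 : 0 < P s 0%N by exact: P0.
have l0 : 0 <= (1 + C^-1) ^+ k.+1 by rewrite exprn_ge0// addr_ge0 ?invr_ge0// ltW.
rewrite -(ler_pM2r e0).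
apply: (@le_trans _ _ ((1 + C^-1) ^+ k.+1 * (C * (D * P s' k.+1)))).
  by rewrite ler_wpM2l// (le_trans h1)// ler_pM2l.
rewrite mulrCA [_ * (D * _)]mulrCA.
apply: (@le_trans _ _ (C * (D * (C * (D * P s 0%N))))).
  by rewrite ler_pM2l// ler_pM2l// (le_trans h2)// (le_trans h3)// ler_pM2l.
by rewrite le_eqVlt; apply/orP; left; apply/eqP; ring.
Qed.

End UniformExpansion.

(** * Local surjectivity of the flow *)

Lemma near_imp (X : topologicalType) (x : X) (P Q : X -> Prop) :
  nbhs x P -> (forall y, P y -> Q y) -> nbhs x Q.
Proof. by move=> nP PQ; apply: filterS nP. Qed.

Lemma near_and_imp (X : topologicalType) (x : X) (P P' Q : X -> Prop) :
  nbhs x P -> nbhs x P' -> (forall y, P y -> P' y -> Q y) -> nbhs x Q.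
Proof. by move=> nP nP' PQ; apply: filterS2 nP nP'. Qed.

Lemma continuous_at_scale (R : realType) (X : topologicalType) (V : normedModType R)
    (k : X -> R) (f : X -> V) x : {for x, continuous k} -> {for x, continuous f} ->
  {for x, continuous (fun y => k y *: f y)}.
Proof. by move=> ck cf; apply: cvgZ. Qed.

Lemma essential_ext (R : realType) (V : normedModType R) (h h' : V -> V) :
  (forall b, `|b| = 1 -> h b = h' b) -> essential h -> essential h'.
Proof. by move=> e eh g cg g1; apply: eh => // b b1; rewrite g1// e. Qed.

(** The first property serves for local surjectivity, the second, with one more parameter, for the
    global one. Both pass through the same homotopies, which replaces an appeal to the degree. *)
Definition stably_essential (R : realType) d (h : 'rV[R]_d -> 'rV[R]_d) :=
  essential h /\ essential (fun b : ('rV[R]_d * R)%type => (h b.1, b.2)).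

Section StablyEssential.
Variables (R : realType) (d : nat).
Implicit Types h : 'rV[R]_d -> 'rV[R]_d.

Lemma stably_essential_id : stably_essential (fun b : 'rV[R]_d => b).
Proof.
split; first exact: essential_id_rV.
by apply: essential_ext (@essential_id_rV_prod R d) => -[].
Qed.

Lemma norm_pair_eq1 (v : 'rV[R]_d) : `|(v, 0 : R)| = 1 -> `|v| = 1.
Proof. by rewrite prod_normE /= normr0 max_l. Qed.

Lemma stably_essential_homotopy (H : 'rV[R]_d * R -> 'rV[R]_d) :
  continuous H -> (forall b r, `|b| = 1 -> 0 <= r <= 1 -> H (b, r) != 0) ->
  stably_essential (fun b => H (b, 0)) -> stably_essential (fun b => H (b, 1)).
Proof.
move=> cH H0 [e1 e2]; split; first exact: essential_homotopy.
apply: (essential_homotopy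
  (H := fun a : ('rV[R]_d * R)%type * R => (H (a.1.1, a.2), a.1.2))) e2.
  apply: continuous_pairf; last first.
    exact: continuous_compf (@continuous_fstf _ _) (@continuous_sndf _ _).
  apply: continuous_compf cH; apply: continuous_pairf; last exact: continuous_sndf.
  exact: continuous_compf (@continuous_fstf _ _) (@continuous_fstf _ _).
move=> [v t] r vt1 r01; apply/eqP => -[Hv0 t0]; rewrite /= in Hv0 t0.
by rewrite t0 in vt1; move/eqP: Hv0; rewrite (negbTE (H0 _ _ (norm_pair_eq1 vt1) r01)).
Qed.

End StablyEssential.

Lemma pencil_coordinates (R : realType) (n d : nat) (P : grassmannian R n d) :
  exists (W : 'M[R]_(d, n * n)) (W' : 'M[R]_(n * n, d)),
    [/\ W *m W' = 1%:M, forall v, vec_mx (v *m W) \in pencil_space P &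
        forall q, q \in pencil_space P -> vec_mx (mxvec q *m W' *m W) = q].
Proof.
case: P => P /= /andP[_ /eqP dP]; subst d.
pose W := frame_mx (fun i : 'I_(\dim P) => (vbasis P)`_i).
have fW : row_free W := pencil_frame_free P.
exists W, (W^T *m invmx (W *m W^T)); split.
- by rewrite mulmxA mulmxV// gram_unit.
- by move=> v; rewrite mem_pencil vec_mxK submxMl.
- move=> q; rewrite mem_pencil -/W => qW.
  by rewrite -!mulmxA [W^T *m _]mulmxA -/(oproj W) oproj_id// mxvecK.
Qed.

Section Exponential.
Variables (R : realType) (n d : nat) (M : topologicalType).
Variables (u : M -> grassmannian R n d) (F : M * 'M[R]_n * R -> M * 'M[R]_n).
Hypotheses (cu : continuous u) (Fs : flow_spec u F).

(** Compactness of the unit sphere of all forms: near a form of [u x0] the flow is continuous, and a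
    form outside [u x0] stays outside the pencils of nearby points. *)
Lemma flow_near (x0 : M) (U : set M) : nbhs x0 U ->
  \forall a \near (x0, 0 : R), forall q, q \in pencil_space (u a.1) -> `|q| = 1 ->
    U (F (a.1, q, a.2)).1.
Proof.
move=> nU; pose P (a : M * R) (q : 'M[R]_n) := q \in pencil_space (u a.1) ->
  U (F (a.1, q, a.2)).1.
have : \forall a \near (x0, 0 : R), forall q, [set q : 'M[R]_n | `|q| = 1] q -> P a q.
  apply: (compact_near (F := nbhs (x0, 0 : R)) (P := P) (@compact_mx_sphere R n n)).
  move=> q0 /= q01; have q00 : q0 != 0 by rewrite -normr_eq0 q01 oner_neq0.
  have swap (Q : 'M[R]_n * (M * R) -> Prop) :
      (\forall b \near ((x0, q0), 0 : R), Q (b.1.2, (b.1.1, b.2))) ->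
      \forall q \near q0 & a \near (x0, 0 : R), Q (q, a).
    move=> [[/= A B] [[[/= A1 A2] [nA1 nA2] A12] nB] AB].
    exists (A2, A1 `*` B) => /=; first by split=> //; exists (A1, B).
    move=> [q [y t]] [/= qA [/= yA tB]].
    by have /= := AB ((y, q), t); apply; split => //=; apply: (A12 (y, q)).
  apply: (swap (fun p => P p.2 p.1)); rewrite /P /=.
  have [qx|qx] := boolP (q0 \in pencil_space (u x0)).
    have cF : {for ((x0, q0), 0 : R), continuous F}.
      by apply: (flow_spec_cont Fs); rewrite proj_id.
    have c1 : {for ((x0, q0), 0 : R), continuous (fun b => (F b).1)}.
      by apply: (@continuous_comp _ _ _ F fst) => //; exact: continuous_fstf.
    have nU' : nbhs ((F ((x0, q0), 0)).1) U by rewrite (flow_spec0 Fs).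
    by apply: (near_imp (c1 _ nU')) => -[[y q] t] /= h _.
  have c : continuous (fun b : M * 'M[R]_n * R => `|proj (u b.1.1) b.1.2 - b.1.2|).
    apply: continuous_normf; apply: continuousBf.
      apply: (@continuous_compf _ (M * 'M[R]_n)%type _ fst (fun p => proj (u p.1) p.2)).
        exact: continuous_fstf.
      exact: proj_continuous.
    exact: continuous_compf (@continuous_fstf _ _) (@continuous_sndf _ _).
  have p0 : 0 < `|proj (u x0) q0 - q0|.
    by rewrite normr_gt0 subr_eq0; apply: contra qx => /eqP/projP.
  have np : nbhs (`|proj (u x0) q0 - q0|) [set r : R | 0 < r].
    by apply: open_nbhs_nbhs; split => //; exact: open_gt.
  apply: (near_imp (c ((x0, q0), 0) _ np)) => -[[y q] t] /= h /projP e.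
  by move: h; rewrite e subrr normr0 ltxx.
by move=> h; apply: (near_imp h) => a aP q qa q1; exact: aP.
Qed.

Lemma flow_pairing_gt0 x q t s : in_bundle u x q -> 0 < t -> annihilator (u x) s ->
  semipositive_tensors s -> s != 0 -> 0 < pairing (F (x, q, t)).2 s.
Proof.
move=> xq t0 [_ us] sP s0; have [c c0 pos] := flow_spec_fit Fs xq t0.
have := pairing_gt0 pos sP s0; rewrite pairingB pairingZ (us q xq.1) subr0.
by rewrite pmulr_rgt0.
Qed.

Variable x : M.
Variables (W : 'M[R]_(d, n * n)) (W' : 'M[R]_(n * n, d)).
Hypotheses (WW' : W *m W' = 1%:M) (Wu : forall v, vec_mx (v *m W) \in pencil_space (u x)).
Hypothesis W'W : forall q, q \in pencil_space (u x) -> vec_mx (mxvec q *m W' *m W) = q.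

Let e (v : 'rV[R]_d) : 'M[R]_n := vec_mx (v *m W).
Let kap (q : 'M[R]_n) : 'rV[R]_d := mxvec q *m W'.

Let eK v : kap (e v) = v.
Proof. by rewrite /kap /e vec_mxK -mulmxA WW' mulmx1. Qed.

Let eZ a v : e (a *: v) = a *: e v.
Proof. by rewrite /e -scalemxAl linearZ. Qed.

Let e_neq0 v : v != 0 -> e v != 0.
Proof.
apply: contra => /eqP ev; apply/eqP; rewrite -[v]eK ev /kap linear0.
by rewrite mul0mx.
Qed.

Let e_in v : v != 0 -> in_bundle u x (e v).
Proof. by move=> v0; split; [exact: Wu|exact: e_neq0]. Qed.

Let ce : continuous e.
Proof.
apply: continuous_vec_mxf; apply: continuous_mulmxf; first exact: continuous_idf.
exact: continuous_cstf.
Qed.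

Let ckap : continuous kap.
Proof.
apply: continuous_mulmxf; last exact: continuous_cstf.
by apply: continuous_mxvecf; exact: continuous_idf.
Qed.

Let kap_eq0 q : q \in pencil_space (u x) -> kap q = 0 -> q = 0.
Proof.
by move=> qx k0; rewrite -[q]W'W// -/(kap q) k0 mul0mx linear0.
Qed.

Definition expmap (v : 'rV[R]_d) : M :=
  if v == 0 then x else (F (x, vec_mx (v *m W), `|v|)).1.

(** The form carried to [expmap (r *: v)] by the flow, scaled to have the norm of [v], so that it
    extends continuously by 0. The parameter [r] deforms the forms at [x] into those at the end of
    the flow line. *)
Definition expform (a : R * 'rV[R]_d) : 'M[R]_n :=
  if a.2 == 0 then 0 else `|a.2| *: (F (x, vec_mx (a.2 *m W), a.1 * `|a.2|)).2.

Lemma expmap0 : expmap 0 = x. Proof. by rewrite /expmap eqxx. Qed.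

Lemma expmapE v : v != 0 -> expmap v = (F (x, vec_mx (v *m W), `|v|)).1.
Proof. by move=> v0; rewrite /expmap (negbTE v0). Qed.

Let near_neq0 (X : topologicalType) (f : X -> 'rV[R]_d) a : continuous f ->
  f a != 0 -> \forall b \near a, f b != 0.
Proof.
move=> cf fa; have nf : nbhs `|f a| [set r : R | 0 < r].
  by apply: open_nbhs_nbhs; split; [exact: open_gt|rewrite /= normr_gt0].
by apply: (near_imp (continuous_normf cf nf)) => b /=; rewrite normr_gt0.
Qed.

Lemma expmap_continuous : continuous expmap.
Proof.
move=> v; have [->|v0] := eqVneq v 0.
  move=> U; rewrite expmap0 => nU; have [[/= A B] [nA nB] AB] := flow_near nU.
  have n0 : nbhs `|0 : 'rV[R]_d| B by rewrite normr0.
  apply: (near_imp (continuous_normf (@continuous_idf _) n0)) => w /= wB; rewrite /expmap;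
    case: eqVneq => [_|w0].
    exact: nbhs_singleton nU.
  have -> : F (x, vec_mx (w *m W), `|w|) = F (x, normalize (e w), `|w|).
    by rewrite (flow_specZ Fs)// ?invr_gt0 ?normr_gt0 ?e_neq0//; exact: e_in.
  apply: (AB (x, `|w|)) => /=; last exact: norm_normalize (e_neq0 w0).
    by split => //=; exact: nbhs_singleton.
  by apply: memvZ; exact: Wu.
have cF : {for v, continuous (fun v => (F (x, e v, `|v|)).1)}.
  apply: (@continuous_comp _ _ _ (fun v => F (x, e v, `|v|)) fst); last exact: continuous_fstf.
  apply: (@continuous_comp _ _ _ (fun v : 'rV[R]_d => (x, e v, `|v|)) F).
    apply: continuous_pairf; last by apply: continuous_normf; exact: continuous_idf.
    by apply: continuous_pairf => //; exact: continuous_cstf.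
  by apply: (flow_spec_cont Fs); rewrite proj_id; [exact: e_neq0|exact: Wu].
move=> U; rewrite expmapE// => /cF cFU.
by apply: (near_and_imp (near_neq0 (@continuous_idf _) v0) cFU) => w w0; rewrite /= expmapE.
Qed.

Lemma expform_continuous : continuous expform.
Proof.
move=> [r v]; have [->|v0] := eqVneq v 0.
  have e0 : expform (r, 0) = 0 by rewrite /expform eqxx.
  rewrite /continuous_at e0; apply/cvgrPdist_lt => eps eps0.
  have n0 : nbhs `|(r, 0 : 'rV[R]_d).2| [set t : R | t < eps].
    by apply: open_nbhs_nbhs; split; [exact: open_lt|rewrite /= normr0].
  apply: (near_imp (continuous_normf (@continuous_sndf R 'rV[R]_d) n0)) => -[t w] /= wlt;
    rewrite sub0r normrN /expform /=.
  case: eqVneq => [_|w0]; first by rewrite normr0.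
  by rewrite normrZ normr_id (flow_spec_unit Fs) ?mulr1//; exact: e_in.
have cF : {for (r, v), continuous (fun a : R * 'rV[R]_d => `|a.2| *: (F (x, e a.2,
  a.1 * `|a.2|)).2)}.
  have cn : continuous (fun a : R * 'rV[R]_d => `|a.2|).
    by apply: continuous_normf; exact: continuous_sndf.
  apply: continuous_at_scale; first exact: cn.
  apply: (@continuous_comp _ _ _ (fun a : R * 'rV[R]_d => F (x, e a.2, a.1 * `|a.2|)) snd);
    last exact: continuous_sndf.
  apply: (@continuous_comp _ _ _ (fun a : R * 'rV[R]_d => (x, e a.2, a.1 * `|a.2|)) F).
    apply: continuous_pairf.
      apply: continuous_pairf; first exact: continuous_cstf.
      exact: continuous_compf (@continuous_sndf _ _) ce.
    by apply: continuousMf => //; exact: continuous_fstf.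
  by apply: (flow_spec_cont Fs); rewrite proj_id; [exact: e_neq0|exact: Wu].
move=> U; rewrite {1}/expform /= (negbTE v0) => /cF cFU.
apply: (near_and_imp (near_neq0 (@continuous_sndf R 'rV[R]_d) (a := (r, v)) v0) cFU).
by move=> -[t w] /= w0; rewrite /expform /= (negbTE w0).
Qed.

Lemma expform_mem r v : 0 <= r -> expform (r, v) \in pencil_space (u (expmap (r *: v))).
Proof.
rewrite /expform /=; case: eqVneq => [_ _|v0]; first exact: mem0v.
rewrite le_eqVlt => /orP[/eqP<-|r0].
  rewrite scale0r expmap0 mul0r (flow_spec0 Fs) /=; last exact: e_in.
  by apply: memvZ; apply: memvZ; exact: Wu.
have rv0 : r *: v != 0 by rewrite scaler_eq0 negb_or v0 gt_eqF.
rewrite expmapE// -scalemxAl linearZ /= (flow_specZ Fs)//; last exact: e_in.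
rewrite normrZ gtr0_norm//; apply: memvZ.
by have [] := flow_spec_in Fs (r * `|v|) (e_in v0).
Qed.

Lemma expform_neq0 r v : v != 0 -> expform (r, v) != 0.
Proof.
move=> v0; rewrite /expform /= (negbTE v0) scaler_eq0 negb_or normr_eq0 v0 /=.
by have [] := flow_spec_in Fs (r * `|v|) (e_in v0).
Qed.

Lemma expform0 v : v != 0 -> exists2 a : R, 0 < a & expform (0, v) = a *: vec_mx (v *m W).
Proof.
move=> v0; exists (`|v| / `|e v|); first by rewrite divr_gt0// normr_gt0// e_neq0.
rewrite /expform /= (negbTE v0) mul0r (flow_spec0 Fs) /=; last exact: e_in.
by rewrite /normalize scalerA.
Qed.

Lemma expform_pairing v s : v != 0 -> annihilator (u x) s -> semipositive_tensors s ->
  s != 0 -> 0 < pairing (expform (1, v)) s.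
Proof.
move=> v0 us sP s0; rewrite /expform /= (negbTE v0) pairingZ mulr_gt0 ?normr_gt0//.
by rewrite mul1r flow_pairing_gt0 ?normr_gt0//; exact: e_in.
Qed.

Lemma expmap_annihilator v s : annihilator (u x) s -> semipositive_tensors s ->
  s != 0 -> annihilator (u (expmap v)) s -> v = 0.
Proof.
move=> us sP s0 [_ us']; apply/eqP; apply: contraT => v0.
have := expform_pairing v0 us sP s0; rewrite us' ?ltxx//.
by have := expform_mem v ler01; rewrite scale1r.
Qed.

(* Transport from the pencil at [expmap v] to the one at [x] by successive
   orthogonal projections along the segment from [v] to [0]. *)
Fixpoint transport (k j : nat) (v : 'rV[R]_d) (q : 'M[R]_n) : 'M[R]_n :=
  if j is j'.+1 then
    transport k j' v (proj (u (expmap ((j'.+1%:R / k%:R) *: v))) q)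
  else proj (u (expmap 0)) q.

Lemma transport_mem k j v q : transport k j v q \in pencil_space (u x).
Proof. by elim: j q => [|j IH] q //=; rewrite expmap0; exact: proj_mem. Qed.

Lemma transport_continuous k j :
  continuous (fun a : 'rV[R]_d * 'M[R]_n => transport k j a.1 a.2).
Proof.
elim: j => [|j IH] /=.
  apply: (@continuous_compf _ (M * 'M[R]_n)%type _
    (fun a : 'rV[R]_d * 'M[R]_n => (expmap 0, a.2)) (fun p => proj (u p.1) p.2)).
    by apply: continuous_pairf; [exact: continuous_cstf|exact: continuous_sndf].
  exact: proj_continuous.
apply: (@continuous_compf _ _ _ (fun a : 'rV[R]_d * 'M[R]_n =>
   (a.1, proj (u (expmap ((j.+1%:R / k%:R) *: a.1))) a.2)) _ _ IH).
apply: continuous_pairf; first exact: continuous_fstf.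
apply: (@continuous_compf _ (M * 'M[R]_n)%type _
    (fun a : 'rV[R]_d * 'M[R]_n => (expmap ((j.+1%:R / k%:R) *: a.1), a.2)) (fun p =>
      proj (u p.1) p.2)).
  apply: continuous_pairf; last exact: continuous_sndf.
  apply: continuous_compf expmap_continuous; apply: continuousZf.
    exact: continuous_cstf.
  exact: continuous_fstf.
exact: proj_continuous.
Qed.

Lemma transport_at0 k j q : q \in pencil_space (u x) -> transport k j 0 q = q.
Proof.
move=> qx; elim: j => [|j IH] /=; first by rewrite expmap0 proj_id.
by rewrite scaler0 expmap0 proj_id.
Qed.

(** The [k] steps are so fine that no nonzero form of one pencil is projected to 0 in the preceding
    one. *)
Definition close_projections k T := forall v (j : nat) q, `|v| <= T -> (j < k)%N -> q != 0 ->
  `|proj (u (expmap ((j%:R / k%:R) *: v))) q - proj (u (expmap ((j.+1%:R / k%:R) *: v))) q| <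
    `|q|.

Lemma transport_eq0 k T v q : (0 < k)%N -> close_projections k T -> `|v| <= T ->
  transport k k v q = 0 -> proj (u (expmap v)) q = 0.
Proof.
move=> k0 cl vT.
have h : forall j q, (j <= k)%N -> transport k j v q = 0 ->
    proj (u (expmap ((j%:R / k%:R) *: v))) q = 0.
  elim=> [|j IH] r jk /=; first by rewrite mul0r scale0r.
  move=> /(IH _ (ltnW jk)) r0; apply/eqP; apply: contraT => rn0.
  have := cl v j _ vT jk rn0; rewrite r0 (proj_id (proj_mem _ _)) sub0r normrN.
  by rewrite ltxx.
by move=> /(h k q (leqnn k)); rewrite divff ?scale1r// pnatr_eq0 -lt0n.
Qed.

(** The first projection in [transport] is the one onto the pencil at the end of the flow line,
    which replaces [s] by the functional it induces there; the factor [T] makes the unit ball of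
    coordinates the ball of radius [T]. *)
Definition transported k T s (v : 'rV[R]_d) : 'rV[R]_d :=
  mxvec (transport k k (T *: v) s) *m W'.

Lemma transported_eq0 k T v s : (0 < k)%N -> close_projections k T -> `|T *: v| <= T ->
  transported k T s v = 0 -> proj (u (expmap (T *: v))) s = 0.
Proof.
move=> k0 cl vT /kap_eq0 t0; apply: (transport_eq0 k0 cl vT).
exact: t0 (transport_mem _ _ _ _).
Qed.

Lemma transported_continuous k T :
  continuous (fun a : 'rV[R]_d * 'M[R]_n => transported k T a.2 a.1).
Proof.
have c1 : continuous (fun a : 'rV[R]_d * 'M[R]_n => transport k k (T *: a.1) a.2).
  apply: (@continuous_compf _ _ _ (fun a : 'rV[R]_d * 'M[R]_n => (T *: a.1,
    a.2)) _ _ (@transport_continuous k k)).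
  apply: continuous_pairf; last exact: continuous_sndf.
  by apply: continuousZf; [exact: continuous_cstf|exact: continuous_fstf].
exact: continuous_compf c1 ckap.
Qed.

(** Three homotopies without zeros on the sphere start at the identity: [H1] goes linearly to the
    rescaled form at [x], [H2] follows the flow lines to their ends while transporting back, and
    [H3] goes linearly from the flowed form to [s], with which it pairs positively. *)
Lemma transported_essential k T s : (0 < k)%N -> 0 < T -> close_projections k T ->
  annihilator (u x) s -> semipositive_tensors s -> s != 0 ->
  stably_essential (transported k T s).
Proof.
move=> k0 T0 cl us sP s0.
have TN (v : 'rV[R]_d) r : `|v| = 1 -> 0 <= r <= 1 -> `|r *: (T *: v)| <= T.
  move=> v1 /andP[r0 r1]; rewrite !normrZ v1 mulr1 ger0_norm// gtr0_norm//.
  by rewrite ler_piMl// ltW.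
have v_neq0 (v : 'rV[R]_d) : `|v| = 1 -> T *: v != 0.
  by move=> v1; rewrite scaler_eq0 gt_eqF//= -normr_eq0 v1 oner_neq0.
have cT : continuous (fun a : 'rV[R]_d * R => T *: a.1).
  by apply: continuousZf; [exact: continuous_cstf|exact: continuous_fstf].
pose H1 (a : 'rV[R]_d * R) := (1 - a.2) *: a.1 + a.2 *: kap (expform (0, T *: a.1)).
have c1 : continuous H1.
  apply: continuousDf; apply: continuousZf.
  - by apply: continuousBf; [exact: continuous_cstf|exact: continuous_sndf].
  - exact: continuous_fstf.
  - exact: continuous_sndf.
  apply: continuous_compf ckap; apply: continuous_compf expform_continuous.
  by apply: continuous_pairf => //; exact: continuous_cstf.
have E1 : stably_essential (fun b => H1 (b, 1)).
  apply: stably_essential_homotopy => //; last first.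
    rewrite (_ : (fun b => _) = id); first exact: stably_essential_id.
    by apply/funext => b; rewrite /H1 /= subr0 scale1r scale0r addr0.
  move=> b r b1 /andP[r0 r1]; have [a a0 ea] := expform0 (v_neq0 _ b1).
  rewrite /H1 /= ea -/(e (T *: b)) -eZ scalerA eK scalerA -scalerDl scaler_eq0 negb_or.
  have b0 : b != 0 by rewrite -normr_eq0 b1 oner_neq0.
  rewrite b0 andbT gt_eqF//; have aT : 0 < a * T by exact: mulr_gt0.
  by have [<-|r0'] := eqVneq 0 r; [lra|nra].
pose H2 (a : 'rV[R]_d * R) := kap (transport k k (a.2 *: (T *: a.1)) (expform (a.2, T *: a.1))).
have c2 : continuous H2.
  apply: continuous_compf ckap.
  apply: (@continuous_compf _ _ _ (fun a : 'rV[R]_d * R =>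
    (a.2 *: (T *: a.1), expform (a.2, T *: a.1))) _ _ (@transport_continuous k k)).
  apply: continuous_pairf.
    by apply: continuousZf => //; exact: continuous_sndf.
  apply: continuous_compf expform_continuous.
  by apply: continuous_pairf => //; exact: continuous_sndf.
have E2 : stably_essential (fun b => H2 (b, 1)).
  apply: stably_essential_homotopy => //; last first.
    rewrite (_ : (fun b => _) = (fun b => H1 (b, 1))) //.
    apply/funext => b; rewrite /H1 /H2 /= subrr !scale0r add0r scale1r.
    rewrite transport_at0//; have := @expform_mem 0 (T *: b) (lexx _).
    by rewrite scale0r expmap0.
  move=> b r b1 r01; apply/eqP => /(kap_eq0 (transport_mem _ _ _ _)).
  move=> /(transport_eq0 k0 cl (TN _ _ b1 r01)).
  rewrite proj_id; last by apply: expform_mem; case/andP: r01.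
  by move/eqP; rewrite (negbTE (expform_neq0 _ (v_neq0 _ b1))).
pose H3 (a : 'rV[R]_d * R) :=
  kap (transport k k (T *: a.1) ((1 - a.2) *: expform (1, T *: a.1) + a.2 *: s)).
have c3 : continuous H3.
  apply: continuous_compf ckap.
  apply: (@continuous_compf _ _ _ (fun a : 'rV[R]_d * R =>
    (T *: a.1, (1 - a.2) *: expform (1, T *: a.1) + a.2 *: s)) _ _ (@transport_continuous k k)).
  apply: continuous_pairf => //; apply: continuousDf; apply: continuousZf.
  - by apply: continuousBf; [exact: continuous_cstf|exact: continuous_sndf].
  - apply: continuous_compf expform_continuous.
    by apply: continuous_pairf => //; exact: continuous_cstf.
  - exact: continuous_sndf.
  - exact: continuous_cstf.
rewrite (_ : transported k T s = (fun b => H3 (b, 1))); last first.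
  by apply/funext => b; rewrite /H3 /= subrr scale0r add0r scale1r.
apply: stably_essential_homotopy => //; last first.
  rewrite (_ : (fun b => _) = (fun b => H2 (b, 1))) //.
  by apply/funext => b; rewrite /H2 /H3 /= subr0 !scale1r scale0r addr0.
move=> b r b1 r01; apply/eqP => /(kap_eq0 (transport_mem _ _ _ _)).
have TN1 : `|T *: b| <= T by have := TN b 1 b1; rewrite scale1r; apply; rewrite ler01 lexx.
move=> /(transport_eq0 k0 cl TN1); set w := expform (1, T *: b) => pw.
have wm : w \in pencil_space (u (expmap (T *: b))).
  by have := @expform_mem 1 (T *: b) ler01; rewrite scale1r.
(* If the projection vanished, the scalar product with the flowed form [w] would give
   [(1 - r) * dot w w + r * pairing w s = 0], although both coefficients are nonnegative with sum 1
   and both values are positive. *)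
have := dot_proj ((1 - r) *: w + r *: s) wm; rewrite pw.
have sT := sP.1.
have -> : dot w ((1 - r) *: w + r *: s) = (1 - r) * dot w w + r * pairing w s.
  rewrite pairing_dot// !dotE linearD !linearZ /= mulmxDr mxtraceD.
  by rewrite -!scalemxAr !mxtraceZ.
rewrite dotE trmx0 mulmx0 mxtrace0.
have := dot_gt0 (expform_neq0 1 (v_neq0 _ b1)); rewrite -/w => ww.
have := expform_pairing (v_neq0 _ b1) us sP s0; rewrite -/w => ws.
by case/andP: r01 => r0 r1; nra.
Qed.

End Exponential.

Section LocalFitting.
Variables (R : realType) (n d : nat) (M : topologicalType).
Variables (u : M -> grassmannian R n d) (F : M * 'M[R]_n * R -> M * 'M[R]_n).
Hypotheses (cu : continuous u) (Fs : flow_spec u F) (mu : forall x, mixed (u x)).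

Lemma pencil_proj_u_continuous : continuous (fun x => pencil_proj (u x)).
Proof.
exact: (@continuous_compf M (grassmannian R n d) _ u (fun P => pencil_proj P) cu
  (@pencil_proj_continuous R n d)).
Qed.

Lemma close_projectionsP (P P' : grassmannian R n d) (q : 'M[R]_n) : q != 0 ->
  `|pencil_proj P - pencil_proj P'| < ((n * n)%:R + 1)^-1 ->
  `|proj P q - proj P' q| < `|q|.
Proof.
move=> q0 PP'; apply: le_lt_trans (proj_delta_bound _ _ _) _.
have N0 : 0 < (n * n)%:R + 1 :> R by rewrite ltr_wpDl.
have nq : 0 < `|q| by rewrite normr_gt0.
move: PP'; rewrite -[ltRHS]mul1r ltr_pdivlMr// => h.
rewrite mulrCA gtr_pMr//; apply: le_lt_trans h.
by rewrite mulrDr mulr1 mulrC lerDl.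
Qed.

Hypothesis n0 : (0 < n)%N.

Lemma flow_moves x q t : in_bundle u x q -> 0 < t -> (F (x, q, t)).1 != x.
Proof.
move=> xq t0; apply/eqP => Fx; have [s [us sP]] := mu x.
have := flow_pairing_gt0 Fs xq t0 us (positive_semipositive sP) (positive_tensors_neq0 n0 sP).
have [_ h] := us; rewrite h ?ltxx//.
by have [] := flow_spec_in Fs t xq; rewrite Fx.
Qed.

(** [essential_comp_surj] is applied in a chart to the exponential map on the ball of radius [T],
    with the section of a tensor annihilated by [u y] read in the chart as [sg]. The zeros of the
    section along the exponential map lie over [y] only, while the sphere is carried away from [y]
    by a distance uniform in [y]. So near [x] a single projection replaces the transport. *)
Lemma local_flow_surjective (x : M) : locally_euclidean R d M -> exists2 A : set M, nbhs x A &
  forall y y', A y -> A y' -> y != y' ->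
    exists q t, [/\ in_bundle u y q, 0 < t & (F (y, q, t)).1 = y'].
Proof.
move=> /(_ x)[U [f [h [[oU Ux oO] [cf ch hf]]]]].
move: cf; rewrite continuous_open_subspace// => cf.
move: ch; rewrite continuous_open_subspace// => ch.
have cfU y : U y -> {for y, continuous f} by move=> Uy; apply: cf; exact: mem_set.
set O := f @` U in oO ch *.
have Ofx : O (f x) by exists x.
(* Half the bound of [close_projectionsP], so that any two pencils within [eta] of the one at [x]
   satisfy it. *)
pose eta : R := ((n * n)%:R + 1)^-1 / 2.
have eta0 : 0 < eta by rewrite divr_gt0// invr_gt0 ltr_wpDl.
have [r1 r10 r1P] : exists2 r1 : R, 0 < r1 & forall w, `|w - f x| <= r1 ->
    O w /\ `|pencil_proj (u (h (f x))) - pencil_proj (u (h w))| < eta.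
  have c1 : {for f x, continuous (fun w => pencil_proj (u (h w)))}.
    apply: (@continuous_comp _ _ _ h (fun y => pencil_proj (u y))).
      by apply: ch; exact: mem_set.
    exact: pencil_proj_u_continuous.
  have n1 : \forall w \near f x, O w by exact: open_nbhs_nbhs.
  have [r /= r0 rP] := (nbhs_ballP _ _).1 (filterI n1 (near_continuous_at c1 eta0)).
  exists (r / 2); first by rewrite divr_gt0.
  move=> w wr; apply: rP; rewrite -ball_normE /= distrC (le_lt_trans wr)//.
  by rewrite ltr_pdivrMr// ltr_pMr// ltr1n.
pose V1 : set M := [set y | U y /\ `|f y - f x| < r1].
have nV1 : nbhs x V1.
  have nU : nbhs x U by exact: open_nbhs_nbhs.
  apply: (near_and_imp nU (near_continuous_at (cfU x Ux) r10)) => y Uy.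
  by rewrite distrC.
have [[/= A B] [nA nB] AB] := flow_near cu Fs nV1.
have [T T0 TB] : exists2 T : R, 0 < T & forall t, 0 <= t <= T -> B t.
  have [r /= r0 rP] := (nbhs_ballP _ _).1 nB.
  exists (r / 2); first by rewrite divr_gt0.
  move=> t /andP[t0 tr]; apply: rP; rewrite -ball_normE /= sub0r normrN ger0_norm//.
  by rewrite (le_lt_trans tr)// ltr_pdivrMr// ltr_pMr// ltr1n.
have FV1 y q t : A y -> q \in pencil_space (u y) -> `|q| = 1 -> 0 <= t <= T ->
    V1 (F (y, q, t)).1.
  by move=> Ay qy q1 tT; apply: (AB (y, t)) => //=; split => //; exact: TB.
(* No flow line has returned at the time [T], by [flow_moves]; compactness of the sphere of forms
   makes the displacement in the chart uniformly positive for base points near [x]. *)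
have [r3 r30 [A3 nA3 A3P]] : exists2 r3 : R, 0 < r3 & exists2 A3, nbhs x A3 &
    forall y q, A3 y -> q \in pencil_space (u y) -> `|q| = 1 ->
      r3 < `|f (F (y, q, T)).1 - f y|.
  pose P (a : M * R) (q : 'M[R]_n) := q \in pencil_space (u a.1) ->
    a.2 < `|f (F (a.1, q, T)).1 - f a.1|.
  have FF : Filter (filter_prod (nbhs x) (0 : R)^'+) by exact: filter_prod_filter.
  have : \forall a \near filter_prod (nbhs x) (0 : R)^'+,
      forall q, [set q : 'M[R]_n | `|q| = 1] q -> P a q.
    apply: (compact_near (P := P) (@compact_mx_sphere R n n)) => q0 /= q01.
    have q00 : q0 != 0 by rewrite -normr_eq0 q01 oner_neq0.
    suff [[C1 C2] [/= nC1 nC2] [r r0 CP]] : exists2 C : set M * set 'M[R]_n,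
        nbhs x C.1 /\ nbhs q0 C.2 & exists2 r : R, 0 < r &
          forall y q, C.1 y -> C.2 q -> q \in pencil_space (u y) ->
            r < `|f (F (y, q, T)).1 - f y|.
      exists (C2, [set a : M * R | C1 a.1 /\ a.2 < r]) => /=.
        split=> //; exists (C1, [set t | t < r]) => //=.
        by split=> //; exact: nbhs_right_lt.
      move=> [q [y t]] [/= qC [yC tr]] qy; apply: lt_trans tr _.
      exact: CP.
    have [qx|qx] := boolP (q0 \in pencil_space (u x)); last first.
      have c : continuous (fun b : M * 'M[R]_n => `|proj (u b.1) b.2 - b.2|).
        apply: continuous_normf; apply: continuousBf; last exact: continuous_sndf.
        exact: proj_continuous.
      have p0 : 0 < `|proj (u x) q0 - q0|.
        by rewrite normr_gt0 subr_eq0; apply: contra qx => /eqP/projP.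
      have np : nbhs (`|proj (u x) q0 - q0|) [set r : R | 0 < r].
        by apply: open_nbhs_nbhs; split => //; exact: open_gt.
      have [[C1 C2] nC CP] := c (x, q0) _ np.
      exists (C1, C2) => //; exists 1 => // y q Cy Cq /projP e.
      by have := CP (y, q) (conj Cy Cq); rewrite /= e subrr normr0 ltxx.
    have Tx : V1 (F (x, q0, T)).1.
      by apply: FV1; rewrite ?(ltW T0) ?lexx//; exact: nbhs_singleton.
    have rho0 : 0 < `|f (F (x, q0, T)).1 - f x|.
      rewrite normr_gt0 subr_eq0; apply: contra (flow_moves (conj qx q00) T0).
      by move=> /eqP e; rewrite -(hf _ Tx.1) e hf.
    have cF : {for (x, q0), continuous (fun b : M * 'M[R]_n => f (F (b, T)).1 - f b.1)}.
      apply: continuous_atB.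
        apply: (@continuous_comp _ _ _ (fun b : M * 'M[R]_n => (F (b, T)).1) f);
          last exact: cfU Tx.1.
        apply: (@continuous_comp _ _ _ (fun b : M * 'M[R]_n => F (b, T)) fst);
          last exact: continuous_fstf.
        apply: (@continuous_comp _ _ _ (fun b : M * 'M[R]_n => (b, T)) F).
          exact: continuous_pairf (@continuous_idf _) (@continuous_cstf _ _ _) _.
        by apply: (flow_spec_cont Fs); rewrite proj_id.
      apply: (@continuous_comp _ _ _ (fun b : M * 'M[R]_n => b.1) f); last exact: cfU.
      exact: continuous_fstf.
    have half : 0 < `|f (F (x, q0, T)).1 - f x| / 2 by rewrite divr_gt0.
    have [[C1 C2] nC CP] := near_continuous_at cF half.
    exists (C1, C2) => //; exists (`|f (F (x, q0, T)).1 - f x| / 2) => // y q Cy Cq qy.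
    have := CP (y, q) (conj Cy Cq); rewrite /=.
    set a := f (F (x, q0, T)).1 - f x; set b := f (F (y, q, T)).1 - f y => ab.
    have := ler_normD (a - b) b; rewrite subrK.
    by move: ab; lra.
  move=> [[/= A3 B3] [nA3 nB3] AB3].
  have [r3 [r30 B3r]] : exists r3 : R, 0 < r3 /\ B3 r3.
    have nn : (0 : R)^'+ ([set r | 0 < r] `&` B3).
      by apply: filterI => //; exact: nbhs_right_gt.
    by have [r [r0 Br]] := filter_ex nn; exists r.
  exists r3 => //; exists A3 => // y q Ay qy q1.
  exact: (AB3 (y, r3) (conj Ay B3r) q q1 qy).
(* [f y'] will be within [r4] of [f y], where the zeros lie, while the sphere is mapped beyond [r3]
   from [f y], hence beyond [r3 - r4 = r4] from [f y']. *)
pose r4 := r3 / 2.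
have r40 : 0 < r4 by rewrite divr_gt0.
have r44 : 0 < r4 / 2 by rewrite divr_gt0.
exists (A `&` A3 `&` V1 `&` [set y | `|f x - f y| < r4 / 2]).
  apply: filterI; last exact: (near_continuous_at (cfU x Ux) r44).
  by apply: filterI => //; exact: filterI.
move=> y y' [[[Ay A3y] [Uy yr]] yr4] [[_ [Uy' yr']] yr4'] yy'.
have [W [W' [WW' Wu W'W]]] := pencil_coordinates (u y).
have [s [us sP]] := mu y.
have sS := positive_semipositive sP; have s0 := positive_tensors_neq0 n0 sP.
pose g := expmap F y W.
have in_y v : v != 0 -> in_bundle u y (vec_mx (v *m W)).
  move=> v0; split; first exact: Wu.
  apply: contra v0 => /eqP e; apply/eqP.
  by rewrite -[v]mulmx1 -WW' mulmxA -[v *m W]vec_mxK e linear0 mul0mx.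
have gV1 v : `|v| <= T -> V1 (g v).
  move=> vT; have [->|v0] := eqVneq v 0; first by rewrite /g expmap0.
  rewrite /g expmapE//; have [qy q0] := in_y v v0.
  rewrite -(flow_specZ Fs _ (_ : 0 < `|vec_mx (v *m W)|^-1)) ?invr_gt0 ?normr_gt0//.
  apply: FV1 => //; [exact: memvZ|exact: norm_normalize|by rewrite normr_ge0].
pose fv (v : 'rV[R]_d) := f (g (T *: clip 1 v)).
have TcT (v : 'rV[R]_d) : `|T *: clip 1 v| <= T.
  by rewrite normrZ gtr0_norm// ler_piMr ?(ltW T0)// clip_le.
have cfv : continuous fv.
  move=> v; apply: (@continuous_comp _ _ _ (fun v : 'rV[R]_d => g (T *: clip 1 v)) f).
    move: v; apply: (@continuous_compf _ _ _ (fun v : 'rV[R]_d => T *: clip 1 v) g).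
      by apply: continuousZf; [exact: continuous_cstf|exact: clip_continuous].
    exact: (expmap_continuous cu Fs WW' Wu).
  by apply: cfU; have [] := gV1 _ (TcT v).
(* Retracting onto a ball inside the chart makes [sg] continuous on the whole space without changing
   it on the image of the exponential map. *)
pose cw (w : 'rV[R]_d) := f x + clip r1 (w - f x).
have ccw : continuous cw.
  apply: continuousDf; first exact: continuous_cstf.
  apply: (@continuous_compf _ _ _ (fun w : 'rV[R]_d => w - f x) (@clip _ _ r1));
    last exact: clip_continuous.
  by apply: continuousBf; [exact: continuous_idf|exact: continuous_cstf].
have cwr w : `|cw w - f x| <= r1 by rewrite /cw addrC addKr clip_le.
pose sg w : 'rV[R]_d := mxvec (proj (u y) (proj (u (h (cw w))) s)) *m W'.
have csg : continuous sg.
  apply: continuous_mulmxf; last exact: continuous_cstf.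
  apply: continuous_mxvecf.
  apply: (@continuous_compf _ (M * 'M[R]_n)%type _ (fun w => (y,
    proj (u (h (cw w))) s)) (fun p => proj (u p.1) p.2)); last exact: proj_continuous.
  apply: continuous_pairf; first exact: continuous_cstf.
  apply: (@continuous_compf _ (M * 'M[R]_n)%type _ (fun w => (h (cw w), s)) (fun p =>
    proj (u p.1) p.2)); last exact: proj_continuous.
  apply: continuous_pairf; last exact: continuous_cstf.
  move=> w; apply: (@continuous_comp _ _ _ cw h); first exact: ccw.
  by apply: ch; apply: mem_set; exact: (r1P _ (cwr w)).1.
have hcw v : `|v| <= 1 -> h (cw (fv v)) = g (T *: v).
  move=> v1; have [Ug gr] := gV1 _ (TcT v); rewrite /cw clip_id//; last exact: ltW.
  by rewrite addrC subrK /fv hf// clip_id.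
have near_u v : `|v| <= T -> exists2 w, `|w - f x| <= r1 & g v = h w.
  move=> vT; have [Ug gr] := gV1 v vT; exists (f (g v)); first exact: ltW.
  by rewrite hf.
have cl : close_projections u F y W 1 T.
  move=> v j q vT; case: j => // _ q0; rewrite mul0r scale0r divr1 scale1r.
  have [w wr gw] := near_u v vT.
  have [w0 w0r gw0] := near_u 0 (ltac:(by rewrite normr0 ltW)).
  rewrite -/(g v) -/(g 0) gw gw0; apply: close_projectionsP => //.
  rewrite [ltRHS]splitr -/eta.
  have [_ h1] := r1P w wr; have [_ h2] := r1P w0 w0r.
  rewrite -(subrK (pencil_proj (u (h (f x)))) (pencil_proj (u (h w0)))) -addrA.
  by rewrite (le_lt_trans (ler_normD _ _))// ltrD// distrC.
have sgE v : `|v| <= 1 -> sg (fv v) = transported u F y W W' 1 T s v.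
  move=> v1; rewrite /sg hcw// /transported /= expmap0 divr1 scale1r.
  by [].
have ess : essential (fun v => sg (fv v)).
  have [e1 _] := transported_essential cu Fs WW' Wu W'W (isT : (0 < 1)%N) T0 cl us sS s0.
  by apply: essential_ext e1 => b b1; rewrite sgE// b1.
have r4r3 : r4 + r4 = r3 by rewrite /r4 -splitr.
have dyy' : `|f y - f y'| < r4.
  rewrite -(subrK (f x) (f y)) -addrA (le_lt_trans (ler_normD _ _))//.
  by rewrite [ltRHS]splitr ltrD// distrC.
have [|v v1|v v1 fvy'] := @essential_comp_surj R d fv sg (f y') r4 r40 cfv csg _ _ ess.
- move=> v v1; rewrite sgE// => /(transported_eq0 W'W (isT : (0 < 1)%N) cl).
  rewrite normrZ gtr0_norm// ler_piMr ?(ltW T0)// => /(_ isT) p0.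
  have Tv0 : T *: v = 0.
    apply: (expmap_annihilator Fs WW' Wu us sS s0).
    by apply/annihilatorP; split => //; exact: sP.1.
  have -> : fv v = f y by rewrite /fv clip_id// Tv0 /g expmap0.
  exact: dyy'.
- have Tv0 : T *: v != 0 by rewrite scaler_eq0 gt_eqF//= -normr_eq0 v1 oner_neq0.
  have : r3 < `|fv v - f y|.
    rewrite /fv clip_id ?v1// /g expmapE// normrZ v1 mulr1 gtr0_norm//.
    have [qy q0] := in_y _ Tv0.
    rewrite -(flow_specZ Fs _ (_ : 0 < `|vec_mx (T *: v *m W)|^-1)) ?invr_gt0 ?normr_gt0//.
    by apply: A3P => //; [exact: memvZ|exact: norm_normalize].
  have := ler_normD (fv v - f y') (f y' - f y).
  by rewrite addrA subrK [`|f y' - f y|]distrC; move: dyy' r4r3; lra.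
have gy' : g (T *: v) = y'.
  have [Ug _] := gV1 _ (TcT v); move: fvy'; rewrite /fv => e.
  by rewrite -(hf _ Uy') -e hf ?clip_id// -{1}(clip_id _ v1)//.
have Tv0 : T *: v != 0.
  by apply: contra yy' => /eqP e; rewrite -gy' e /g expmap0.
exists (vec_mx (T *: v *m W)), `|T *: v|; split; first exact: in_y.
  by rewrite normr_gt0.
by rewrite -gy' /g expmapE.
Qed.

End LocalFitting.

(** * Surjectivity of the flow *)

Lemma exists_power_gt (R : realType) (c B : R) : 0 < c -> exists k, B < (1 + c) ^+ k.+1.
Proof.
move=> c0; have bern k : 1 + k%:R * c <= (1 + c) ^+ k.
  elim: k => [|k IH]; first by rewrite mul0r addr0 expr0.
  have k0 : 0 <= k%:R :> R by [].
  rewrite exprS -natr1; apply: (@le_trans _ _ ((1 + c) * (1 + k%:R * c))); first by nra.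
  by rewrite ler_pM2l// ltr_pwDl// ltW.
have [k kB] : exists k : nat, `|B| / c < k%:R.
  exists (Num.trunc (`|B| / c)).+1.
  by have /trunc_itv/andP[] : 0 <= `|B| / c by rewrite divr_ge0// ltW.
exists k; apply: lt_le_trans (bern k.+1); rewrite -natr1.
move: kB; rewrite ltr_pdivrMr// => kB.
by apply: le_lt_trans (ler_norm B) _; lra.
Qed.

Lemma closed_diagonal (X : topologicalType) : hausdorff_space X ->
  closed [set xy : X * X | xy.1 = xy.2].
Proof.
move=> hX [x y] cl /=; apply: hX => A B nA nB.
have [|[z z'] [/= e [/= Az Bz']]] := cl (A `*` B); first by exists (A, B).
by exists z; split => //; rewrite e.
Qed.

Lemma semipositive0 (R : realType) n : semipositive_tensors (0 : 'M[R]_n).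
Proof.
split; first by rewrite /symmetric_tensors /= trmx0.
by move=> l; rewrite mulmx0 mul0mx mxE.
Qed.

Lemma compact_comparable (R : realType) n (X : topologicalType) (K : set X)
    (s : X -> 'M[R]_n) (r : 'M[R]_n) : compact K -> continuous s ->
  (forall x, K x -> positive_tensors (s x)) -> positive_tensors r ->
  exists D : R, forall x, K x -> positive_tensors (D *: s x - r) /\
                                 positive_tensors (D *: r - s x).
Proof.
move=> cK cs sP rP.
have : \forall D \near (+oo : set_system R), forall x, K x -> K x ->
    positive_tensors (D *: s x - r) /\ positive_tensors (D *: r - s x).
  apply: compact_near => // x0 Kx0.
  have [e e0 eP] := positive_tensors_open (sP x0 Kx0).
  have [e' e'0 e'P] := positive_tensors_open rP.
  have e20 : 0 < e / 2 by rewrite divr_gt0.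
  near=> x D => Kx.
  have D0 : 0 < D by near: D; apply: nbhs_pinfty_gt; exact: num_real.
  have D1 : `|r| / (e / 2) < D by near: D; apply: nbhs_pinfty_gt; exact: num_real.
  have D2 : (`|s x0| + e / 2) / e' < D by near: D; apply: nbhs_pinfty_gt; exact: num_real.
  have sx : `|s x0 - s x| < e / 2 by near: x; apply: (near_continuous_at (cs x0) e20).
  have sT y : K y -> (s y)^T = s y by move=> /sP[].
  have rT : r^T = r := rP.1.
  have DD y : D *: (D^-1 *: y) = y :> 'M[R]_n by rewrite scalerA divff ?scale1r// gt_eqF.
  split.
    rewrite -(DD r) -scalerBr; apply: positive_tensorsZ => //.
    rewrite -(subrK (s x0) (s x)) [_ - _ + _]addrC -addrA; apply: eP.
      by rewrite !linearB /= linearZ /= !sT// rT.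
    rewrite (le_lt_trans (ler_normB _ _))// [ltRHS]splitr ltrD//; first by rewrite distrC.
    by rewrite normrZ gtr0_norm ?invr_gt0// mulrC ltr_pdivrMr// -ltr_pdivrMl// mulrC.
  rewrite -(DD (s x)) -scalerBr; apply: positive_tensorsZ => //; apply: e'P.
    by rewrite linearN /= linearZ /= sT.
  rewrite normrN normrZ gtr0_norm ?invr_gt0// mulrC ltr_pdivrMr// -ltr_pdivrMl// mulrC.
  apply: le_lt_trans D2; rewrite ler_pM2r ?invr_gt0//.
  rewrite -(subrK (s x0) (s x)) (le_trans (ler_normD _ _))// addrC lerD2l ltW//.
  by rewrite distrC.
move=> h; near (+oo : set_system R) => D; exists D => x Kx.
have hD : forall x, K x -> K x ->
  positive_tensors (D *: s x - r) /\ positive_tensors (D *: r - s x) by near: D.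
exact: hD.
Unshelve. all: by end_near. Qed.

Section Clamp.
Variable R : realType.

(** Composition with this retraction turns continuity within the unit interval into continuity on
    the line. *)
Definition clamp01 (t : R) : R := Num.max 0 (Num.min 1 t).

Lemma clamp01_continuous : continuous clamp01.
Proof.
apply: continuous_maxf; first exact: continuous_cstf.
by apply: continuous_minf; [exact: continuous_cstf|exact: continuous_idf].
Qed.

Lemma clamp01_itv t : 0 <= clamp01 t <= 1.
Proof. by rewrite /clamp01 le_max lexx /= ge_max ler01 ge_min lexx. Qed.

Lemma clamp01_id t : 0 <= t <= 1 -> clamp01 t = t.
Proof. by move=> /andP[t0 t1]; rewrite /clamp01 min_r// max_r. Qed.

Lemma continuous_clamp (T : topologicalType) (a : R -> T) :
  {within `[0, 1], continuous a} -> continuous (fun t => a (clamp01 t)).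
Proof.
move=> /subspace_sigL_continuousP ca.
have itv t : `[0, 1]%classic (clamp01 t) by rewrite /= in_itv /=; exact: clamp01_itv.
pose c' (t : R) : `[0, 1]%classic := SigSub (mem_set (itv t)).
have cc' : continuous c'.
  by apply: continuous_comp_initial; exact: clamp01_continuous.
exact: continuous_compf cc' ca.
Qed.

End Clamp.

Section Surjectivity.
Variables (R : realType) (n d : nat) (M : topologicalType).
Variables (u : M -> grassmannian R n d) (F : M * 'M[R]_n * R -> M * 'M[R]_n).
Hypotheses (cu : continuous u) (Fs : flow_spec u F) (mu : forall x, mixed (u x)).
Hypothesis n0 : (0 < n)%N.

Lemma flow_disjoint x q t s : in_bundle u x q -> 0 < t -> annihilator (u x) s ->
  semipositive_tensors s -> s != 0 -> ~ annihilator (u (F (x, q, t)).1) s.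
Proof.
move=> xq t0 us sP s0 [_ us']; have := flow_pairing_gt0 Fs xq t0 us sP s0.
by rewrite us' ?ltxx//; exact: (flow_spec_in Fs t xq).1.
Qed.

Lemma projection_continuous (X : topologicalType) (g : X -> M) (q : X -> 'M[R]_n) :
  continuous g -> continuous q -> continuous (fun a => proj (u (g a)) (q a)).
Proof.
move=> cg cq; apply: (@continuous_compf _ (M * 'M[R]_n)%type _ (fun a => (g a, q a))
  (fun p => proj (u p.1) p.2)); last exact: proj_continuous.
exact: continuous_pairf.
Qed.

Lemma annihilator_sub_proj x (h : 'M[R]_n) : h^T = h -> annihilator (u x) (h - proj (u x) h).
Proof.
move=> hT; have pm := proj_mem (u x) h; apply/annihilatorP; split.
  by rewrite linearB /= hT (pencil_sym pm).
by rewrite projB (proj_id pm) subrr.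
Qed.

(** A positive tensor [h] annihilated at time [t] remains positive after removal of its projection
    onto the pencils at nearby times. Since projections are linear and positive tensors form a
    convex cone, local choices are glued by tent functions. *)
Lemma positive_selection (g : R -> M) : continuous g -> exists s : R -> 'M[R]_n,
  continuous s /\ forall t, 0 <= t <= 1 ->
    annihilator (u (g t)) (s t) /\ positive_tensors (s t).
Proof.
move=> cg.
pose P (r t : R) := exists2 h : 'M[R]_n, h^T = h &
  forall t', `|t - t'| < r -> positive_tensors (h - proj (u (g t')) h).
have [r r0 rP] : exists2 r : R, 0 < r & forall t, `[0, 1]%classic t -> P r t.
  have : \forall r \near (0 : R)^'+, forall t, `[0, 1]%classic t -> P r t.
    apply: compact_near; first exact: segment_compact.
    move=> t0 _; have [h [/annihilatorP[hT ph] hP]] := mu (g t0).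
    have [e e0 eP] := positive_tensors_open hP.
    have cp : continuous (fun t => proj (u (g t)) h).
      by apply: projection_continuous => //; exact: continuous_cstf.
    have [a /= a0 aP] := (nbhs_ballP _ _).1 (near_continuous_at (cp t0) e0).
    have a20 : 0 < a / 2 by rewrite divr_gt0.
    near=> t r.
    have ra : r < a / 2 by near: r; exact: nbhs_right_lt.
    have ta : `|t0 - t| < a / 2 by near: t; exact: (@near_dist R R^o).
    exists h => // t' tt'; apply: eP.
      by rewrite linearN /= (pencil_sym (proj_mem _ _)).
    rewrite normrN; have := aP t'; rewrite /= ph sub0r normrN; apply.
    rewrite /ball /= -(subrK t t0) -addrA (le_lt_trans (ler_normD _ _))//.
    by rewrite [ltRHS]splitr ltrD// (lt_trans tt').
  move=> hr; near (0 : R)^'+ => r; exists r; near: r => //; exact: nbhs_right_gt.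
pose N := (Num.trunc r^-1).+1.
have N0 : (0 : R) < N%:R by rewrite ltr0n.
have Nr : N%:R^-1 < r.
  rewrite -[ltRHS]invrK ltf_pV2 ?posrE ?invr_gt0//.
  by have /trunc_itv/andP[] : 0 <= r^-1 by rewrite invr_ge0 ltW.
have pick (i : 'I_N.+1) : exists h : 'M[R]_n, h^T = h /\
    forall t', `|i%:R / N%:R - t'| < r -> positive_tensors (h - proj (u (g t')) h).
  have [|h hT hP] := rP (i%:R / N%:R); last by exists h.
  rewrite /= in_itv /= divr_ge0//= ler_pdivrMr// mul1r ler_nat -ltnS.
  exact: ltn_ord.
have [h hP] := choice pick.
(* The tents have half-width [N%:R^-1], less than [r], and at each time of the interval one of them
   is positive, which suffices in a convex cone. *)
pose phi (i : 'I_N.+1) (t : R) : R := Num.max 0 (1 - N%:R * `|i%:R / N%:R - t|).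
pose H t := \sum_i phi i t *: h i.
have HT t : (H t)^T = H t.
  rewrite /H linear_sum; apply: eq_bigr => i _; by rewrite linearZ /= (hP i).1.
have cH : continuous H.
  apply: continuous_sumf => i; apply: continuousZf; last exact: continuous_cstf.
  apply: continuous_maxf; first exact: continuous_cstf.
  apply: (@continuousBf R _ R^o); first exact: continuous_cstf.
  apply: continuousMf; first exact: continuous_cstf.
  apply: (@continuous_normf R _ R^o).
  by apply: (@continuousBf R _ R^o); [exact: continuous_cstf|exact: continuous_idf].
exists (fun t => H t - proj (u (g t)) (H t)); split.
  by apply: continuousBf => //; exact: projection_continuous.
move=> t /andP[t0 t1]; split; first exact: annihilator_sub_proj.
have -> : H t - proj (u (g t)) (H t) =
    \sum_i phi i t *: (h i - proj (u (g t)) (h i)).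
  rewrite [in X in _ - X]/H (big_morph _ (projD (u (g t))) (proj0 (u (g t)))).
  rewrite /H -sumrB; apply: eq_bigr => i _; by rewrite projZ scalerBr.
have term i : phi i t = 0 \/ 0 < phi i t /\ positive_tensors (h i - proj (u (g t)) (h i)).
  rewrite /phi; case: (leP 0 (1 - N%:R * `|i%:R / N%:R - t|)) => [|_]; last by left.
  rewrite le_eqVlt => /orP[/eqP<-|p0]; [by left|right; split => //].
  apply: (hP i).2; apply: lt_trans Nr; rewrite -[ltRHS]mul1r ltr_pdivlMr// mulrC.
  by rewrite -subr_gt0.
have semi i : semipositive_tensors (phi i t *: (h i - proj (u (g t)) (h i))).
  have [->|[p0 hp]] := term i; first by rewrite scale0r; exact: semipositive0.
  by apply: semipositive_tensorsZ; [exact: ltW|exact: positive_semipositive].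
have Nt0 : 0 <= N%:R * t by rewrite mulr_ge0.
have /andP[tr1 tr2] := trunc_itv Nt0.
have iN : (Num.trunc (N%:R * t) < N.+1)%N.
  by rewrite ltnS -(ler_nat R) (le_trans tr1)// ler_piMr.
rewrite (bigD1 (Ordinal iN))//=; apply: positive_tensorsD.
  have [p0|[p0 hp]] := term (Ordinal iN); last exact: positive_tensorsZ.
  have : 0 < phi (Ordinal iN) t.
    rewrite lt_max ltxx /= subr_gt0 -{1}(gtr0_norm N0) -normrM mulrBr.
    rewrite mulrCA divff ?gt_eqF// mulr1 distrC ger0_norm ?subr_ge0//.
    by rewrite ltrBlDl natr1.
  by rewrite p0 ltxx.
elim/big_ind: _ => [|a b|i _]; [exact: semipositive0|exact: semipositive_tensorsD|exact: semi].
Unshelve. all: by end_near. Qed.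

Hypotheses (hM : hausdorff_space M) (lM : locally_euclidean R d M).
Variable C : R.
Hypothesis C0 : 0 < C.
Hypothesis CP : forall x q, in_bundle u x q ->
  exists2 c : R, 0 < c & expands C q (c *: (F (x, q, 1)).2).

(* Otherwise the zeros of the section defined by [s_t] along the exponential
   map would split into two closed sets, those over [a t] and the others, and
   a function separating them would deform an essential map off [0]. *)
Lemma flow_surjective x y (a : R -> M) : is_path x y a -> x != y ->
  exists q t, [/\ in_bundle u x q, 0 < t & (F (x, q, t)).1 = y].
Proof.
move=> [ca a0 a1] xy; apply: contrapT => no_flow.
have [W [W' [WW' Wu W'W]]] := pencil_coordinates (u x).
pose g := expmap F x W.
have cg : continuous g := expmap_continuous cu Fs WW' Wu.
have in_x v : v != 0 -> in_bundle u x (vec_mx (v *m W)).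
  move=> v0; split; first exact: Wu.
  apply: contra v0 => /eqP e; apply/eqP.
  by rewrite -[v]mulmx1 -WW' mulmxA -[v *m W]vec_mxK e linear0 mul0mx.
have gy v : g v != y.
  have [->|v0] := eqVneq v 0; first by rewrite /g expmap0.
  apply/eqP; rewrite /g expmapE// => e; apply: no_flow.
  by exists (vec_mx (v *m W)), `|v|; split; [exact: in_x|rewrite normr_gt0|].
pose cl01 (t : R) : R := clamp01 t.
have ccl : continuous cl01 := @clamp01_continuous R.
have cl01_in t : 0 <= cl01 t <= 1 := clamp01_itv t.
have cl01_id t : 0 <= t <= 1 -> cl01 t = t := @clamp01_id R t.
pose gam t := a (cl01 t).
have cgam : continuous gam := continuous_clamp ca.
have gam0 : gam 0 = x by rewrite /gam cl01_id ?a0// ?lexx ?ler01.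
have gam1 : gam 1 = y by rewrite /gam cl01_id ?a1// ?lexx ?ler01.
have [s [cs sP]] := positive_selection cgam.
have i01 : 0 <= (0 : R) <= 1 by rewrite lexx ler01.
have us0 : annihilator (u x) (s 0) by rewrite -{1}gam0; exact: (sP 0 i01).1.
have sS t : 0 <= t <= 1 -> semipositive_tensors (s t).
  by move=> /sP[_ /positive_semipositive].
have sn0 t : 0 <= t <= 1 -> s t != 0.
  by move=> /sP[_]; exact: positive_tensors_neq0.
have [D DP] : exists D : R, forall t, 0 <= t <= 1 ->
    positive_tensors (D *: s t - s 0) /\ positive_tensors (D *: s 0 - s t).
  have [|D DP] := compact_comparable (@segment_compact R 0 1) cs _ (sP 0 i01).2.
    by move=> t; rewrite /= in_itv /= => /sP[].
  by exists D => t t01; apply: DP; rewrite /= in_itv.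
(* Each [s t] is comparable with [s 0] by the factor [D]. By [flow_time_bound], a flow line from [x]
   of duration at least [T] therefore never ends where some [s t] is annihilated. *)
have [k kP] := @exists_power_gt R C^-1 (C ^+ 2 * D ^+ 2) (ltac:(by rewrite invr_gt0)).
pose T : R := k.+2%:R.
have T0 : 0 < T by rewrite ltr0n.
have far v t : T <= `|v| -> 0 <= t <= 1 -> ~ annihilator (u (g v)) (s t).
  move=> vT t01; have v0 : v != 0 by rewrite -normr_gt0 (lt_le_trans T0).
  rewrite /g expmapE// => us'.
  have := flow_time_bound Fs C0 CP (in_x v v0) us0 us' (sS 0 i01) (sn0 0 i01)
    (sS t t01) (sn0 t t01) (positive_semipositive (DP t t01).2)
    (positive_semipositive (DP t t01).1) vT.
  by rewrite leNgt kP.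
have cB : compact [set v : 'rV[R]_d | `|v| <= T].
  by have := @compact_rV_ball R d 0 T; under eq_fun do rewrite subr0.
have cpp : continuous (fun v => pencil_proj (u (g v))).
  exact: (@continuous_compf _ M _ g (fun y => pencil_proj (u y)) cg
    (pencil_proj_u_continuous cu)).
have nn0 : 0 < ((n * n)%:R + 1)^-1 :> R by rewrite invr_gt0 ltr_wpDl.
have [r r0 rP] := compact_unif_continuous cB cpp nn0.
pose m := (Num.trunc (T / r)).+1.
have m0 : (0 : R) < m%:R by rewrite ltr0n.
have mr : T / m%:R < r.
  rewrite ltr_pdivrMr// mulrC -ltr_pdivrMr//.
  by have /trunc_itv/andP[] : 0 <= T / r by rewrite divr_ge0// ltW.
have cl : close_projections u F x W m T.
  move=> v j q vT jm q0; apply: close_projectionsP => //; apply: rP.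
    rewrite /= normrZ ger0_norm ?divr_ge0// (le_trans _ vT)// ler_piMl//.
    by rewrite ler_pdivrMr// mul1r ler_nat ltnW.
  rewrite -scalerBl -mulrBl normrZ normrM normfV (gtr0_norm m0).
  rewrite -natr1 opprD addrA subrr sub0r normrN normr1 mul1r mulrC.
  by apply: le_lt_trans mr; rewrite ler_pM2r ?invr_gt0.
have annP v t : 0 <= t <= 1 -> proj (u (g v)) (s t) = 0 -> annihilator (u (g v)) (s t).
  by move=> t01 e; apply/annihilatorP; split => //; have [_ []] := sP t t01.
pose V := ('rV[R]_d * R)%type.
(* The last coordinate of the unit ball runs over [[-1, 1]], the path parameter over [[0, 1]]. *)
pose tm (b : V) : R := cl01 ((1 + b.2) / 2).
have ctm : continuous tm.
  apply: continuous_compf ccl; apply: continuousMf; last exact: continuous_cstf.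
  by apply: (@continuousDf R _ R^o); [exact: continuous_cstf|exact: continuous_sndf].
pose G (p : 'rV[R]_d * R) := transported u F x W W' m T (s p.2) p.1.
have cG : continuous G.
  have c1 : continuous (fun p : 'rV[R]_d * R => (p.1, s p.2)).
    apply: continuous_pairf; first exact: continuous_fstf.
    exact: continuous_compf (@continuous_sndf _ _) cs.
  exact: continuous_compf c1 (transported_continuous cu Fs WW' Wu (k := m) (T := T)).
have G0 v t : `|v| <= 1 -> 0 <= t <= 1 -> G (v, t) = 0 -> annihilator (u (g (T *: v))) (s t).
  move=> v1 t01 /(transported_eq0 W'W (isT : (0 < m)%N) cl) h; apply: annP => //.
  by apply: h; rewrite normrZ gtr0_norm// ler_piMr// ltW.
have G1 v t : `|v| = 1 -> 0 <= t <= 1 -> G (v, t) != 0.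
  move=> v1 t01; apply/eqP => /(G0 _ _ _ t01); rewrite v1 lexx => /(_ isT).
  by apply: far => //; rewrite normrZ v1 mulr1 gtr0_norm.
have [_ E0] := transported_essential cu Fs WW' Wu W'W (isT : (0 < m)%N) T0 cl
  us0 (sS 0 i01) (sn0 0 i01).
(* The homotopy replaces the fixed tensor [s 0] by [s (tm b)]. A zero on the boundary would have
   last coordinate 0, hence a first component of norm 1, where [far] excludes zeros. *)
pose H1 (c : V * R) : V := (G (c.1.1, cl01 c.2 * tm c.1), c.1.2).
have cc1 : continuous (fun c : V * R => c.1.1).
  exact: continuous_compf (@continuous_fstf _ _) (@continuous_fstf _ _).
have E1 : essential (fun b => H1 (b, 1)).
  apply: essential_homotopy; last first.
  - apply: essential_ext E0 => -[v t] _.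
    by rewrite /H1 /G /= cl01_id// mul0r.
  - move=> [v t] rr vt1 rr01; apply/eqP => -[/= Gv t0]; rewrite t0 in vt1 Gv.
    have v1 := norm_pair_eq1 vt1.
    move/eqP: Gv; apply/negP; apply: G1 => //.
    have /andP[c1 c2] := cl01_in rr; have /andP[c3 c4] := cl01_in ((1 + 0) / 2).
    by rewrite mulr_ge0//= mulr_ile1.
  - apply: continuous_pairf;
    last exact: continuous_compf (@continuous_fstf _ _) (@continuous_sndf _ _).
    apply: (@continuous_compf _ _ _ (fun c : V * R => (c.1.1, cl01 c.2 * tm c.1)) _ _ cG).
    apply: continuous_pairf => //; apply: continuousMf.
      exact: continuous_compf (@continuous_sndf _ _) ccl.
    exact: continuous_compf (@continuous_fstf _ _) ctm.
have E1' : essential (fun b : V => (G (b.1, tm b), b.2)).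
  apply: essential_ext E1 => b _; rewrite /H1 /= cl01_id ?mul1r//.
  by rewrite ?ler01 ?lexx.
pose BV : set V := [set b | `|b| <= 1].
have clBV : closed BV.
  by have := @closed_dist_le R V 0 1; rewrite /BV; under eq_fun do rewrite subr0.
pose Z : set V := BV `&` [set b | `|G (b.1, tm b)| <= 0].
have cGt : continuous (fun b : V => G (b.1, tm b)).
  apply: (@continuous_compf _ _ _ (fun b : V => (b.1, tm b)) _ _ cG).
  by apply: continuous_pairf => //; exact: continuous_fstf.
have clZ : closed Z.
  apply: closedI => //.
  apply: (closed_preimage (f := fun b : V => `|G (b.1, tm b)|) _ (@closed_le _ 0)).
  exact: continuous_normf.
pose pr (b : V) : M * M := (gam (tm b), g (T *: b.1)).
have cpr : continuous pr.
  apply: continuous_pairf; first exact: continuous_compf ctm cgam.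
  apply: continuous_compf cg; apply: continuousZf; first exact: continuous_cstf.
  exact: continuous_fstf.
(* Pairs of points that share a nonzero semi-definite tensor only if they are equal. Local
   surjectivity makes [O] a neighbourhood of the diagonal, so the zeros over the diagonal are
   separated from the others by its interior. *)
pose O : set (M * M) := [set yy | forall q, annihilator (u yy.1) q ->
  semipositive_tensors q -> q != 0 -> annihilator (u yy.2) q -> yy.1 = yy.2].
have nO (z : M) : nbhs (z, z) O.
  have [A nA AP] := local_flow_surjective cu Fs mu n0 z lM.
  exists (A, A) => // -[y1 y2] [/= A1 A2] q us qP q0 us'.
  apply/eqP; apply: contraT => y12.
  have [q' [t [yq t0 Fy]]] := AP _ _ A1 A2 y12.
  by have := flow_disjoint yq t0 us qP q0; rewrite Fy.
pose Z1 := Z `&` [set b | (pr b).1 = (pr b).2].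
pose Z2 := Z `&` pr @^-1` (~` O^°).
have clZ1 : closed Z1.
  apply: closedI => //.
  rewrite (_ : [set b | _] = pr @^-1` [set yy | yy.1 = yy.2])//.
  apply: closed_preimage => //.
  exact: closed_diagonal.
have clZ2 : closed Z2.
  apply: closedI => //; apply: closed_preimage => //.
  by apply: open_closedC; exact: open_interior.
have tm01 b : 0 <= tm b <= 1 by exact: cl01_in.
have b1P (b : V) : BV b -> `|b.1| <= 1.
  by rewrite /BV /= prod_normE /= ge_max => /andP[].
have ZP b : Z b -> annihilator (u (pr b).2) (s (tm b)).
  move=> [Bb]; rewrite /= normr_le0 => /eqP; apply: G0 => //; exact: b1P.
have Z12 : Z1 `&` Z2 = set0.
  rewrite -subset0 => b [[_ /= e] [_ /= h]]; apply: h.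
  have -> : pr b = (gam (tm b), gam (tm b)) by rewrite /pr -e.
  exact: nO.

have ZU b : Z b -> Z1 b \/ Z2 b.
  move=> Zb; have [Ob|Ob] := pselect (O^° (pr b)); [left|by right].
  split => //; apply: (interior_subset Ob (s (tm b))).
  - exact: (sP _ (tm01 b)).1.
  - exact: sS.
  - exact: sn0.
  - exact: ZP.
have sep : uniform_separator Z1 Z2.
  by apply: normal_uniform_separator => //; exact: pseudometric_normal.
(* By the Urysohn function [K] is -1 on [Z1] and 1 on [Z2], hence without zeros on [Z], their
   union. *)
pose K (b : V) : R := 2 * Urysohn Z1 Z2 b - 1.
have cK : continuous K.
  apply: (@continuousBf R _ R^o); last exact: continuous_cstf.
  apply: continuousMf; first exact: continuous_cstf.
  exact: Urysohn_continuous.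
have K1 b : Z1 b -> K b = -1.
  move=> Zb; have := Urysohn_sub0 sep (R := R); move/(_ (Urysohn Z1 Z2 b)).
  by rewrite /K => ->; [rewrite mulr0 sub0r|exists b].
have K2 b : Z2 b -> K b = 1.
  move=> Zb; have := Urysohn_sub1 sep (R := R); move/(_ (Urysohn Z1 Z2 b)).
  by rewrite /K => ->; [rewrite mulr1 -[2]/(1 + 1 : R) addrK|exists b].
(* Where the first component vanishes on the boundary, the last coordinate is 1 or -1 and [K] agrees
   with it: at the end [y], which the exponential map misses, only [Z2] is possible, and at the end
   [x] the only zero is the origin, in [Z1]. So the segment from the last coordinate to [K] creates
   no zero. *)
have E2 : essential (fun b : V => (G (b.1, tm b), K b)).
  apply: (essential_segment _ _ _ E1').
  - by apply: continuous_pairf => //; exact: continuous_sndf.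
  - exact: continuous_pairf.
  move=> b rr b1 /andP[r0' r1']; apply/eqP => -[/=].
  rewrite -scalerDl subrK scale1r => Gb; rewrite -![_ *: _]/(_ * _) => Kb.
  have Bb : BV b by rewrite /BV /= b1.
  have Zb : Z b by split; rewrite //= Gb normr0.
  have v1 : `|b.1| != 1.
    apply/eqP => v1; have := G1 _ _ v1 (tm01 b); by rewrite Gb eqxx.
  have : `|b.2| = 1.
    move: b1; rewrite prod_normE /= /Num.max; case: ltP => // _ e.
    by rewrite e eqxx in v1.
  have [b20|b20] := leP 0 b.2.
    rewrite ger0_norm// => b21.
    have t1 : tm b = 1 by rewrite /tm b21 -[1 + 1]/(2 : R) divff// cl01_id// ?ler01 ?lexx.
    have Zb2 : Z2 b.
      have [[_ /= e]|//] := ZU b Zb.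
      by move: e; rewrite t1 gam1 => /esym/eqP; rewrite (negbTE (gy _)).
    by move: Kb; rewrite (K2 b Zb2) b21; lra.
  rewrite ltr0_norm// => b21; have b2E : b.2 = -1 by rewrite -[b.2]opprK b21.
  have t0 : tm b = 0 by rewrite /tm b2E subrr mul0r cl01_id.
  have Zb1 : Z1 b.
    split=> //=; rewrite t0 gam0.
    have := ZP b Zb; rewrite t0 /= => us'.
    have -> : T *: b.1 = 0.
      exact: (expmap_annihilator Fs WW' Wu us0 (sS 0 i01) (sn0 0 i01) us').
    by rewrite /g expmap0.
  by move: Kb; rewrite (K1 b Zb1) b2E; lra.
have [b b1 [Gb Kb]] := E2 (fun b : V => (G (b.1, tm b),
  K b)) (continuous_pairf cGt cK) (fun _ _ => erefl).
have Zb : Z b by split; rewrite //= Gb normr0.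
have [Z1b|Z2b] := ZU b Zb.
  by move: Kb; rewrite (K1 b Z1b) => /eqP; rewrite oppr_eq0 oner_eq0.
by move: Kb; rewrite (K2 b Z2b) => /eqP; rewrite oner_eq0.
Qed.

End Surjectivity.

(** * Deck transformations *)

Section Covering.
Variables (R : realType) (d : nat) (N M : topologicalType) (p : M -> N).
Hypothesis covp : covering_map p.

Lemma covering_sheet (y : N) : exists2 U : set N, open U /\ U y &
  forall x, U (p x) -> exists (A : set M) (s : N -> M),
    [/\ open A, A x, {in U, continuous s}, forall z, U z -> A (s z) /\ p (s z) = z &
        forall x', A x' -> U (p x') /\ s (p x') = x'].
Proof.
have [_ _ /(_ y)[U [F [[oU Uy pU] [oF tF sF]]]]] := covp.
exists U => // x Upx.
have [A FA Ax] : (\bigcup_(A in F) A) x by rewrite -pU.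
have [s [cs sA ps sp]] := sF A FA; exists A, s; split => //.
- exact: oF.
- by move: cs; rewrite continuous_open_subspace.
- by move=> z Uz; rewrite ps//; split => //; rewrite -sA; exists z.
- move=> x' Ax'; split; last exact: sp.
  by rewrite -[U _]/((p @^-1` U) x') pU; exists A.
Qed.

Lemma covering_continuous : continuous p. Proof. by case: covp. Qed.

Lemma covering_hausdorff : hausdorff_space N -> hausdorff_space M.
Proof.
move=> hN x x' cl.
have pxx' : p x = p x'.
  apply: hN => A B nA nB.
  have [z [Az Bz]] := cl _ _ (covering_continuous nA) (covering_continuous nB).
  by exists (p z).
have [U [oU Ux] sh] := covering_sheet (p x).
have [A [s [oA Ax _ _ sp]]] := sh x Ux.
have Ux' : U (p x') by rewrite -pxx'.
have [A' [s' [oA' Ax' _ _ sp']]] := sh x' Ux'.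
apply: contrapT => xx'.
have [_ _ /(_ (p x))[V [F [[oV Vy pV] [oF tF sF]]]]] := covp.
have [B FB Bx] : (\bigcup_(A in F) A) x by rewrite -pV.
have [B' FB' Bx'] : (\bigcup_(A in F) A) x' by rewrite -pV /= -pxx'.
have [z [Bz B'z]] := cl _ _ (open_nbhs_nbhs (conj (oF _ FB) Bx)) (open_nbhs_nbhs (conj (oF _
  FB') Bx')).
have BB' : B = B' by apply: (tF B B') => //; exists z.
have [t [_ _ _ tp]] := sF B FB.
by apply: xx'; rewrite -(tp x Bx) pxx' tp// BB'.
Qed.

Lemma covering_locally_euclidean : locally_euclidean R d N -> locally_euclidean R d M.
Proof.
move=> lN x; have [U0 [f [h [[oU0 U0x oO] [cf ch hf]]]]] := lN (p x).
have [U [oU Ux] sh] := covering_sheet (p x).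
have [A [s [oA Ax cs ps sp]]] := sh x Ux.
move: cf ch; rewrite !continuous_open_subspace// => cf ch.
set V := A `&` p @^-1` U0.
have oV : open V.
  by apply: openI => //; apply: open_comp => // z _; exact: covering_continuous.
have imV : (f \o p) @` V = (f @` U0) `&` h @^-1` U.
  apply/seteqP; split => [_ [z [Az Uz] <-]|w [[y U0y <-]]] /=.
    by rewrite hf//; split; [exists (p z)|exact: (sp z Az).1].
  rewrite hf// => Uy; have [As pse] := ps y Uy.
  by exists (s y); rewrite /= ?pse//; split => //; rewrite /= pse.
have oI : open ((f \o p) @` V).
  rewrite imV; move: ch => /(continuous_inP _ oO) ch.
  exact: ch.
exists V, (f \o p), (s \o h); split; first by split.
split.
- rewrite continuous_open_subspace// => z /set_mem[Az U0z].
  apply: continuous_comp; first exact: covering_continuous.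
  by apply: cf; exact: mem_set.
- rewrite continuous_open_subspace// => w /set_mem; rewrite imV => -[Ow Uhw].
  apply: continuous_comp; first by apply: ch; exact: mem_set.
  by apply: cs; exact: mem_set.
- by move=> z [Az U0z] /=; rewrite hf// (sp z Az).2.
Qed.

Lemma continuous_paste (X : topologicalType) (c : R) (f g : R -> X) :
  continuous f -> continuous g -> f c = g c ->
  continuous (fun t => if t <= c then f t else g t).
Proof.
move=> cf cg fg; apply/continuous_subspace_setT.
rewrite (_ : setT = [set t : R | t <= c] `|` [set t : R | c <= t]); last first.
  by apply/seteqP; split => // t _; have [|/ltW] := leP t c; [left|right].
apply: withinU_continuous; [exact: closed_le|exact: closed_ge| |].
  apply: (subspace_eq_continuous (f := f)); last exact: continuous_subspaceT.
  by move=> t /set_mem /= tc; rewrite /from_subspace tc.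
apply: (subspace_eq_continuous (f := g)); last exact: continuous_subspaceT.
move=> t /set_mem /= ct; rewrite /from_subspace; case: ifP => // tc.
by have -> : t = c by apply: le_anti; rewrite tc ct.
Qed.

(** Over an evenly covered set, both agreement and disagreement of the lifts are open conditions on
    [t], and the line is connected. *)
Lemma lift_unique (a b : R -> M) t0 : continuous a -> continuous b ->
  (forall t, p (a t) = p (b t)) -> a t0 = b t0 -> forall t, a t = b t.
Proof.
move=> ca cb pab ab0.
have loc t : exists2 V : set R, nbhs t V &
    (a t = b t -> forall t', V t' -> a t' = b t') /\
    (a t <> b t -> forall t', V t' -> a t' <> b t').
  have [U [F [[oU Uy pU] [oF tF sF]]]] := (let: And3 _ _ h := covp in h) (p (a t)).
  have [A FA Ax] : (\bigcup_(A in F) A) (a t) by rewrite -pU.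
  have [B FB Bx] : (\bigcup_(A in F) A) (b t) by rewrite -pU /= -pab.
  exists (a @^-1` A `&` b @^-1` B).
    apply: filterI.
      by apply: ca; apply: open_nbhs_nbhs; split => //; exact: oF.
    by apply: cb; apply: open_nbhs_nbhs; split => //; exact: oF.
  have [s [_ _ _ sp]] := sF A FA; split.
    move=> abt t' [At' Bt']; have AB : A = B.
      by apply: tF => //; exists (a t); split => //; rewrite abt.
    by rewrite -(sp _ At') pab sp// AB.
  move=> abt t' [At' Bt'] abt'; apply: abt; have AB : A = B.
    by apply: tF => //; exists (a t'); split => //; rewrite abt'.
  by rewrite -(sp _ Ax) pab sp// AB.
pose E := [set t | a t = b t].
have oE : open E.
  rewrite openE => t Et; have [V nV [h _]] := loc t.
  by rewrite /interior; apply: (near_imp nV) => t'; exact: h.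
have oE' : open (~` E).
  rewrite openE => t Et; have [V nV [_ h]] := loc t.
  by rewrite /interior; apply: (near_imp nV) => t'; exact: h.
have conn : connected [set: R] by apply/connected_intervalP => ? ?.
have ET : E = setT.
  apply: conn; first by exists t0.
    by exists E => //; rewrite setTI.
  by exists E; [rewrite -[E]setCK; exact: open_closedC|rewrite setTI].
by move=> t; have : setT t by []; rewrite -ET.
Qed.

Lemma path_lift (a : R -> N) x : continuous a -> p x = a 0 ->
  exists2 b : R -> M, continuous b & b 0 = x /\ forall t, 0 <= t <= 1 -> p (b t) = a t.
Proof.
move=> ca pa.
pose P (r t : R) := exists2 U : set N, forall t', `|t - t'| < r -> U (a t') &
  open U /\ forall x, U (p x) -> exists (A : set M) (s : N -> M),
    [/\ open A, A x, {in U, continuous s}, forall z, U z -> A (s z) /\ p (s z) = z &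
        forall x', A x' -> U (p x') /\ s (p x') = x'].
have [r r0 rP] : exists2 r : R, 0 < r & forall t, `[0, 1]%classic t -> P r t.
  have : \forall r \near (0 : R)^'+, forall t, `[0, 1]%classic t -> P r t.
    apply: compact_near; first exact: segment_compact.
    move=> t0 _; have [U [oU Uat] sh] := covering_sheet (a t0).
    have nU : nbhs t0 (a @^-1` U) by apply: ca; exact: open_nbhs_nbhs.
    have [e /= e0 eP] := (nbhs_ballP _ _).1 nU.
    have e20 : 0 < e / 2 by rewrite divr_gt0.
    near=> t r.
    have ra : r < e / 2 by near: r; exact: nbhs_right_lt.
    have ta : `|t0 - t| < e / 2 by near: t; exact: (@near_dist R R^o).
    exists U => // t' tt'; apply: eP.
    rewrite /ball /= -(subrK t t0) -addrA (le_lt_trans (ler_normD _ _))//.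
    by rewrite [ltRHS]splitr ltrD// (lt_trans tt').
  move=> hr; near (0 : R)^'+ => r; exists r; near: r => //; exact: nbhs_right_gt.
pose m := (Num.trunc r^-1).+1.
have m0 : (0 : R) < m%:R by rewrite ltr0n.
have mr : m%:R^-1 < r.
  rewrite -[ltRHS]invrK ltf_pV2 ?posrE ?invr_gt0//.
  by have /trunc_itv/andP[] : 0 <= r^-1 by rewrite invr_ge0 ltW.
have step (i : nat) : (i <= m)%N -> exists2 b : R -> M, continuous b &
    b 0 = x /\ forall t, 0 <= t <= i%:R / m%:R -> p (b t) = a t.
  elim: i => [_|i IH im].
    exists (fun=> x); first exact: continuous_cstf.
    by split=> // t; rewrite mul0r => tt; have -> : t = 0 by apply: le_anti; rewrite andbC.
  have [b cb [b0 pb]] := IH (ltnW im).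
  pose c : R := i%:R / m%:R.
  have c01 : 0 <= c by rewrite divr_ge0.
  have [|U aU [oU sh]] := rP c.
    by rewrite /= in_itv /= c01 ler_pdivrMr// mul1r ler_nat ltnW.
  have Ub : U (p (b c)) by rewrite pb ?lexx ?andbT//; apply: aU; rewrite subrr normr0.
  have [A [s [oA Ab cs ps sp]]] := sh _ Ub.
  (* The path is frozen outside the next subinterval, so that the local section is only applied
     inside [U] and the pieces are continuous on the whole line. *)
  pose cut (t : R) := c + m%:R^-1 * clamp01 ((t - c) * m%:R).
  have ccut : continuous cut.
    apply: (@continuousDf R _ R^o); first exact: continuous_cstf.
    apply: continuousMf; first exact: continuous_cstf.
    apply: continuous_compf (@clamp01_continuous R).
    apply: continuousMf; last exact: continuous_cstf.
    by apply: (@continuousBf R _ R^o); [exact: continuous_idf|exact: continuous_cstf].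
  have Ucut t : U (a (cut t)).
    apply: aU; apply: le_lt_trans mr; have /andP[h1 h2] := clamp01_itv ((t - c) * m%:R).
    rewrite /cut opprD addrA subrr sub0r normrN normrM gtr0_norm ?invr_gt0//.
    by rewrite ger0_norm// ler_piMr// invr_ge0 ltW.
  have cs' : continuous (fun t => s (a (cut t))).
    move=> t; apply: (@continuous_comp _ _ _ (fun t => a (cut t)) s).
      exact: continuous_compf ccut ca _.
    by apply: cs; exact: mem_set.
  have cutc : cut c = c by rewrite /cut subrr mul0r clamp01_id ?mulr0 ?addr0// lexx ler01.
  exists (fun t => if t <= c then b t else s (a (cut t))).
    apply: continuous_paste => //; rewrite cutc -pb ?lexx ?andbT//.
    by have [_ ->] := sp _ Ab.
  split=> [|t /andP[t0 ti]]; first by rewrite c01.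
  case: (leP t c) => tc; first by rewrite pb// t0.
  have -> : cut t = t.
    rewrite /cut clamp01_id; first by rewrite mulrC mulfK ?gt_eqF// addrC subrK.
    rewrite mulr_ge0 ?subr_ge0 ?(ltW tc) ?(ltW m0)//= -ler_pdivlMr// mul1r lerBlDr.
    by rewrite (le_trans ti)// /c -natr1 mulrDl mul1r addrC.
  have := Ucut t; rewrite /cut clamp01_id; first by rewrite mulrC mulfK ?gt_eqF//
    addrC subrK => /ps[].
  rewrite mulr_ge0 ?subr_ge0 ?(ltW tc) ?(ltW m0)//= -ler_pdivlMr// mul1r lerBlDr.
  by rewrite (le_trans ti)// /c -natr1 mulrDl mul1r addrC.
have [b cb [b0 pb]] := step m (leqnn m).
by exists b => //; split => // t t01; apply: pb; rewrite divff ?gt_eqF.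
Unshelve. all: by end_near. Qed.

End Covering.

Lemma compact_neighbourhood (R : realType) d (M : topologicalType) :
  locally_euclidean R d M -> forall x : M, exists2 K : set M, compact K & nbhs x K.
Proof.
move=> lM x; have [U [f [h [[oU Ux oO] [cf ch hf]]]]] := lM x.
move: (cf) (ch); rewrite !continuous_open_subspace// => cf' ch'.
have [e e0 eP] : exists2 e : R, 0 < e & [set w | `|w - f x| <= e] `<=` f @` U.
  have /nbhs_ballP[e /= e0 eP] : nbhs (f x) (f @` U).
    by apply: open_nbhs_nbhs; split => //; exists x.
  have e20 : 0 < e / 2 by rewrite divr_gt0.
  exists (e / 2) => // w /= wx; apply: eP; rewrite -ball_normE /= distrC.
  by rewrite (le_lt_trans wx)// ltr_pdivrMr// ltr_pMr// ltr1n.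
exists (h @` [set w | `|w - f x| <= e]).
  apply: continuous_compact; last exact: compact_rV_ball.
  by apply: continuous_subspaceW ch.
have nU : nbhs x U by exact: open_nbhs_nbhs.
have nb : nbhs x (fun y => `|f x - f y| < e).
  by apply: (near_imp (cf' x (mem_set Ux) _ (nbhsx_ballx (f x) e e0))) => y; rewrite -ball_normE.
apply: (near_and_imp nU nb) => y Uy fy; exists (f y); last exact: hf.
by rewrite /= distrC ltW.
Qed.

Section Deck.
Variables (R : realType) (d : nat) (N M : topologicalType) (p : M -> N) (x0 : M).
Variables (Gamma : groupType) (cls : (R -> N) -> Gamma) (act : Gamma -> M -> M).
Hypothesis ucp : universal_cover R p.
Hypothesis fgc : fundamental_group (p x0) cls.
Hypothesis dact : deck_action p x0 cls act.

Let covp : covering_map p := let: conj h _ := ucp in h.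

Lemma cover_path (x y : M) : exists a : R -> M, is_path x y a.
Proof. by have [_ [h _]] := ucp; exact: h. Qed.

Lemma cover_global_path (x y : M) : exists a : R -> M,
  [/\ continuous a, a 0 = x & a 1 = y].
Proof.
have [a [ca a0 a1]] := cover_path x y.
exists (fun t => a (clamp01 t)); split; first exact: continuous_clamp.
- by rewrite clamp01_id ?lexx ?ler01.
- by rewrite clamp01_id ?lexx ?ler01.
Qed.

Lemma act1 x : act 1%g x = x. Proof. by have [[h _] _ _ _] := dact. Qed.
Lemma actM g h x : act (g * h)%g x = act g (act h x).
Proof. by have [[_ e] _ _ _] := dact. Qed.
Lemma act_continuous g : continuous (act g). Proof. by have [_ h _ _] := dact. Qed.
Lemma act_fibre g x : p (act g x) = p x. Proof. by have [_ _ h _] := dact. Qed.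

(** [deck_action] describes only the orbit of [x0]. A path from [x] to [x0] is projected and lifted
    again from [x']; the end of the lift is a translate of [x0], and uniqueness of lifts carries the
    translation back to the other end. *)
Lemma deck_transitive x x' : p x = p x' -> exists g, act g x = x'.
Proof.
move=> pxx'; have [b [cb b0 b1]] := cover_global_path x x0.
have cp := covering_continuous covp.
have [||c cc [c0 pc]] := @path_lift R N M p covp (fun t => p (b (clamp01 t))) x'.
- apply: continuous_compf (cp); apply: continuous_compf (cb); exact: clamp01_continuous.
- by rewrite clamp01_id ?lexx ?ler01// b0 pxx'.
have [e [ce e0 e1]] := cover_global_path x0 (c 1).
have i11 : 0 <= (1 : R) <= 1 by rewrite lexx ler01.
have px1 : p (c 1) = p x0 by rewrite pc// clamp01_id// b1.
have gx0 : act (cls (p \o e)) x0 = c 1.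
  have [_ _ _] := dact; apply => //; split => //.
  exact: continuous_subspaceT.
exists (cls (p \o e)).
have -> : x = b (clamp01 0) by rewrite clamp01_id ?lexx ?ler01.
have -> : x' = c (clamp01 0) by rewrite clamp01_id ?lexx ?ler01.
apply: (@lift_unique R N M p covp (fun t => act (cls (p \o e)) (b (clamp01 t)))
  (fun t => c (clamp01 t)) 1).
- apply: continuous_compf (@act_continuous _); apply: continuous_compf (cb).
  exact: clamp01_continuous.
- apply: continuous_compf (cc); exact: clamp01_continuous.
- move=> t; rewrite act_fibre pc; last exact: clamp01_itv.
  by rewrite (clamp01_id (clamp01_itv t)).
- by rewrite !clamp01_id// b1.
Qed.

(** By uniqueness of lifts [g] also fixes [x0]. Then a loop of class [g] lifts to a loop, which is
    contractible in the cover, so [g] is the class of the constant loop; this class is its own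
    square, hence trivial. *)
Lemma deck_free g x : act g x = x -> g = 1%g.
Proof.
move=> gx; have cp := covering_continuous covp.
have gx0 : act g x0 = x0.
  have [b [cb b0 b1]] := cover_global_path x x0; rewrite -b1.
  apply: (@lift_unique R N M p covp (fun t => act g (b t)) b 0) => //.
  - exact: continuous_compf (@act_continuous _).
  - by move=> t; rewrite act_fibre.
  - by rewrite b0.
have [surj clsE clsM] := fgc.
have [a [ca a0 a1] clsa] := surj g.
have ca' := continuous_clamp ca.
have [|c cc [c0 pc]] := @path_lift R N M p covp (fun t => a (clamp01 t)) x0 ca'.
  by rewrite clamp01_id ?lexx ?ler01.
have pcE t : 0 <= t <= 1 -> p (c t) = a t by move=> t01; rewrite pc// clamp01_id.
have i11 : 0 <= (1 : R) <= 1 by rewrite lexx ler01.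
have px1 : p (c 1) = p x0 by rewrite pcE.
have pa : is_path (p x0) (p x0) a by [].
have ppc : is_path (p x0) (p x0) (p \o c).
  split; [|by rewrite /= c0|by rewrite /= px1].
  by apply: continuous_subspaceT; exact: continuous_compf cc cp.
have gE : cls (p \o c) = g.
  rewrite -clsa; apply/(clsE _ _ ppc pa).
  exists (fun st => a (clamp01 st.1)); split.
  - by apply: continuous_subspaceT; exact: continuous_compf (@continuous_fstf _ _) ca'.
  - by move=> s; rewrite in_itv /= => s01; rewrite clamp01_id// -pcE.
  - by move=> t _; rewrite /= !clamp01_id ?lexx ?ler01.
have cx0 : c 1 = x0.
  rewrite -[RHS]gx0 -gE; have [_ _ _ h] := dact; apply/esym/h => //.
  by split => //; exact: continuous_subspaceT.
have pcst : is_path (p x0) (p x0) (cst (p x0) : R -> N).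
  by split => //; apply: continuous_subspaceT; exact: continuous_cstf.
have -> : g = cls (cst (p x0)).
  rewrite -gE; apply/(clsE _ _ ppc pcst).
  have [_ [_ sc]] := ucp.
  have [|H [cH H0 H1]] := sc x0 c.
    by split => //; exact: continuous_subspaceT.
  exists (p \o H); split.
  - by move=> z; apply: (continuous_comp (cH z)); exact: cp.
  - by move=> s /H0[/= -> ->].
  - by move=> t /H1[/= -> ->].
have := clsM _ _ pcst pcst.
have -> : concat_path (cst (p x0)) (cst (p x0)) = cst (p x0) :> (R -> N).
  by apply/funext => t; rewrite /concat_path; case: ifP.
by move=> /esym/eqP; rewrite -[X in _ == X]mulg1 => /eqP/mulgI.
Qed.

Lemma deck_cocompact : compact [set: N] -> locally_euclidean R d N ->
  exists2 K : set M, compact K & forall x, exists g, K (act g x).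
Proof.
move=> cN lN; have lM := covering_locally_euclidean covp lN.
(* The filter of large sets: a property of sets holds eventually if it holds for all sets containing
   some compact one. [compact_near] thus collects finitely many local compact lifts. *)
pose F : set_system (set M) := fun A =>
  exists2 K0, compact K0 & forall K, K0 `<=` K -> A K.
have FF : Filter F.
  split.
  - by exists set0; [exact: compact0|].
  - move=> A B [K cK KA] [L cL LB]; exists (K `|` L); first exact: compactU.
    by move=> K' KLK'; split; [apply: KA|apply: LB] => z Kz; apply: KLK'; [left|right].
  - by move=> A B AB [K cK KA]; exists K => // K' /KA /AB.
have [|K cK /(_ K) KP] := @compact_near N [set: N] _ F
    (fun K y => exists2 x, p x = y & K x) cN FF.
  move=> y _; have [_ rp _] := covp.
  have [x _ xy] : range p y by rewrite rp.
  have [K cK nK] := compact_neighbourhood lM x.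
  have [U [oU Uy] sh] := covering_sheet covp y.
  have [|A [s [oA Ax cs ps sp]]] := sh x; first by rewrite xy.
  have sy : s y = x by rewrite -xy; have [] := sp x Ax.
  exists (s @^-1` K `&` U, [set K' | K `<=` K']); last first.
    by move=> [y' K'] [[/= sK Uy'] KK']; exists (s y'); [exact: (ps _ Uy').2|exact: KK'].
  split; last by exists K.
  apply: filterI; last exact: open_nbhs_nbhs.
  by apply: cs; [exact: mem_set|rewrite sy].
exists K => // x; have [//|x' px' Kx'] := KP _ (p x) I.
by have [g gx] := deck_transitive (esym px'); exists g; rewrite gx.
Qed.

(** Near a pair of points of the same fibre a single deck transformation can relate the two sides,
    by freeness and the sheets; near a pair of points of different fibres none can, because [N] is
    Hausdorff. Compactness of the product leaves a finite list. *)
Lemma deck_proper (K K' : set M) : hausdorff_space N -> compact K -> compact K' ->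
  exists S : seq Gamma, forall g x, K x -> K' (act g x) -> g \in S.
Proof.
move=> hN cK cK'.
pose F : set_system (seq Gamma) := fun A =>
  exists S0 : seq Gamma, forall S, {subset S0 <= S} -> A S.
have FF : Filter F.
  split.
  - by exists [::].
  - move=> A B [S SA] [T TB]; exists (S ++ T) => S' h.
    by split; [apply: SA|apply: TB] => z zS; apply: h; rewrite mem_cat zS ?orbT.
  - by move=> A B AB [S SA]; exists S => S' /SA /AB.
have [|S /(_ S (fun _ h => h)) SP] := @compact_near (M * M)%type (K `*` K') _ F
    (fun S xx' => forall g, act g xx'.1 = xx'.2 -> g \in S) (compact_setX cK cK') FF;
  last by exists S => g x Kx K'x; apply: (SP (x, act g x)).
move=> [x x'] [/= Kx K'x'].
have [pxx'|pxx'] := pselect (p x = p x').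
  have [g0 gx] := deck_transitive pxx'.
  have [U [oU Uy] sh] := covering_sheet covp (p x').
  have [A [s [oA Ax cs ps sp]]] := sh x' Uy.
  exists ((act g0 @^-1` A) `*` A, [set S : seq Gamma | g0 \in S]); last first.
    move=> [[z z'] S] [[/= Az Az'] g0S] g gz.
    have zz' : act g z = act g0 z.
      rewrite gz -(sp _ Az).2 -(sp _ Az').2; congr s.
      by rewrite act_fibre -gz act_fibre.
    have : (g0^-1 * g)%g = 1%g.
      by apply: (@deck_free _ z); rewrite actM zz' -actM mulVg act1.
    by rewrite -(mulVg g0) => /mulgI ->.
  split; last by exists [:: g0] => S; apply; rewrite mem_head.
  exists (act g0 @^-1` A, A) => //; split.
    by apply: act_continuous; rewrite gx; exact: open_nbhs_nbhs.
  exact: open_nbhs_nbhs.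
have cp := covering_continuous covp.
have := hN; rewrite open_hausdorff =>
  /(_ _ _ (introN eqP pxx'))[[A B] /= [/set_mem Ax /set_mem Bx'] [oA oB /eqP AB]].
exists ((p @^-1` A) `*` (p @^-1` B), [set: seq Gamma]); last first.
  move=> [[z z'] S] [[/= Az Bz'] _] g gz.
  have : (A `&` B) (p z) by split => //; rewrite -(act_fibre g) gz.
  by rewrite AB.
split; last by exists [::].
exists (p @^-1` A, p @^-1` B) => //; split.
  by apply: cp; exact: open_nbhs_nbhs.
by apply: cp; exact: open_nbhs_nbhs.
Qed.

End Deck.

(** * The embedding *)

Lemma mx_neq0_gt0 (R : realType) n (q : 'M[R]_n) : q != 0 -> (0 < n)%N.
Proof. by case: n q => // q; rewrite [q]flatmx0 eqxx. Qed.

Lemma zero_dimensional_point (R : realType) (M : topologicalType) :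
  locally_euclidean R 0 M -> (forall x y : M, exists a : R -> M, is_path x y a) ->
  forall x y : M, x = y.
Proof.
move=> lM pM x y; have [a [ca a0 a1]] := pM x y.
have o1 (z : M) : open [set z].
  have [U [f [h [[oU Uz _] [_ _ hf]]]]] := lM z.
  suff -> : [set z] = U by [].
  apply/seteqP; split => [_ -> //|z' Uz'] /=.
  by rewrite -(hf z' Uz') -(hf z Uz) (thinmx0 (f z')) (thinmx0 (f z)).
have oA (A : set M) : open A.
  have -> : A = \bigcup_(z in A) [set z] by rewrite bigcup_imset1 image_id.
  by apply: bigcup_open => z _; exact: o1.
have cb := continuous_clamp ca.
pose E := (fun t => a (clamp01 t)) @^-1` [set x].
have ET : E = setT.
  have conn : connected [set: R] by apply/connected_intervalP => ? ?.
  apply: conn; first by exists 0; rewrite /E /= clamp01_id// lexx ler01.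
    by exists E; [apply: open_comp => // t _; exact: cb|rewrite setTI].
  exists E; last by rewrite setTI.
  rewrite -[E]setCK; apply: open_closedC.
  by apply: (@open_comp _ _ (fun t => a (clamp01 t)) (~` [set x])) => // t _; exact: cb.
have : E 1 by rewrite ET.
by rewrite /E /= clamp01_id ?ler01 ?lexx// a1.
Qed.

Section Geometry.
Variables (R : realType) (n d : nat) (M : topologicalType).
Variables (u : M -> grassmannian R n d) (F : M * 'M[R]_n * R -> M * 'M[R]_n).
Hypotheses (cu : continuous u) (Fs : flow_spec u F) (mu : forall x, mixed (u x)).
Hypotheses (hM : hausdorff_space M) (lM : locally_euclidean R d M).
Hypothesis pM : forall x y : M, exists a : R -> M, is_path x y a.
Variable C : R.
Hypothesis C0 : 0 < C.
Hypothesis CP : forall x q, in_bundle u x q ->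
  exists2 c : R, 0 < c & expands C q (c *: (F (x, q, 1)).2).

Lemma flow_transitive x y : x != y ->
  exists q t, [/\ in_bundle u x q, 0 < t & (F (x, q, t)).1 = y].
Proof.
move=> xy; have [n0|] := posnP n; last first.
  by have [a pa] := pM x y; move=> n0; exact: (flow_surjective cu Fs mu n0 hM lM C0 CP pa).
(* For [n = 0] there is no nonzero tensor to argue with, but pencils have dimension 0 and [M] is a
   point. *)
have d0 : d = 0%N.
  have /andP[_ /eqP <-] := valP (u x).
  apply/eqP; rewrite -leqn0 (leq_trans (dimvS (subvf _)))// dimvf.
  by rewrite /dim /= n0.
have e := @zero_dimensional_point R M _ pM x y; move: xy; rewrite e ?eqxx//.
by rewrite -d0.
Qed.

Lemma annihilator_disjoint x y s : annihilator (u x) s -> annihilator (u y) s ->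
  semipositive_tensors s -> s != 0 -> x = y.
Proof.
move=> us us' sP s0; apply/eqP; apply: contraT => /flow_transitive[q [t [xq t0 Fy]]].
by have := flow_disjoint Fs xq t0 us sP s0; rewrite Fy.
Qed.

Lemma globally_fitting_u : globally_fitting u.
Proof.
split=> //; apply/trivIsetP => x y _ _ xy; apply/eqP/negPn/negP => /set0P[L [/=]].
move=> [s [[us sP] /eqP s0] <-] [s' [[us' s'P] /eqP s'0] ss'].
have /vlineP[k sk] : s \in <[s']>%VS by rewrite ss' memv_line.
move: xy; rewrite (@annihilator_disjoint x y s) ?eqxx//.
have [st _] := us; move: us' => /annihilatorP[_ us'].
by apply/annihilatorP; split => //; rewrite sk projZ us' scaler0.
Qed.

Lemma injective_u : injective u.
Proof.
move=> x y xy; apply/eqP; apply: contraT => xy'.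
have [q [t [[_ q0] _ _]]] := flow_transitive xy'.
have [s [us sP]] := mu x.
suff e : x = y by rewrite e eqxx in xy'.
apply: (@annihilator_disjoint x y s) => //.
- by rewrite -xy.
- exact: positive_semipositive.
- exact: positive_tensors_neq0 (mx_neq0_gt0 q0) sP.
Qed.

Definition flow_image (K : set M) (T : R) : set M :=
  [set y | exists x q t, [/\ K x, in_bundle u x q, 0 <= t <= T & (F (x, q, t)).1 = y]].

Lemma flow_image_compact (K : set M) (T : R) : compact K -> compact (flow_image K T).
Proof.
move=> cK; pose B := [set p : M * 'M[R]_n |
  [/\ K p.1, p.2 \in pencil_space (u p.1) & `|p.2| = 1]].
have cB : compact (B `*` `[0, T]).
  by apply: compact_setX; [exact: unit_bundle_compact|exact: segment_compact].
have -> : flow_image K T = (fun a : M * 'M[R]_n * R => (F a).1) @` (B `*` `[0, T]).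
  apply/funext => y; apply/propext; split.
    move=> [x [q [t [Kx xq tT <-]]]]; have [qu q0] := xq.
    exists (x, normalize q, t) => /=.
      split; last by rewrite /= in_itv.
      by split => //; [exact: memvZ|exact: norm_normalize].
    by rewrite (flow_specZ Fs)// invr_gt0 normr_gt0.
  move=> [[[x q] t] [[/= Kx xq q1]]]; rewrite in_itv /= => tT <-.
  by exists x, q, t; split => //; split => //; rewrite -normr_gt0 q1.
apply: continuous_compact cB; apply: continuous_in_subspaceT => -[[x q] t].
move=> /set_mem[[/= Kx xq q1] _].
apply: (@continuous_comp _ _ _ F fst); last exact: cvg_fst.
by apply: (flow_spec_cont Fs); rewrite proj_id// -normr_gt0 q1.
Qed.

(** If the pencil at [y] is close to that at [x], the projection of [h] onto it is small, and
    removing this projection from [h] gives a tensor annihilated by [u y] and comparable with [h] up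
    to the factor 2. *)
Lemma near_time_bound x : exists e T : R, 0 < e /\ forall q t, in_bundle u x q ->
  0 < t -> `|pencil_proj (u (F (x, q, t)).1) - pencil_proj (u x)| < e -> t <= T.
Proof.
have [h [uh hP]] := mu x; have [hT ph] := (annihilatorP (u x) h).1 uh.
have [e e0 eP] := positive_tensors_open hP.
have [k kP] := @exists_power_gt R C^-1 (C ^+ 2 * 2 ^+ 2) (ltac:(by rewrite invr_gt0)).
(* [c] bounds the norm of the projection of [h] in terms of the distance of the pencils; [e / 2]
   leaves room for the perturbation [2 *: s] below. *)
pose c : R := 1 + (n * n)%:R * `|h|.
have c0 : 0 < c by rewrite ltr_pwDl// mulr_ge0.
exists (e / 2 / c), k.+2%:R; split; first by rewrite !divr_gt0.
move=> q t xq t0; set y := (F (x, q, t)).1 => ye.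
rewrite leNgt; apply/negP => kt.
pose s := proj (u y) h.
have sT : s^T = s by exact: pencil_sym (proj_mem _ _).
have se : `|s| < e / 2.
  rewrite /s -[proj (u y) h]subr0 -ph (le_lt_trans (proj_delta_bound _ _ _))// mulrA.
  have := ye; rewrite ltr_pdivlMr//; apply: le_lt_trans; rewrite mulrC ler_wpM2l//.
  by rewrite /c lerDr.
have hs : h - s = h + (- s) by [].
have e2e : e / 2 < e by rewrite ltr_pdivrMr// ltr_pMr// ltr1n.
have h_s : positive_tensors (h - s).
  by apply: eP; rewrite ?raddfN /= ?sT// normrN (lt_trans se).
have n0 : (0 < n)%N by case: xq => _ /mx_neq0_gt0.
have := flow_time_bound Fs C0 CP xq uh (annihilator_sub_proj u y hT)
  (positive_semipositive hP) (positive_tensors_neq0 n0 hP)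
  (positive_semipositive h_s) (positive_tensors_neq0 n0 h_s)
  (D := 2) (k := k).
move=> bound; suff : (1 + C^-1) ^+ k.+1 <= C ^+ 2 * 2 ^+ 2 by rewrite leNgt kP.
apply: bound; last exact: ltW.
  apply: positive_semipositive.
  have -> : 2 *: h - (h - proj (u y) h) = h + s.
    by rewrite scaler_nat mulr2n opprB addrA addrAC addrK.
  by apply: eP; rewrite ?sT// (lt_trans se).
apply: positive_semipositive.
have -> : 2 *: (h - proj (u y) h) - h = h + (- (2 *: s)).
  by rewrite scalerBr [2 *: h]scaler_nat mulr2n -!addrA; congr (_ + _);
    rewrite addrCA subrr addr0.
apply: eP; first by rewrite raddfN /= linearZ /= sT.
by rewrite normrN normrZ ger0_norm// mulrC -ltr_pdivlMr.
Qed.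

(** By [near_time_bound] the points whose pencils are close to that of [x] lie in the compact set of
    points reached from [x] in a bounded time. On the part of it outside [U] the distance of pencils
    has a positive minimum, because [u] is injective. *)
Lemma embedding_near (U : set M) x : open U -> U x ->
  exists2 W : set (grassmannian R n d), open W & W (u x) /\ forall y, W (u y) -> U y.
Proof.
move=> oU Ux; have [e [T [e0 eT]]] := near_time_bound x.
pose f y := `|pencil_proj (u y) - pencil_proj (u x)|.
have cpp : continuous (fun y => pencil_proj (u y)).
  exact: continuous_compf cu (@pencil_proj_continuous R n d).
have cf : continuous f.
  apply: continuous_normf; apply: continuousBf cpp _; exact: continuous_cstf.
pose K := flow_image [set x] T `&` ~` U.
have cK0 := flow_image_compact (T := T) (@compact_set1 M x).
have cK : compact K by apply: compact_closedI => //; exact: open_closedC.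
have [e' e'0 e'P] : exists2 e' : R, 0 < e' & forall y, K y -> e' <= f y.
  have [K0|/set0P K0] := eqVneq K set0; first by exists 1 => // y; rewrite K0.
  have [|y0 /set_mem[Ky0 Uy0] y0P] := @compact_EVT_min M R f K K0 cK.
    exact: continuous_subspaceT.
  exists (f y0); last by move=> y Ky; apply: y0P; exact: mem_set.
  rewrite normr_gt0 subr_eq0; apply/eqP => /pencil_proj_inj ux.
  apply: Uy0; have -> // : y0 = x; apply: injective_u; exact: val_inj.
exists [set P | `|pencil_proj P - pencil_proj (u x)| < Num.min e e'].
  have cP : continuous (fun P : grassmannian R n d => `|pencil_proj P - pencil_proj (u x)|).
    apply: continuous_normf; apply: continuousBf; last exact: continuous_cstf.
    exact: pencil_proj_continuous.
  apply: (@open_comp _ _ (fun P : grassmannian R n d =>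
    `|pencil_proj P - pencil_proj (u x)|) [set r | r < Num.min e e']); last exact: open_lt.
  by move=> P _; exact: cP.
split; first by rewrite /= subrr normr0 lt_min e0.
move=> y /=; rewrite lt_min => /andP[ye ye'].
have [->//|] := eqVneq y x; rewrite eq_sym => /flow_transitive[q [t [xq t0 Fy]]].
apply: contrapT => Uy; have : K y.
  split => //; exists x, q, t; split => //; rewrite ltW//=.
  by apply: (eT q t xq t0); rewrite Fy.
by move=> /e'P; rewrite leNgt ye'.
Qed.

Lemma embedding_u : embedding u.
Proof.
split => //; first exact: injective_u.
move=> U oU; exists (\bigcup_(W in [set W | open W /\ forall y, W (u y) -> U y]) W).
  by apply: bigcup_open => W [].
apply/funext => P; apply/propext; split.
  move=> [x Ux <-]; have [W oW [Wx WU]] := embedding_near oU Ux.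
  by split; [exists W|exists x].
by move=> [[W [oW WU] Wx] [x _ xE]]; exists x => //; apply: WU; rewrite xE.
Qed.

End Geometry.

(** * Word length and flow time *)

Section Words.
Variables (R : realType) (n d : nat) (M : topologicalType).
Variables (u : M -> grassmannian R n d) (F : M * 'M[R]_n * R -> M * 'M[R]_n).
Hypothesis Fs : flow_spec u F.
Variables (Gamma : groupType) (act : Gamma -> M -> M) (rho : Gamma -> 'M[R]_n).
Hypothesis act1 : forall x, act 1%g x = x.
Hypothesis actM : forall g h x, act (g * h)%g x = act g (act h x).
Hypothesis eF : forall g x q t, in_bundle u x q ->
  F (act g x, form_action (rho g) q, t) =
  (act g (F (x, q, t)).1, normalize (form_action (rho g) (F (x, q, t)).2)).
Hypothesis in_act : forall g x q, in_bundle u x q ->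
  in_bundle u (act g x) (form_action (rho g) q).
Variables (K : set M) (S : seq Gamma).
Hypothesis KP : forall x, exists g, K (act g x).
Hypothesis SP : forall g x, K x -> flow_image u F K 1 (act g x) -> g \in S.

(* Every unit of time spent along the flow costs one letter: after time 1 the
   flow line issued from [K] is in a translate [g K] with [g] in [S]. *)
Lemma flow_word m x q t g : K x -> in_bundle u x q -> 0 <= t <= m%:R ->
  (exists2 y, K y & (F (x, q, t)).1 = act g y) ->
  exists2 w, words S g w & (size w <= m.+1)%N.
Proof.
have short x' q' t' g' : K x' -> in_bundle u x' q' -> 0 <= t' <= 1 ->
    (exists2 y, K y & (F (x', q', t')).1 = act g' y) -> g' \in S.
  move=> Kx xq t1 [y Ky Fy]; apply: (SP Ky); rewrite -Fy.
  by exists x', q', t'.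
have letter g' : g' \in S -> words S g' [:: g'].
  by move=> gS; split; [rewrite /= gS|rewrite big_seq1].
elim: m x q t g => [|m IH] x q t g Kx xq /andP[t0 tm] gy.
  exists [:: g] => //; apply: letter; apply: (short x q t) => //.
  by rewrite t0 (le_trans tm).
have [t1|t1] := leP t 1.
  by exists [:: g] => //; apply: letter; apply: (short x q t) => //; rewrite t0.
have xq1 := flow_spec_in Fs 1 xq.
have [h Kh] := KP (F (x, q, 1)).1.
pose y1 := act h (F (x, q, 1)).1.
have y1E : (F (x, q, 1)).1 = act h^-1%g y1 by rewrite /y1 -actM mulVg act1.
have hS : h^-1%g \in S.
  by apply: (short x q 1) => //; [rewrite ler01 lexx|exists y1].
pose q1 := form_action (rho h) (F (x, q, 1)).2.
have y1q1 : in_bundle u y1 q1 by exact: in_act.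
have FE : F (y1, q1, t - 1) = (act h (F (x, q, t)).1,
    normalize (form_action (rho h) (F (x, q, t)).2)).
  rewrite eF//; have e : F ((F (x, q, 1)).1, (F (x, q, 1)).2, t - 1) = F (x, q, t).
    by rewrite -surjective_pairing (flow_specD Fs)// addrC subrK.
  by rewrite e.
have [||w [wS wh] sw] := IH y1 q1 (t - 1) (h * g)%g Kh y1q1.
- by rewrite subr_ge0 (ltW t1) lerBlDr natr1.
- by have [y Ky Fy] := gy; exists y => //; rewrite FE /= Fy actM.
exists (h^-1%g :: w); last by rewrite /= ltnS.
by split; [rewrite /= hS|rewrite big_cons wh mulgA mulVg mul1g].
Qed.

End Words.

Lemma annihilator_act (R : realType) n d (M : topologicalType)
    (u : M -> grassmannian R n d) (Gamma : groupType) (act : Gamma -> M -> M)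
    (rho : Gamma -> 'M[R]_n) g x s : equivariant_map act rho u -> rho g \in unitmx ->
  annihilator (u x) s -> annihilator (u (act g x)) (rho g *m s *m (rho g)^T).
Proof.
move=> eu gu [st us]; split.
  by rewrite /symmetric_tensors /= !trmx_mul trmxK (st : s^T = s) mulmxA.
move=> q qu; have : [set` u (act g x)] q by [].
by rewrite eu => -[q' q'u <-]; rewrite pairing_form_action// us.
Qed.

Section WordBound.
Variables (R : realType) (n d : nat) (M : topologicalType).
Variables (u : M -> grassmannian R n d) (F : M * 'M[R]_n * R -> M * 'M[R]_n).
Hypothesis Fs : flow_spec u F.
Variables (Gamma : groupType) (act : Gamma -> M -> M) (rho : Gamma -> 'M[R]_n).
Hypothesis eu : equivariant_map act rho u.
Hypothesis rho_unit : forall g, rho g \in unitmx.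
Variable C : R.
Hypothesis C0 : 0 < C.
Hypothesis CP : forall x q, in_bundle u x q ->
  exists2 c : R, 0 < c & expands C q (c *: (F (x, q, 1)).2).
Hypothesis flow_trans : forall x y, x != y ->
  exists q t, [/\ in_bundle u x q, 0 < t & (F (x, q, t)).1 = y].
Hypothesis act_free : forall g x, act g x = x -> g = 1%g.
Variables (K : set M) (S : seq Gamma) (x1 : M) (s : 'M[R]_n).
Hypothesis Kx1 : K x1.
Hypothesis flow_words : forall m q t g, in_bundle u x1 q -> 0 <= t <= m%:R ->
  (F (x1, q, t)).1 = act g x1 -> exists2 w, words S g w & (size w <= m.+1)%N.
Hypotheses (us : annihilator (u x1) s) (sP : positive_tensors s).

(** The translate of [s] by [rho g] is annihilated at [act g x1], so [D] bounds the time of the flow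
    from [x1] to this point; the logarithm of [flow_time_bound] is linear in that time. *)
Lemma word_bound : exists A B : R, [/\ 0 <= A, 0 <= B & forall g D, 1 <= D ->
  semipositive_tensors (D *: s - rho g *m s *m (rho g)^T) ->
  semipositive_tensors (D *: (rho g *m s *m (rho g)^T) - s) ->
  exists2 w, words S g w & (size w)%:R <= A * ln D + B].
Proof.
pose lam := ln (1 + C^-1).
have C1 : 1 < 1 + C^-1 by rewrite ltrDl invr_gt0.
have lam0 : 0 < lam by rewrite ln_gt0.
have lam_ge0 := ltW lam0.
have lC0 : 0 <= 2 * `|ln C| / lam by rewrite divr_ge0// mulr_ge0.
(* Three letters suffice for a time below 2. For a time between [k.+2] and [k.+3] at most [k.+4],
   that is [3 + k.+1], are needed, and [k.+1%:R * lam] is at most the logarithm of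
   [C ^+ 2 * D ^+ 2]. *)
exists (2 / lam), (3 + 2 * `|ln C| / lam); split.
- by rewrite divr_ge0.
- by rewrite addr_ge0.
move=> g D D1 h1 h2.
have D0 : 0 < D by rewrite (lt_le_trans _ D1).
have lnD : 0 <= 2 / lam * ln D by rewrite mulr_ge0 ?ln_ge0// divr_ge0.
have [gx|] := eqVneq x1 (act g x1).
  have -> : g = 1%g by apply: (@act_free _ x1).
  exists [::]; first by split; rewrite ?big_nil.
  by rewrite addr_ge0// addr_ge0.
move=> /flow_trans[q [t [xq t0 Fg]]].
have n0 : (0 < n)%N by case: xq => _ /mx_neq0_gt0.
have [t2|t2] := ltP t 2.
  have [|w ww sw] := @flow_words 2 q t g xq _ Fg; first by rewrite !ltW.
  exists w => //; rewrite -[leLHS]add0r lerD// -[leLHS]addr0 lerD ?ler_nat//.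
have /andP[kt tk] := trunc_itv (ltW t0).
have [k kE] : exists k, Num.trunc t = k.+2.
  have : (2 <= Num.trunc t)%N by rewrite truncn_ge_nat// ltW.
  by case: (Num.trunc t) => [|[|k]] // _; exists k.
rewrite kE in kt tk.
have [|w ww sw] := @flow_words k.+3 q t g xq _ Fg; first by rewrite !ltW.
exists w => //.
have gP := positive_tensors_act (rho_unit g) sP.
have usg : annihilator (u (F (x1, q, t)).1) (rho g *m s *m (rho g)^T).
  by rewrite Fg; exact: (annihilator_act eu (rho_unit g) us).
have bound : (1 + C^-1) ^+ k.+1 <= C ^+ 2 * D ^+ 2.
  exact: (flow_time_bound Fs C0 CP xq us usg (positive_semipositive sP)
    (positive_tensors_neq0 n0 sP) (positive_semipositive gP)
    (positive_tensors_neq0 n0 gP) h1 h2 kt).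
have lbound : k.+1%:R * lam <= 2 * `|ln C| + 2 * ln D.
  have : ln ((1 + C^-1) ^+ k.+1) <= ln (C ^+ 2 * D ^+ 2).
    by rewrite ler_ln// posrE ?mulr_gt0 ?exprn_gt0// (lt_trans ltr01).
  rewrite lnM ?posrE ?exprn_gt0// !lnXn// ?(lt_trans ltr01)//.
  rewrite -[ln (1 + _) *+ _]mulr_natl -[ln C *+ 2]mulr_natl -[ln D *+ 2]mulr_natl => /le_trans;
    apply; rewrite lerD2r ler_wpM2l//; exact: ler_norm.
have -> : 2 / lam * ln D + (3 + 2 * `|ln C| / lam) = 3 + (2 * `|ln C| + 2 * ln D) / lam.
  by field; rewrite gt_eqF.
apply: (@le_trans _ _ (3 + k.+1%:R)).
  by rewrite -natrD ler_nat addnC addn3.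
by rewrite lerD2l ler_pdivlMr.
Qed.

End WordBound.

Section WordDistance.
Variables (R : realType) (Gamma : groupType).
Implicit Types (S w : seq Gamma) (g h : Gamma).

Lemma words_le S S0 : generates S -> exists L : nat, forall g w, words S0 g w ->
  exists2 w', words S g w' & (size w' <= L * size w)%N.
Proof.
move=> /choice[f fP].
exists (\max_(s <- S0) maxn (size (f s)) (size (f s^-1%g))) => g w [].
set L := \max_(_ <- _) _.
elim: w g => [g _ <-|a w IH g /= /andP[aS wS] <-].
  by exists [::] => //; split; rewrite ?big_nil.
have [w' [w'S w'E] sw'] := IH _ wS erefl.
have [faS faE] := fP a; exists (f a ++ w').
  by split; [rewrite all_cat faS|rewrite big_cat big_cons faE w'E].
rewrite size_cat mulnS leq_add//; case/orP: aS => aS.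
  by apply: leq_trans (leq_maxl _ (size (f a^-1%g))) _; exact: leq_bigmax_seq.
rewrite -[a]invgK; apply: leq_trans (leq_maxr (size (f a^-1%g)) _) _.
by apply: (leq_bigmax_seq (F := fun s => maxn (size (f s)) (size (f s^-1%g)))).
Qed.

Lemma word_dist_le S g h w : words S (g^-1 * h)%g w -> word_dist R S g h <= (size w)%:R.
Proof.
move=> ww; apply: ge_inf; last by exists w.
by exists 0 => _ [v _ <-].
Qed.

Lemma le_word_dist S g h (a : R) : generates S ->
  (forall w, words S (g^-1 * h)%g w -> a <= (size w)%:R) -> a <= word_dist R S g h.
Proof.
move=> gS aP; apply: lb_le_inf.
  by have [w ww] := gS (g^-1 * h)%g; exists (size w)%:R; exists w.
by move=> _ [w ww <-]; exact: aP.
Qed.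

End WordDistance.

(** * Paths in the special linear group *)

(* The constant and linear coefficients of a polynomial record the value and
   the derivative of a function; products of polynomials obey the Leibniz
   rule, so that the derivative of [\det] is read off a polynomial matrix. *)
Section FirstJets.
Variable R : realType.
Implicit Types (f g : R -> R) (P Q : {poly R}).

Definition first_jet f t P := f t = P`_0 /\ is_derive t (1 : R) f P`_1.

Lemma first_jetM f g t P Q : first_jet f t P -> first_jet g t Q ->
  first_jet (fun x => f x * g x) t (P * Q).
Proof.
move=> [f0 f1] [g0 g1]; split; first by rewrite coef0M f0 g0.
apply: is_derive_eq; rewrite coefM !big_ord_recl big_ord0 /= addr0 /bump /= f0 g0.
by rewrite /GRing.scale /= [Q`_0 * _]mulrC.
Qed.

Lemma first_jetD f g t P Q : first_jet f t P -> first_jet g t Q ->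
  first_jet (fun x => f x + g x) t (P + Q).
Proof.
by move=> [f0 f1] [g0 g1]; split; rewrite !coefD ?f0 ?g0//; exact: is_deriveD.
Qed.

Lemma first_jet_cst (a : R) t : first_jet (fun=> a) t a%:P.
Proof. by split; rewrite coefC//; exact: is_derive_cst. Qed.

Lemma first_jet_prod (I : Type) (r : seq I) (f : I -> R -> R) t (P : I -> {poly R}) :
  (forall i, first_jet (f i) t (P i)) ->
  first_jet (fun x => \prod_(i <- r) f i x) t (\prod_(i <- r) P i).
Proof.
move=> fP; elim: r => [|i r IH].
  rewrite (_ : (fun _ => _) = fun=> 1); last by apply/funext => x; rewrite big_nil.
  by rewrite big_nil; exact: first_jet_cst.
rewrite (_ : (fun _ => _) = fun x => f i x * \prod_(i <- r) f i x); last first.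
  by apply/funext => x; rewrite big_cons.
by rewrite big_cons; exact: first_jetM.
Qed.

Lemma first_jet_sum (I : Type) (r : seq I) (f : I -> R -> R) t (P : I -> {poly R}) :
  (forall i, first_jet (f i) t (P i)) ->
  first_jet (fun x => \sum_(i <- r) f i x) t (\sum_(i <- r) P i).
Proof.
move=> fP; elim: r => [|i r IH].
  rewrite (_ : (fun _ => _) = fun=> 0); last by apply/funext => x; rewrite big_nil.
  by rewrite big_nil; exact: first_jet_cst.
rewrite (_ : (fun _ => _) = fun x => f i x + \sum_(i <- r) f i x); last first.
  by apply/funext => x; rewrite big_cons.
by rewrite big_cons; exact: first_jetD.
Qed.

Lemma first_jet_det n (c : R -> 'M[R]_n) t (P : 'M[{poly R}]_n) :
  (forall i j, first_jet (fun x => c x i j) t (P i j)) ->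
  first_jet (fun x => \det (c x)) t (\det P).
Proof.
move=> cP; apply: first_jet_sum => s; apply: first_jetM; last exact: first_jet_prod.
have -> : (-1) ^+ odd_perm s = ((-1) ^+ odd_perm s)%:P :> {poly R}.
  by rewrite rmorphXn rmorphN.
exact: first_jet_cst.
Qed.

Lemma coef1_prod_unipotent (I : Type) (r : seq I) (y : I -> R) :
  (\prod_(i <- r) (1 + 'X * (y i)%:P))`_0 = 1 /\
  (\prod_(i <- r) (1 + 'X * (y i)%:P))`_1 = \sum_(i <- r) y i.
Proof.
have c0 i : (1 + 'X * (y i)%:P)`_0 = 1 by rewrite coefD coef1 coefXM addr0.
have c1 i : (1 + 'X * (y i)%:P)`_1 = y i by rewrite coefD coef1 coefXM coefC add0r.
elim: r => [|i r [IH0 IH1]]; first by rewrite !big_nil !coef1.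
rewrite !big_cons coef0M c0 IH0 mulr1; split => //.
rewrite coefM !big_ord_recl big_ord0 /= addr0 /bump /= subn0 subnn.
by rewrite c0 c1 IH0 IH1 mul1r mulr1 addrC.
Qed.

(** A permutation other than the identity moves at least two indices, so its product is divisible by
    the square of the indeterminate. *)
Lemma coef1_det n (Y : 'M[R]_n) :
  (\det (1%:M + 'X *: map_mx polyC Y))`_1 = \tr Y.
Proof.
rewrite /determinant (bigD1 (1%g : {perm 'I_n})) //= coefD odd_perm1 expr0 mul1r.
have -> : \prod_i (1%:M + 'X *: map_mx polyC Y) i ((1%g : {perm 'I_n}) i) =
    \prod_i (1 + 'X * (Y i i)%:P).
  by apply: eq_bigr => i _; rewrite perm1 !mxE eqxx.
rewrite (coef1_prod_unipotent (index_enum 'I_n) (fun i => Y i i)).2.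
rewrite coef_sum [X in _ + X]big1 ?addr0// => s s1.
have [i si] : exists i, s i != i.
  apply/existsP; apply: contraR s1 => /existsPn h.
  by apply/eqP/permP => i; rewrite perm1; apply/eqP/negPn; exact: h.
have sj : s (s i) != s i by apply: contra si => /eqP/perm_inj ->.
have E k : s k != k -> (1%:M + 'X *: map_mx polyC Y) k (s k) = 'X * (Y k (s k))%:P.
  by move=> sk; rewrite !mxE eq_sym (negbTE sk) add0r.
rewrite (bigD1 i)//= (bigD1 (s i))//= !E//.
have comm (e a b Q : {poly R}) : e * ('X * a * ('X * b * Q)) = 'X * ('X * (e * a * b * Q)).
  by ring.
by rewrite comm !coefXM.
Qed.

(** Jacobi's formula: the jet of the matrix has [c t] as a factor of determinant 1, and what remains
    has the shape treated by [coef1_det]. *)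
Lemma is_derive_det n (c : R -> 'M[R]_n) (c' : 'M[R]_n) t : \det (c t) = 1 ->
  (forall i j, is_derive t (1 : R) (fun x => c x i j) (c' i j)) ->
  is_derive t (1 : R) (fun x => \det (c x)) (\tr (invmx (c t) *m c')).
Proof.
move=> dc cc'; have cu : c t \in unitmx by rewrite unitmxE dc unitr1.
pose P : 'M[{poly R}]_n := \matrix_(i, j) ((c t i j)%:P + 'X * (c' i j)%:P).
have [_] : first_jet (fun x => \det (c x)) t (\det P).
  apply: first_jet_det => i j; rewrite /first_jet !mxE !coefD !coefC !coefXM !coefC /=.
  by rewrite addr0 add0r.
have -> : P = map_mx polyC (c t) *m (1%:M + 'X *: map_mx polyC (invmx (c t) *m c')).
  rewrite mulmxDr mulmx1 -scalemxAr -map_mxM mulmxA mulmxV// mul1mx.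
  by apply/matrixP => i j; rewrite !mxE.
by rewrite det_mulmx det_map_mx dc mul1r coef1_det.
Qed.

(** A derivative is determined by the difference quotients on one side, here that of the sign of
    [s]. At the ends of an interval nothing more is known of a path. *)
Lemma is_derive_constant_side (f : R -> R) t (v s e : R) : is_derive t (1 : R) f v ->
  s != 0 -> 0 < e -> (forall h, 0 < h < e -> f (t + s * h) = f t) -> v = 0.
Proof.
move=> fv s0 e0 fc; apply/eqP; apply: contraT => v0.
have dv : derivable f t 1 by [].
have := dv; rewrite /derivable => /cvgrPdist_lt/(_ `|v|).
rewrite normr_gt0 => /(_ v0).
have -> : lim ((fun h : R => h^-1 *: (f (h *: 1 + t) - f t)) @ 0^') = v.
  by have := derive_val (is_derive := fv).
move=> [r /= r0 rP].
pose h := Num.min e (r / `|s|) / 2.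
have h0 : 0 < h by rewrite divr_gt0// lt_min e0 divr_gt0// normr_gt0.
have he : h < e by rewrite /h ltr_pdivrMr// (@le_lt_trans _ _ e) ?ge_min ?lexx// ltr_pMr// ltr1n.
have := rP (s * h); rewrite mulf_neq0 ?(gt_eqF h0)// => /(_ _ isT).
rewrite /ball /= sub0r normrN normrM (gtr0_norm h0).
have -> : `|s| * h < r.
  rewrite mulrC -ltr_pdivlMr ?normr_gt0// /h ltr_pdivrMr//.
  rewrite (@le_lt_trans _ _ (r / `|s|)) ?ge_min ?lexx ?orbT//.
  by rewrite ltr_pMr ?ltr1n// divr_gt0// normr_gt0.
move=> /(_ isT); rewrite /GRing.scale /= mulr1 [s * h + t]addrC fc ?h0//.
by rewrite subrr mulr0 subr0 ltxx.
Qed.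

End FirstJets.

Section MatrixPaths.
Variable R : realType.

Lemma norm_mulmx_le m n p (A : 'M[R]_(m, n)) (B : 'M[R]_(n, p)) :
  `|A *m B| <= n%:R * (`|A| * `|B|).
Proof.
apply/mx_norm_leP => [|i j]; first by rewrite mulr_ge0// mulr_ge0.
rewrite mxE (le_trans (ler_norm_sum _ _ _))//.
rewrite (@le_trans _ _ (\sum_(k < n) `|A| * `|B|))//.
  by apply: ler_sum => k _; rewrite normrM ler_pM// le_mx_norm.
by rewrite sumr_const card_ord mulr_natl.
Qed.

Lemma norm_trmx m n (A : 'M[R]_(m, n)) : `|A^T| = `|A|.
Proof.
apply/le_anti/andP; split; apply/mx_norm_leP => // i j.
  by rewrite mxE le_mx_norm.
by rewrite -[A]trmxK mxE trmxK le_mx_norm.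
Qed.

Lemma is_derive_sumf (I : Type) (r : seq I) (f : I -> R -> R) (t : R) (f' : I -> R) :
  (forall i, is_derive t (1 : R) (f i) (f' i)) ->
  is_derive t (1 : R) (fun x => \sum_(i <- r) f i x) (\sum_(i <- r) f' i).
Proof.
move=> ff'; elim: r => [|i r IH].
  rewrite (_ : (fun _ => _) = cst 0); last by apply/funext => x; rewrite big_nil.
  by rewrite big_nil; exact: is_derive_cst.
rewrite (_ : (fun _ => _) = f i + (fun x => \sum_(i <- r) f i x)); last first.
  by apply/funext => x; rewrite big_cons.
by rewrite big_cons; exact: is_deriveD.
Qed.

Definition mx_derive m n (A : R -> 'M[R]_(m, n)) t (A' : 'M[R]_(m, n)) :=
  forall i j, is_derive t (1 : R) (fun x => A x i j) (A' i j).

Lemma mx_derive_mul m n p (A : R -> 'M[R]_(m, n)) (B : R -> 'M[R]_(n, p)) t A' B' :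
  mx_derive A t A' -> mx_derive B t B' ->
  mx_derive (fun x => A x *m B x) t (A' *m B t + A t *m B').
Proof.
move=> dA dB i j.
rewrite (_ : (fun x => _) = fun x => \sum_k A x i k * B x k j); last first.
  by apply/funext => x; rewrite mxE.
rewrite !mxE -big_split /=; apply: is_derive_sumf => k.
rewrite addrC [A' i k * _]mulrC.
exact: (@is_deriveM R R (fun x => A x i k) (fun x => B x k j) t 1).
Qed.

Lemma mx_derive_tr m n (A : R -> 'M[R]_(m, n)) t A' :
  mx_derive A t A' -> mx_derive (fun x => (A x)^T) t A'^T.
Proof.
move=> dA i j; rewrite mxE.
by rewrite (_ : (fun x => _) = fun x => A x j i)//; apply/funext => x; rewrite mxE.
Qed.

Lemma mx_derive_cst m n (A : 'M[R]_(m, n)) t : mx_derive (fun=> A) t 0.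
Proof. by move=> i j; rewrite mxE; exact: is_derive_cst. Qed.

Lemma mx_derive_derive1 m n (A : R -> 'M[R]_(m, n)) t :
  derivable A t 1 -> mx_derive A t (derive1 A t).
Proof.
move=> dA i j; apply: DeriveDef; first by move/derivable_mxP: dA.
by rewrite derive1E derive_mx// mxE.
Qed.

Lemma derive1_mx_derive m n (A : R -> 'M[R]_(m, n)) t A' :
  mx_derive A t A' -> derivable A t 1 /\ derive1 A t = A'.
Proof.
move=> dA; have dA' : derivable A t 1 by apply/derivable_mxP => i j; have [] := dA i j.
split => //; rewrite derive1E derive_mx//; apply/matrixP => i j; rewrite mxE.
by have [_] := dA i j.
Qed.

End MatrixPaths.

Section InnerProduct.
Variables (R : realType) (n : nat) (B : 'M[R]_n -> 'M[R]_n -> R).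
Hypothesis slB : sl_inner_product B.
Implicit Types X Y Z : 'M[R]_n.

Let lin (a : R) X Y Z : B (a *: X + Y) Z = a * B X Z + B Y Z.
Proof. by have [h _ _] := slB; exact: h. Qed.
Let sym X Y : B X Y = B Y X. Proof. by have [_ h _] := slB; exact: h. Qed.

Lemma inner0 Z : B 0 Z = 0.
Proof. by have := lin (-1) 0 0 Z; rewrite scaler0 addr0 mulN1r addNr. Qed.

Lemma innerZ (a : R) X Z : B (a *: X) Z = a * B X Z.
Proof. by rewrite -[a *: X]addr0 lin inner0 addr0. Qed.

Lemma innerZZ (a : R) X : B (a *: X) (a *: X) = a ^+ 2 * B X X.
Proof. by rewrite innerZ sym innerZ mulrA. Qed.

Lemma inner_sum (I : Type) (r : seq I) (f : I -> 'M[R]_n) Z :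
  B (\sum_(i <- r) f i) Z = \sum_(i <- r) B (f i) Z.
Proof.
elim: r => [|i r IH]; first by rewrite !big_nil inner0.
by rewrite !big_cons -[f i]scale1r lin mul1r IH scale1r.
Qed.

Lemma inner_coord X Z : B X Z = \sum_i \sum_j X i j * B (delta_mx i j) Z.
Proof.
rewrite {1}[X]matrix_sum_delta inner_sum; apply: eq_bigr => i _.
by rewrite inner_sum; apply: eq_bigr => j _; rewrite innerZ.
Qed.

Lemma inner_continuous (T : topologicalType) (f : T -> 'M[R]_n) :
  continuous f -> continuous (fun t => B (f t) (f t)).
Proof.
move=> cf; under eq_fun do rewrite inner_coord.
apply: continuous_sumf => i; apply: continuous_sumf => j.
apply: continuousMf; first exact: continuous_coordf.
under eq_fun do rewrite sym inner_coord.
apply: continuous_sumf => k; apply: continuous_sumf => l.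
apply: continuousMf; first exact: continuous_coordf.
exact: continuous_cstf.
Qed.

Lemma norm_le_inner : exists2 k : R, 0 < k &
  forall X, \tr X = 0 -> `|X| <= k * Num.sqrt (B X X).
Proof.
have [_ _ Bpos] := slB.
pose A := [set X : 'M[R]_n | `|X| = 1] `&` [set X | \tr X = 0].
have cA : compact A.
  apply: compact_closedI; first exact: compact_mx_sphere.
  apply: (@closed_preimage _ _ (fun X : 'M[R]_n => \tr X) [set 0]).
    exact/continuous_mxtracef/continuous_idf.
  exact: closed_eq.
have [m m0 mP] : exists2 m : R, 0 < m & forall X, A X -> m <= B X X.
  have [A0|/set0P A0] := eqVneq A set0; first by exists 1 => // X; rewrite A0.
  have [|X0 /set_mem[X01 trX0] X0P] := @compact_EVT_min _ R (fun X => B X X) A A0 cA.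
    exact/continuous_subspaceT/inner_continuous/continuous_idf.
  exists (B X0 X0); last by move=> X AX; apply: X0P; exact: mem_set.
  by apply: Bpos; rewrite // -normr_gt0 X01.
have sm : 0 < Num.sqrt m by rewrite sqrtr_gt0.
exists (Num.sqrt m)^-1; first by rewrite invr_gt0.
move=> X trX; have [->|X0] := eqVneq X 0.
  by rewrite normr0 mulr_ge0 ?invr_ge0 ?sqrtr_ge0.
have X0' : 0 < `|X| by rewrite normr_gt0.
rewrite mulrC ler_pdivlMr// mulrC -[X in _ * X]ger0_norm// -sqrtr_sqr -sqrtrM ?(ltW m0)//.
rewrite ler_wsqrtr// mulrC -ler_pdivlMl ?exprn_gt0//.
have := mP (`|X|^-1 *: X); rewrite innerZZ exprVn; apply.
split; last by rewrite /= linearZ /= trX mulr0.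
by rewrite /= normrZ normfV normr_id mulVf// gt_eqF.
Qed.

End InnerProduct.

(** * Variation of a form along a path in the special linear group *)

Section PathComparison.
Variables (R : realType) (n : nat) (B : 'M[R]_n -> 'M[R]_n -> R).
Hypothesis slB : sl_inner_product B.

Section OnePath.
Variables (g h : 'M[R]_n) (c : R -> 'M[R]_n).
Hypothesis pc : SL_path g h c.

Let c01 (t : R) := c (clamp01 t).
Let c'01 (t : R) := derive1 c (clamp01 t).
(** The left-invariant velocity, with the time clamped to the interval on which [c] is invertible,
    so as to be continuous on the line. *)
Definition path_velocity (t : R) := invmx (c01 t) *m c'01 t.

Let dc t : mx_derive c t (derive1 c t).
Proof. by have [h1 _ _ _ _] := pc; exact/mx_derive_derive1/h1. Qed.

Let detc t : 0 <= t <= 1 -> \det (c t) = 1.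
Proof. by have [_ _ h1 _ _] := pc => t01; apply: h1; rewrite in_itv. Qed.

Lemma path_unit t : 0 <= t <= 1 -> c t \in unitmx.
Proof. by move=> t01; rewrite unitmxE detc// unitr1. Qed.

Lemma path_continuous : continuous c.
Proof.
have [h1 _ _ _ _] := pc; move=> t.
exact/differentiable_continuous/derivable1_diffP/h1.
Qed.

Lemma path_velocity_continuous : continuous path_velocity.
Proof.
have [_ h1 _ _ _] := pc.
apply: continuous_mulmxf; last first.
  by apply: continuous_compf h1; exact: clamp01_continuous.
apply: continuous_invmxf => [|t]; last by apply: path_unit; exact: clamp01_itv.
by apply: continuous_compf path_continuous; exact: clamp01_continuous.
Qed.

(** The trace is the derivative of the determinant, which is constant on the unit interval only; it
    is computed from the right before the time 1 and from the left at 1. Only for traceless matrices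
    does the inner product control the norm. *)
Lemma path_velocity_traceless t : \tr (path_velocity t) = 0.
Proof.
have t01 := clamp01_itv t; rewrite /path_velocity /c01 /c'01; move: (clamp01 t) t01 => {}t t01.
have [t0 t1] := andP t01.
have dd := is_derive_det (detc t01) (dc t).
have [tl|tl] := ltP t 1.
  apply: (is_derive_constant_side (s := 1) (e := 1 - t) dd) => //.
    by rewrite subr_gt0.
  move=> e /andP[e0 e1]; rewrite mul1r !detc// addr_ge0 ?(ltW e0)//=.
  by rewrite addrC -lerBrDr ltW.
apply: (is_derive_constant_side (s := -1) (e := 1) dd) => //.
move=> e /andP[e0 e1]; rewrite mulN1r !detc// subr_ge0 (le_trans (ltW e1))//=.
by rewrite lerBlDr (le_trans t1)// lerDl ltW.
Qed.

Definition path_speed (t : R) := Num.sqrt (B (path_velocity t) (path_velocity t)).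

Lemma path_speed_continuous : continuous path_speed.
Proof.
apply: (continuous_compf (g := Num.sqrt)); last exact: sqrt_continuous.
exact/(inner_continuous slB)/path_velocity_continuous.
Qed.

Lemma SL_lengthE : SL_length B c = \int[lebesgue_measure]_(t in `[0, 1]) path_speed t.
Proof.
apply: eq_Rintegral => t /set_mem; rewrite /= in_itv /= => t01.
by rewrite /path_speed /path_velocity /c01 /c'01 clamp01_id.
Qed.

Lemma SL_length_ge0 : 0 <= SL_length B c.
Proof. by apply: Rintegral_ge0 => t _; exact: sqrtr_ge0. Qed.

Lemma path_qform_derive (s : 'M[R]_n) (l : 'rV[R]_n) (t : R) : s^T = s -> 0 <= t <= 1 ->
  is_derive t (1 : R) (fun x => qform s (l *m c x))
    (qform (path_velocity t *m s + (path_velocity t *m s)^T) (l *m c t)).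
Proof.
move=> st t01.
have dlc : mx_derive (fun x => l *m c x) t (l *m derive1 c t).
  have := mx_derive_mul (mx_derive_cst l t) (dc t).
  by rewrite mul0mx add0r.
have := mx_derive_mul (mx_derive_mul dlc (mx_derive_cst s t)) (mx_derive_tr dlc).
move=> /(_ 0 0); rewrite mulmx0 addr0.
suff -> : l *m derive1 c t *m s *m (l *m c t)^T + l *m c t *m s *m (l *m derive1 c t)^T =
   l *m c t *m (path_velocity t *m s + (path_velocity t *m s)^T) *m (l *m c t)^T by [].
rewrite /path_velocity /c01 /c'01 clamp01_id// mulmxDr mulmxDl; congr (_ + _).
  by rewrite -!mulmxA (mulmxA (c t) (invmx _)) mulmxV ?path_unit// mul1mx.
rewrite !trmx_mul st !mulmxA -!mulmxA; congr (_ *m (_ *m (_ *m _))).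
rewrite !mulmxA; congr (_ *m _); rewrite -mulmxA -trmx_mul mulmxV ?path_unit//.
by rewrite trmx1 mulmx1.
Qed.

End OnePath.

Lemma qform_le_positive (s : 'M[R]_n) : positive_tensors s -> exists2 k : R, 0 < k &
  forall w m, w^T = w -> `|qform w m| <= k * `|w| * qform s m.
Proof.
move=> /positive_tensors_open[e e0 eP]; exists (2 / e); first by rewrite divr_gt0.
move=> w m wt; have [->|w0] := eqVneq w 0.
  by rewrite {1}/qform mulmx0 mul0mx mxE !normr0 mulr0 mul0r.
have nw : 0 < `|w| by rewrite normr_gt0.
(* Adding or subtracting [a *: w], of norm [e / 2], keeps [s] positive, so [qform s m] bounds [a]
   times the value of [w]. *)
pose a := e / 2 / `|w|.
have a0 : 0 < a by rewrite !divr_gt0.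
have bnd b : `|b| = a -> 0 <= qform s m + b * qform w m.
  move=> ba; have : semipositive_tensors (s + b *: w).
    apply/positive_semipositive/eP; first by rewrite linearZ /= wt.
    by rewrite normrZ ba /a divfK ?gt_eqF// ltr_pdivrMr// ltr_pMr// ltr1n.
  by move=> [_ /(_ m)]; rewrite -/(qform _ _) qformD qformZ.
have ak : 2 / e * `|w| = a^-1 by rewrite /a !invfM !invrK; field; rewrite gt_eqF.
rewrite ak mulrC ler_pdivlMr// mulrC -[X in X * _]gtr0_norm// -normrM ler_norml.
have h1 := bnd a (gtr0_norm a0); have h2 := bnd (- a) (etrans (normrN a) (gtr0_norm a0)).
by rewrite mulNr in h2; apply/andP; split; [rewrite lerNl; lra|lra].
Qed.

(* The logarithmic derivative of a positive form along a path is bounded by the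
   speed of the path. *)
Lemma path_comparison (s : 'M[R]_n) : positive_tensors s -> exists2 k : R, 0 <= k &
  forall g h c, SL_path g h c -> forall l,
    qform s (l *m h) <= expR (k * SL_length B c) * qform s (l *m g) /\
    qform s (l *m g) <= expR (k * SL_length B c) * qform s (l *m h).
Proof.
move=> sP; have [st s_pos] := sP; have {}st : s^T = s := st.
have [k1 k10 k1P] := qform_le_positive sP.
have [k2 k20 k2P] := norm_le_inner slB.
(* [k2] bounds the norm of the velocity by the speed, the factor 2 accounts for a product with [s]
   and its transpose, [n%:R] for the norm of a product, and [k1] compares the resulting form with
   [s]. *)
pose k := k1 * (2 * (n%:R * `|s|)) * k2.
have k0 : 0 <= k by rewrite !mulr_ge0// ltW.
exists k => // g h c pc l.
have [_ _ _ cg ch] := pc.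
have [->|l0] := eqVneq l 0.
  by rewrite !mul0mx /qform !mul0mx mxE mulr0.
pose f t := qform s (l *m c t).
pose w t := path_velocity c t *m s + (path_velocity c t *m s)^T.
have f0 (t : R) : 0 <= t <= 1 -> 0 < f t.
  move=> t01; apply: s_pos; apply: contra l0 => /eqP e.
  by rewrite -[l](mulmxK (path_unit pc t01)) e mul0mx.
have wT t : (w t)^T = w t by rewrite /w linearD /= trmxK addrC.
have wN t : k1 * `|w t| <= k * path_speed c t.
  rewrite /k -!mulrA ler_wpM2l ?(ltW k10)//.
  have -> : 2 * (n%:R * (`|s| * (k2 * path_speed c t))) =
     n%:R * ((k2 * path_speed c t) * `|s|) + n%:R * ((k2 * path_speed c t) * `|s|).
    by ring.
  rewrite (le_trans (ler_normD _ _))// norm_trmx.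
  have : `|path_velocity c t *m s| <= n%:R * (k2 * path_speed c t * `|s|).
    rewrite (le_trans (norm_mulmx_le _ _))// ler_wpM2l// ler_wpM2r//.
    exact/k2P/(path_velocity_traceless pc).
  by move=> H; exact: lerD.
have cpath := path_continuous pc.
have cf : continuous f.
  apply: (@continuous_coordf R R 1 1).
  apply: continuous_mulmxf.
    apply: continuous_mulmxf; last exact: continuous_cstf.
    by apply: continuous_mulmxf => //; exact: continuous_cstf.
  by apply: continuous_trmxf; apply: continuous_mulmxf => //; exact: continuous_cstf.
(* The derivative of [ln f] on the unit interval, extended continuously; integrating it bounds the
   ratio of the end values of [f]. *)
pose G t := qform (w t) (l *m c (clamp01 t)) / f (clamp01 t).
have cG : continuous G.
  have cv := path_velocity_continuous pc.
  have ccl : continuous (fun t => c (clamp01 t)).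
    by apply: continuous_compf cpath; exact: clamp01_continuous.
  have clc : continuous (fun t => l *m c (clamp01 t)).
    by apply: continuous_mulmxf => //; exact: continuous_cstf.
  have cvs : continuous (fun t => path_velocity c t *m s).
    by apply: continuous_mulmxf => //; exact: continuous_cstf.
  apply: continuousMf.
    apply: (@continuous_coordf R R 1 1); apply: continuous_mulmxf.
      apply: continuous_mulmxf => //; apply: continuousDf => //.
      exact: continuous_trmxf.
    exact: continuous_trmxf.
  apply: continuousVf => [|t]; last by rewrite gt_eqF// f0// clamp01_itv.
  by apply: continuous_compf cf; exact: clamp01_continuous.
have GN t : `|G t| <= k * path_speed c t.
  have ft := f0 _ (clamp01_itv t).
  rewrite /G normrM normfV (gtr0_norm ft) ler_pdivrMr//.
  by rewrite (le_trans (k1P _ _ (wT t)))// ler_wpM2r// ltW.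
have dF (t : R) : 0 <= t <= 1 -> is_derive t (1 : R) (fun x => ln (f x)) (G t).
  move=> t01; have := @is_derive1_comp R (@ln R) f t _ _ (is_derive1_ln (f0 t t01))
    (path_qform_derive pc l st t01).
  by rewrite /G clamp01_id// mulrC.
have FTC : \int[lebesgue_measure]_(t in `[0, 1]) G t = ln (f 1) - ln (f 0).
  rewrite /Rintegral (continuous_FTC2 (F := fun x => ln (f x)))//.
  - exact: continuous_subspaceT.
  - have lF (t : R) : 0 <= t <= 1 -> {for t, continuous (fun x => ln (f x))}.
      move=> t01; apply/differentiable_continuous/derivable1_diffP.
      by have [] := dF t t01.
    split.
    + by move=> t; rewrite in_itv /= => /andP[t0 t1]; have [] := dF t; rewrite ?ltW.
    + by apply: cvg_at_right_filter; apply: lF; rewrite lexx ler01.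
    + by apply: cvg_at_left_filter; apply: lF; rewrite lexx ler01.
  - move=> t; rewrite in_itv /= => /andP[t0 t1]; rewrite derive1E.
    by have [] := dF t; rewrite ?ltW.
have intG : lebesgue_measure.-integrable `[0, 1] (EFin \o G).
  by apply: continuous_compact_integrable; [exact: segment_compact|exact: continuous_subspaceT].
have cS := path_speed_continuous pc.
have lnB : `|ln (f 1) - ln (f 0)| <= k * SL_length B c.
  rewrite -FTC SL_lengthE (le_trans (le_normr_Rintegral _ intG))//.
  rewrite -RintegralZl//; last first.
    by apply: continuous_compact_integrable; [exact: segment_compact|exact: continuous_subspaceT].
  apply: le_Rintegral => //.
    apply: continuous_compact_integrable; first exact: segment_compact.
    exact/continuous_subspaceT/continuous_normf.
  apply: continuous_compact_integrable; first exact: segment_compact.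
  by apply/continuous_subspaceT/continuousMf => //; exact: continuous_cstf.
have i0 : 0 <= (0 : R) <= 1 by rewrite lexx ler01.
have i1 : 0 <= (1 : R) <= 1 by rewrite lexx ler01.
rewrite -cg -ch -/(f 0) -/(f 1) -[f 1]lnK ?posrE ?f0// -[f 0]lnK ?posrE ?f0//.
rewrite -!expRD !ler_expR; move: lnB; rewrite ler_norml => /andP[h1 h2].
by split; lra.
Qed.

End PathComparison.

(** * C1 paths from the identity and their concatenation *)

Section SmoothStep.
Variable R : realType.

Lemma is_derive_quadratic_remainder (f : R -> R) (t v : R) :
  (forall h, `|f (t + h) - f t - v * h| <= h ^+ 2) -> is_derive t (1 : R) f v.
Proof.
move=> fv.
have cv : (fun h : R => h^-1 *: (f (h *: (1 : R) + t) - f t)) @ 0^' --> v.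
  apply/cvgrPdist_le => e e0; near=> h.
  have h0 : h != 0 by near: h; exact: nbhs_dnbhs_neq.
  have he : `|h| <= e by apply: ltW; near: h; exact: dnbhs0_lt.
  apply: le_trans he; have := fv h.
  rewrite /GRing.scale /= mulr1 [h + t]addrC -[h ^+ 2]ger0_norm ?sqr_ge0// normrX.
  have -> : v - h^-1 * (f (t + h) - f t) = - (h^-1 * (f (t + h) - f t - v * h)).
    by field.
  rewrite normrN normrM normfV => H.
  by rewrite mulrC ler_pdivrMr ?normr_gt0// -expr2.
by apply: DeriveDef; [apply/cvg_ex; exists v|exact: cvg_lim].
Unshelve. all: by end_near. Qed.

Definition sqr_pos (t : R) : R := Num.max 0 t ^+ 2.

Lemma is_derive_sqr_pos (t : R) : is_derive t (1 : R) sqr_pos (2 * Num.max 0 t).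
Proof.
apply: is_derive_quadratic_remainder => h; rewrite /sqr_pos.
by rewrite ler_norml; have [th|th] := leP 0 (t + h); have [t0|t0] := leP 0 t;
  apply/andP; split; nra.
Qed.

(** A quadratic spline whose second derivative is 4 on the first half of the unit interval, -4 on
    the second and 0 outside. It joins the constants 0 and 1 with a continuous derivative. *)
Definition smooth_step (t : R) : R :=
  2 * sqr_pos t + (- 4 * sqr_pos (t - 2^-1) + 2 * sqr_pos (t - 1)).

Definition smooth_step' (t : R) : R :=
  2 * (2 * Num.max 0 t) + (- 4 * (2 * Num.max 0 (t - 2^-1)) + 2 * (2 * Num.max 0 (t - 1))).

Lemma is_derive_shift (f : R -> R) (a t v : R) : is_derive (t - a) (1 : R) f v ->
  is_derive t (1 : R) (fun x => f (x - a)) v.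
Proof.
move=> fv; have ga : is_derive t (1 : R) (fun x => x - a) 1.
  have := @is_deriveB R R R id (cst a) t 1 1 0.
  by rewrite subr0; apply.
by have := @is_derive1_comp R f (fun x => x - a) t v 1 fv ga; rewrite mulr1.
Qed.

Lemma is_derive_smooth_step (t : R) : is_derive t (1 : R) smooth_step (smooth_step' t).
Proof.
apply: (@is_deriveD R R R (fun t => 2 * sqr_pos t)
   (fun t => - 4 * sqr_pos (t - 2^-1) + 2 * sqr_pos (t - 1))).
  exact: (@is_deriveZ R R R sqr_pos 2 t 1 _ (is_derive_sqr_pos t)).
apply: (@is_deriveD R R R (fun t => - 4 * sqr_pos (t - 2^-1)) (fun t => 2 * sqr_pos (t - 1))).
  apply: (@is_deriveZ R R R (fun t => sqr_pos (t - 2^-1)) (- 4) t 1).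
  exact/is_derive_shift/is_derive_sqr_pos.
apply: (@is_deriveZ R R R (fun t => sqr_pos (t - 1)) 2 t 1).
exact/is_derive_shift/is_derive_sqr_pos.
Qed.

Lemma smooth_step'_continuous : continuous smooth_step'.
Proof.
have cm (a : R) : continuous (fun t : R => Num.max 0 (t - a)).
  apply: continuous_maxf; first exact: continuous_cstf.
  by apply: (@continuousBf R _ R^o); [exact: continuous_idf|exact: continuous_cstf].
have c2 (b : R) (f : R -> R) : continuous f -> continuous (fun t => b * (2 * f t)).
  by move=> cf; do 2 (apply: continuousMf; first exact: continuous_cstf).
apply: (@continuousDf R _ R^o).
  by apply: c2; apply: continuous_maxf; [exact: continuous_cstf|exact: continuous_idf].
by apply: (@continuousDf R _ R^o); apply: c2; exact: cm.
Qed.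

Lemma smooth_step0 (t : R) : t <= 0 -> smooth_step t = 0.
Proof.
move=> t0; rewrite /smooth_step /sqr_pos !max_l//; last 2 first.
- by rewrite subr_le0 (le_trans t0).
- by rewrite subr_le0 (le_trans t0)// invr_ge0.
by rewrite expr0n /= !mulr0 !addr0.
Qed.

Lemma smooth_step1 (t : R) : 1 <= t -> smooth_step t = 1.
Proof.
move=> t1; rewrite /smooth_step /sqr_pos !max_r ?subr_ge0//; first by field.
- by rewrite (le_trans _ t1)// invf_le1// ler1n.
- by rewrite (le_trans ler01).
Qed.

End SmoothStep.

Section StepPaths.
Variable R : realType.

Lemma mx_derive_continuous m n (A A' : R -> 'M[R]_(m, n)) :
  (forall t, mx_derive A t (A' t)) -> continuous A.
Proof.
move=> dA; apply: continuous_mxP => i j t.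
by apply/differentiable_continuous/derivable1_diffP; have [] := dA t i j.
Qed.

Lemma mx_derive_constant_side m n (A : R -> 'M[R]_(m, n)) (A' : 'M[R]_(m, n)) (t s e : R) :
  mx_derive A t A' -> s != 0 -> 0 < e ->
  (forall h, 0 < h < e -> A (t + s * h) = A t) -> A' = 0.
Proof.
move=> dA s0 e0 Ac; apply/matrixP => i j; rewrite mxE.
by apply: (is_derive_constant_side (dA i j) s0 e0) => h /Ac ->.
Qed.

Lemma mx_derive_shift m n (A : R -> 'M[R]_(m, n)) (A' : 'M[R]_(m, n)) (a t : R) :
  mx_derive A (t - a) A' -> mx_derive (fun x => A (x - a)) t A'.
Proof. by move=> dA i j; apply: (is_derive_shift (f := fun x => A x i j)). Qed.

Lemma mx_derive_scale m n (A : R -> 'M[R]_(m, n)) (A' : 'M[R]_(m, n)) (k t : R) :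
  mx_derive A (k * t) A' -> mx_derive (fun x => A (k * x)) t (k *: A').
Proof.
move=> dA i j; rewrite mxE mulrC.
have gk : is_derive t (1 : R) (fun x => k * x) k.
  have := @is_deriveZ R R R id k t 1 1 (is_derive_id _ _).
  by rewrite /GRing.scale /= mulr1.
exact: (@is_derive1_comp R (fun x => A x i j) (fun x => k * x) t _ k (dA i j) gk).
Qed.

Lemma mx_derive_block m1 m2 n1 n2 (A : R -> 'M[R]_(m1, n1)) (B : R -> 'M[R]_(m1, n2))
    (C : R -> 'M[R]_(m2, n1)) (D : R -> 'M[R]_(m2, n2)) t A' B' C' D' :
  mx_derive A t A' -> mx_derive B t B' -> mx_derive C t C' -> mx_derive D t D' ->
  mx_derive (fun x => block_mx (A x) (B x) (C x) (D x)) t (block_mx A' B' C' D').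
Proof.
move=> dA dB dC dD i j; rewrite -[i]splitK -[j]splitK.
case: (fintype.split i) => {}i; case: (fintype.split j) => {}j /=.
- by rewrite block_mxEul; under eq_fun do rewrite block_mxEul; exact: dA.
- by rewrite block_mxEur; under eq_fun do rewrite block_mxEur; exact: dB.
- by rewrite block_mxEdl; under eq_fun do rewrite block_mxEdl; exact: dC.
- by rewrite block_mxEdr; under eq_fun do rewrite block_mxEdr; exact: dD.
Qed.

(** Being constant on both sides of the unit interval, such paths can be delayed and multiplied, and
    the product is a concatenation that is still of class C1, as [SL_path] requires. *)
Record step_path n (A : 'M[R]_n) (a a' : R -> 'M[R]_n) : Prop := StepPath {
  step_derive : forall t, mx_derive a t (a' t);
  step_continuous : continuous a';
  step_det : forall t, \det (a t) = 1;
  step_before : forall t, t <= 0 -> a t = 1%:M;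
  step_after : forall t, 1 <= t -> a t = A }.

Lemma step_path_mul n (A B : 'M[R]_n) a a' b b' : step_path A a a' -> step_path B b b' ->
  step_path (A *m B) (fun t => a t *m b t) (fun t => a' t *m b t + a t *m b' t).
Proof.
move=> [da ca ea a0 a1] [db cb eb b0 b1].
have ca0 := mx_derive_continuous da; have cb0 := mx_derive_continuous db.
split.
- by move=> t; exact: mx_derive_mul.
- by apply: continuousDf; exact: continuous_mulmxf.
- by move=> t; rewrite det_mulmx ea eb mulr1.
- by move=> t t0; rewrite a0// b0// mulmx1.
- by move=> t t1; rewrite a1// b1.
Qed.

Lemma step_path1 n : step_path (1%:M : 'M[R]_n) (fun=> 1%:M) (fun=> 0).
Proof.
split=> //; [by move=> t; exact: mx_derive_cst|exact: continuous_cstf|by move=> t; rewrite det1].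
Qed.

Lemma step_path_unipotent n (N : 'M[R]_n) : (forall x, \det (1%:M + x *: N) = 1) ->
  step_path (1%:M + N) (fun t => 1%:M + smooth_step t *: N) (fun t => smooth_step' t *: N).
Proof.
move=> dN; split => //.
- move=> t i j; rewrite mxE mulrC.
  rewrite (_ : (fun x => _) = fun x => (1%:M : 'M[R]_n) i j + N i j * smooth_step x); last first.
    by apply/funext => x; rewrite !mxE [N i j * _]mulrC.
  have := @is_deriveD R R R (cst ((1%:M : 'M[R]_n) i j)) (fun x => N i j * smooth_step x) t 1 0 _
    (is_derive_cst _ _ _)
    (@is_deriveZ R R R (@smooth_step R) (N i j) t 1 _ (is_derive_smooth_step t)).
  by rewrite add0r.
- by apply: continuousZf; [exact: smooth_step'_continuous|exact: continuous_cstf].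
- by move=> t t0; rewrite smooth_step0// scale0r addr0.
- by move=> t t1; rewrite smooth_step1// scale1r.
Qed.

Lemma step_path_block m (A : 'M[R]_m) a a' : step_path A a a' ->
  step_path (block_mx 1%:M 0 0 A : 'M[R]_(1 + m)) (fun t => block_mx 1%:M 0 0 (a t))
    (fun t => block_mx 0 0 0 (a' t)).
Proof.
move=> [da ca ea a0 a1]; split.
- by move=> t; apply: mx_derive_block => //; exact: mx_derive_cst.
- apply: continuous_mxP => i j; rewrite -[i]splitK -[j]splitK.
  case: (fintype.split i) => {}i; case: (fintype.split j) => {}j /=.
  + by under eq_fun do rewrite block_mxEul; exact: continuous_cstf.
  + by under eq_fun do rewrite block_mxEur; exact: continuous_cstf.
  + by under eq_fun do rewrite block_mxEdl; exact: continuous_cstf.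
  + by under eq_fun do rewrite block_mxEdr; exact: continuous_coordf.
- by move=> t; rewrite det_ublock det1 ea mulr1.
- by move=> t t0; rewrite a0// -scalar_mx_block.
- by move=> t t1; rewrite a1.
Qed.

Definition has_step_path n (A : 'M[R]_n) := exists a a', step_path A a a'.

Lemma has_step_path_mul n (A B : 'M[R]_n) :
  has_step_path A -> has_step_path B -> has_step_path (A *m B).
Proof.
by move=> [a [a' Aa]] [b [b' Bb]]; eexists; eexists; exact: (step_path_mul Aa Bb).
Qed.

Lemma has_step_path_upper m (v : 'rV[R]_m) :
  has_step_path (block_mx 1%:M v 0 1%:M : 'M[R]_(1 + m)).
Proof.
pose N : 'M[R]_(1 + m) := block_mx 0 v 0 0.
have NE (x : R) : 1%:M + x *: N = block_mx 1%:M (x *: v) 0 1%:M.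
  by rewrite scale_block_mx !scaler0 (scalar_mx_block 1 m) add_block_mx !addr0 add0r.
rewrite -[v]scale1r -NE scale1r; eexists; eexists; apply: step_path_unipotent => x.
by rewrite NE det_ublock !det1 mulr1.
Qed.

Lemma has_step_path_lower m (v : 'cV[R]_m) :
  has_step_path (block_mx 1%:M 0 v 1%:M : 'M[R]_(1 + m)).
Proof.
pose N : 'M[R]_(1 + m) := block_mx 0 0 v 0.
have NE (x : R) : 1%:M + x *: N = block_mx 1%:M 0 (x *: v) 1%:M.
  by rewrite scale_block_mx !scaler0 (scalar_mx_block 1 m) add_block_mx !addr0 add0r.
rewrite -[v]scale1r -NE scale1r; eexists; eexists; apply: step_path_unipotent => x.
by rewrite NE det_lblock !det1 mulr1.
Qed.

(** Elimination by unipotent block matrices: if the first column is nonzero below the corner, adding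
    multiples of the lower rows to the first makes the corner 1, after which the first row and
    column are cleared and a block of determinant 1 remains. *)
Lemma has_step_path_SL n (A : 'M[R]_n) : \det A = 1 -> has_step_path A.
Proof.
elim: n A => [|m IH] A dA.
  have -> : A = 1%:M by apply/matrixP => -[].
  by eexists; eexists; exact: step_path1.
have nonzero (B : 'M[R]_(1 + m)) : \det B = 1 -> dlsubmx B != 0 -> has_step_path B.
  move=> dB; set c := dlsubmx B => c0.
  pose a := ulsubmx B; pose b := ursubmx B; pose D := drsubmx B.
  have BE : B = block_mx a b c D by rewrite submxK.
  have [v vc] : exists v, v *m c = 1%:M - a.
    have cc : (c^T *m c) 0 0 != 0.
      apply: contra c0 => /eqP cc; rewrite -(inj_eq (@trmx_inj _ _ _)) trmx0; apply/eqP.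
      by apply: mulmx_tr_eq0; rewrite trmxK; apply/matrixP => i j; rewrite !ord1 cc mxE.
    exists (((c^T *m c) 0 0)^-1 *: ((1%:M - a) *m c^T)).
    have := mx11_scalar (c^T *m c); move: cc; set k := (c^T *m c) 0 0 => k0 kE.
    by rewrite -scalemxAl -mulmxA kE mul_mx_scalar scalerA mulVf// scale1r.
  pose b' := b + v *m D; pose D' := D - c *m b'.
  have E1 : block_mx 1%:M v 0 1%:M *m B = block_mx 1%:M b' c D.
    rewrite BE mulmx_block !mul1mx !mul0mx !add0r vc; congr block_mx.
    by rewrite addrC subrK.
  have E2 : block_mx 1%:M b' c D =
      block_mx 1%:M 0 c 1%:M *m block_mx 1%:M 0 0 D' *m block_mx 1%:M b' 0 1%:M.
    rewrite !mulmx_block !mul1mx !mul0mx !mulmx1 !mulmx0 !add0r !addr0 mul1mx.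
    by rewrite /D' addrC subrK.
  have E3 : B = block_mx 1%:M (- v) 0 1%:M *m block_mx 1%:M b' c D.
    rewrite -E1 mulmxA mulmx_block !mul1mx !mul0mx !mulmx1 !mulmx0 !addr0 !add0r subrr.
    by rewrite -scalar_mx_block mul1mx.
  have dD' : \det D' = 1.
    have := congr1 determinant E1; rewrite det_mulmx dB mulr1 E2 !det_mulmx.
    by rewrite !det_ublock det_lblock !det1 !mul1r mulr1.
  rewrite E3; apply: has_step_path_mul; first exact: has_step_path_upper.
  rewrite E2; apply: has_step_path_mul; last exact: has_step_path_upper.
  apply: has_step_path_mul; first exact: has_step_path_lower.
  by have [a0 [a0' h]] := IH _ dD'; eexists; eexists; exact: (step_path_block h).
have [c0|] := eqVneq (dlsubmx (A : 'M[R]_(1 + m))) 0; last exact: nonzero.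
have [m0|m0] := posnP m.
  subst m; have -> : A = 1%:M by rewrite [LHS]mx11_scalar -det_mx11 dA.
  by eexists; eexists; exact: step_path1.
pose a := ulsubmx (A : 'M[R]_(1 + m)); pose b := ursubmx (A : 'M[R]_(1 + m)).
pose D := drsubmx (A : 'M[R]_(1 + m)).
have AE : A = block_mx a b 0 D :> 'M[R]_(1 + m) by rewrite -c0 submxK.
(* The first column is zero below the corner, so the corner is nonzero; adding the first row to all
   others brings back the case already treated. *)
pose w : 'cV[R]_m := const_mx 1.
have -> : A = block_mx 1%:M 0 (- w) 1%:M *m (block_mx 1%:M 0 w 1%:M *m A) :> 'M[R]_(1 + m).
  rewrite mulmxA mulmx_block !mul1mx !mul0mx !mulmx1 !mulmx0 !addr0 !add0r addNr.
  by rewrite -scalar_mx_block mul1mx.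
apply: has_step_path_mul; first exact: has_step_path_lower.
apply: nonzero; first by rewrite det_mulmx det_lblock !det1 !mul1r.
have a0 : a 0 0 != 0.
  apply/eqP => a0; have := dA; rewrite AE (@det_ublock _ 1 m) det_mx11 a0 mul0r.
  by move=> /esym/eqP; rewrite oner_eq0.
have -> : block_mx 1%:M 0 w 1%:M *m A = block_mx a b (w *m a) (w *m b + D) :> 'M[R]_(1 + m).
  rewrite AE; apply: etrans (mulmx_block _ _ _ _ _ _ _ _) _.
  by rewrite !mul1mx !mul0mx !addr0.
rewrite block_mxKdl [a]mx11_scalar mul_mx_scalar.
rewrite scaler_eq0 (negbTE a0) /=; apply/eqP => /matrixP/(_ (Ordinal m0) 0).
by rewrite !mxE => /eqP; rewrite oner_eq0.
Qed.

End StepPaths.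

Section WordPaths.
Variables (R : realType) (n : nat) (Gamma : groupType) (rho : Gamma -> 'M[R]_n).
Hypothesis rhoP : SL_representation rho.
Variables (B : 'M[R]_n -> 'M[R]_n -> R).
Hypothesis slB : sl_inner_product B.

Let rho_det g : \det (rho g) = 1. Proof. by have [h _ _] := rhoP. Qed.
Let rho1 : rho 1%g = 1%:M. Proof. by have [_ h _] := rhoP. Qed.
Let rhoM g h : rho (g * h)%g = rho g *m rho h. Proof. by have [_ _ e] := rhoP. Qed.

Definition speed (A A' : 'M[R]_n) : R := Num.sqrt (B (invmx A *m A') (invmx A *m A')).

Lemma speed0 A : speed A 0 = 0.
Proof. by rewrite /speed mulmx0 (inner0 slB) sqrtr0. Qed.

Lemma speedZ A A' (k : R) : 0 <= k -> speed A (k *: A') = k * speed A A'.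
Proof.
move=> k0; rewrite /speed -scalemxAr (innerZZ slB) sqrtrM ?sqr_ge0//.
by rewrite sqrtr_sqr ger0_norm.
Qed.

Lemma speed_mull P A A' : P \in unitmx -> A \in unitmx ->
  speed (P *m A) (P *m A') = speed A A'.
Proof.
move=> Pu Au; rewrite /speed.
have -> // : invmx (P *m A) *m (P *m A') = invmx A *m A'.
have -> : P *m A' = P *m A *m (invmx A *m A') by rewrite -mulmxA mulKVmx.
by rewrite mulKmx// unitmx_mul Pu.
Qed.

Lemma step_path_speed A a a' : step_path A a a' ->
  exists2 L : R, 0 <= L & forall t, speed (a t) (a' t) <= L.
Proof.
move=> [da ca ea a0 a1].
have cs : continuous (fun t => speed (a t) (a' t)).
  apply: (continuous_compf (g := Num.sqrt)); last exact: sqrt_continuous.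
  apply: (inner_continuous slB); apply: continuous_mulmxf => //.
  apply: continuous_invmxf; first exact: mx_derive_continuous da.
  by move=> t; rewrite unitmxE ea unitr1.
have K0 : `[(0 : R), 1]%classic !=set0 by exists 0; rewrite /= in_itv /= lexx ler01.
have [|t0 _ tP] := @compact_EVT_max _ R (fun t =>
  speed (a t) (a' t)) _ K0 (@segment_compact R 0 1).
  exact: continuous_subspaceT.
exists (speed (a t0) (a' t0)); first exact: sqrtr_ge0.
move=> t; have [t0'|t0'] := ltP t 0.
  rewrite (_ : a' t = 0) ?speed0 ?sqrtr_ge0//.
  apply: (mx_derive_constant_side (s := -1) (e := 1) (da t)) => //.
  move=> h /andP[h0 _]; rewrite !a0 ?(ltW t0')// mulN1r subr_le0.
  by rewrite (le_trans (ltW t0'))// ltW.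
have [t1|t1] := leP t 1; first by apply: tP; apply: mem_set; rewrite /= in_itv /= t0' t1.
rewrite (_ : a' t = 0) ?speed0 ?sqrtr_ge0//.
apply: (mx_derive_constant_side (s := 1) (e := 1) (da t)) => //.
move=> h /andP[h0 _]; rewrite !a1 ?(ltW t1)// mul1r.
by rewrite (le_trans (ltW t1))// lerDl ltW.
Qed.

Variables (a a' : Gamma -> R -> 'M[R]_n).
Hypothesis aP : forall g, step_path (rho g) (a g) (a' g).

(** Each letter moves during one unit of time, and the letters before it are then constant factors
    on the left. Since the speed is left-invariant, it is that of the moving letter alone. *)
Fixpoint word_path (w : seq Gamma) (t : R) : 'M[R]_n :=
  if w is g :: w' then a g t *m word_path w' (t - 1) else 1%:M.

Fixpoint word_path' (w : seq Gamma) (t : R) : 'M[R]_n :=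
  if w is g :: w' then a' g t *m word_path w' (t - 1) + a g t *m word_path' w' (t - 1)
  else 0.

Lemma word_path_derive w t : mx_derive (word_path w) t (word_path' w t).
Proof.
elim: w t => [|g w IH] t /=; first exact: mx_derive_cst.
apply: mx_derive_mul; first exact: (step_derive (aP g)).
exact/mx_derive_shift/IH.
Qed.

Lemma word_path'_continuous w : continuous (word_path' w).
Proof.
have csh : continuous (fun t : R => t - 1).
  by apply: (@continuousBf R _ R^o); [exact: continuous_idf|exact: continuous_cstf].
elim: w => [|g w IH] /=; first exact: continuous_cstf.
apply: continuousDf; apply: continuous_mulmxf.
- exact: step_continuous (aP g).
- exact: continuous_compf csh (mx_derive_continuous (word_path_derive w)).
- exact: mx_derive_continuous (step_derive (aP g)).
- exact: continuous_compf csh IH.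
Qed.

Lemma word_path_det w t : \det (word_path w t) = 1.
Proof.
by elim: w t => [|g w IH] t /=; rewrite ?det1// det_mulmx IH (step_det (aP g)) mulr1.
Qed.

Lemma word_path_before w t : t <= 0 -> word_path w t = 1%:M.
Proof.
elim: w t => [|g w IH] t t0 //=; rewrite IH ?(step_before (aP g))// ?mulmx1//.
by rewrite subr_le0 (le_trans t0).
Qed.

Lemma word_path_after w t : (size w)%:R <= t -> word_path w t = rho (\prod_(g <- w) g)%g.
Proof.
elim: w t => [|g w IH] t /=; first by rewrite big_nil rho1.
move=> wt; rewrite big_cons rhoM IH; last by rewrite lerBrDr natr1.
by rewrite (step_after (aP g))// (le_trans _ wt)// ler1n.
Qed.

Lemma word_path_speed w (L : R) : 0 <= L ->
  (forall g, g \in w -> forall t, speed (a g t) (a' g t) <= L) ->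
  forall t, speed (word_path w t) (word_path' w t) <= L.
Proof.
move=> L0; elim: w => [|g w IH] wL t /=; first by rewrite speed0.
have [t1|t1] := leP t 1.
  have t10 : t - 1 <= 0 by rewrite subr_le0.
  rewrite word_path_before// mulmx1.
  have -> : word_path' w (t - 1) = 0.
    apply: (mx_derive_constant_side (s := -1) (e := 1) (word_path_derive w (t - 1))) => //.
    move=> h /andP[h0 _]; rewrite !word_path_before// mulN1r subr_le0.
    by rewrite (le_trans t10)// ltW.
  by rewrite mulmx0 addr0 mulmx1; apply: wL; rewrite mem_head.
have -> : a' g t = 0.
  apply: (mx_derive_constant_side (s := 1) (e := 1) (step_derive (aP g) t)) => //.
  move=> h /andP[h0 _]; rewrite !(step_after (aP g)) ?(ltW t1)// mul1r.
  by rewrite (le_trans (ltW t1))// lerDl ltW.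
rewrite mul0mx add0r speed_mull.
- by apply: IH => h hw; apply: wL; rewrite in_cons hw orbT.
- by rewrite unitmxE (step_det (aP g)) unitr1.
- by rewrite unitmxE word_path_det unitr1.
Qed.

Lemma word_SL_path g h w (L : R) : (\prod_(x <- w) x)%g = (g^-1 * h)%g -> 0 <= L ->
  (forall x, x \in w -> forall t, speed (a x t) (a' x t) <= L) ->
  exists2 c, SL_path (rho g) (rho h) c & SL_length B c <= L * (size w)%:R.
Proof.
move=> wgh L0 wL; pose k : R := (size w)%:R.
pose c t := rho g *m word_path w (k * t).
pose c' t := rho g *m (k *: word_path' w (k * t)).
have dc t : mx_derive c t (c' t).
  have := mx_derive_mul (mx_derive_cst (rho g) t) (mx_derive_scale (word_path_derive w (k * t))).
  by rewrite mul0mx add0r.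
have c'E t : derive1 c t = c' t by have [] := derive1_mx_derive (dc t).
have cc' : continuous c'.
  apply: continuous_mulmxf; first exact: continuous_cstf.
  apply: continuousZf; first exact: continuous_cstf.
  apply: (@continuous_compf _ _ _ (fun t : R => k * t)); last exact: word_path'_continuous.
  by apply: continuousMf; [exact: continuous_cstf|exact: continuous_idf].
have gu : rho g \in unitmx by rewrite unitmxE rho_det unitr1.
have pc : SL_path (rho g) (rho h) c.
  split.
  - by move=> t; have [] := derive1_mx_derive (dc t).
  - by rewrite (_ : derive1 c = c')//; apply/funext => t; rewrite c'E.
  - by move=> t _; rewrite det_mulmx rho_det word_path_det mulr1.
  - by rewrite /c mulr0 word_path_before// mulmx1.
  - by rewrite /c mulr1 word_path_after// -rhoM wgh mulgA mulgV mul1g.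
exists c => //; rewrite SL_lengthE.
have -> : L * k = \int[lebesgue_measure]_(t in `[(0 : R), 1]) (L * k).
  by rewrite Rintegral_cst//= lebesgue_measure_itv/= lte_fin ltr01 oppr0 adde0 mulr1.
apply: le_Rintegral => //.
- apply: continuous_compact_integrable; first exact: segment_compact.
  exact/continuous_subspaceT/(path_speed_continuous slB pc).
- apply: continuous_compact_integrable; first exact: segment_compact.
  exact/continuous_subspaceT/continuous_cstf.
move=> t _; rewrite /path_speed /path_velocity c'E -/(speed _ _) /c' /c.
rewrite speed_mull// ?unitmxE ?word_path_det ?unitr1// speedZ//.
by rewrite mulrC ler_wpM2r//; exact: word_path_speed.
Qed.

End WordPaths.

Lemma SL_dist_word (R : realType) n (Gamma : groupType) (rho : Gamma -> 'M[R]_n)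
    (B : 'M[R]_n -> 'M[R]_n -> R) (S : seq Gamma) :
  SL_representation rho -> sl_inner_product B ->
  exists2 L : R, 0 <= L & forall g h w, words S (g^-1 * h)%g w ->
    exists2 c, SL_path (rho g) (rho h) c & SL_length B c <= L * (size w)%:R.
Proof.
move=> rhoP slB; have [rho_det _ _] := rhoP.
have [a /choice[a' aP]] := choice (fun g => has_step_path_SL (rho_det g)).
have /choice[L LP] g : exists l : R, 0 <= l /\ forall t, speed B (a g t) (a' g t) <= l.
  by have [l l0 lP] := step_path_speed slB (aP g); exists l.
have L0 g : 0 <= L g by have [] := LP g.
pose LS := \sum_(s <- S) (L s + L s^-1%g).
have le_LS s : s \in S -> L s + L s^-1%g <= LS.
  by move=> sS; rewrite /LS (big_rem s)//= lerDl sumr_ge0// => x _; rewrite addr_ge0.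
exists LS; first by rewrite sumr_ge0// => x _; rewrite addr_ge0.
move=> g h w [/allP wS wE]; apply: (word_SL_path rhoP slB aP) => //.
  by rewrite sumr_ge0// => x _; rewrite addr_ge0.
move=> x /wS/orP[xS|xS] t; apply: le_trans ((LP x).2 t) _.
  by rewrite (le_trans _ (le_LS _ xS))// lerDl.
by rewrite (le_trans _ (le_LS _ xS))// invgK lerDr.
Qed.

(** * The quasi-isometric embedding *)

Lemma quasi_isometric_from_bounds (R : realType) n (Gamma : groupType)
    (rho : Gamma -> 'M[R]_n) (S : seq Gamma) (B : 'M[R]_n -> 'M[R]_n -> R) (k b : R) :
  generates S -> 1 <= k -> 0 <= b ->
  (forall g h c, SL_path (rho g) (rho h) c ->
     word_dist R S g h <= k * SL_length B c + b) ->
  (forall g h w, words S (g^-1 * h)%g w ->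
     exists2 c, SL_path (rho g) (rho h) c & SL_length B c <= k * (size w)%:R) ->
  quasi_isometric_embedding (word_dist R S) (SL_dist B) rho.
Proof.
move=> gS k1 b0 low up; have k0 : 0 < k by rewrite (lt_le_trans ltr01).
exists k, b; split => // g h; apply/andP; split.
  apply: (@le_trans _ _ (k^-1 * (word_dist R S g h - b))).
    by rewrite mulrBr lerD2l lerN2 ler_piMl// invf_le1.
  apply: lb_le_inf.
    have [w wS] := gS (g^-1 * h)%g; have [c pc _] := up g h w wS.
    by exists (SL_length B c); exists c.
  by move=> _ [c pc <-]; rewrite ler_pdivrMl// lerBlDr; exact: low.
apply: (@le_trans _ _ (k * word_dist R S g h)); last by rewrite lerDl.
rewrite -ler_pdivrMl//; apply: le_word_dist => // w /up[c pc cw].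
rewrite ler_pdivrMl//; apply: le_trans cw; apply: ge_inf; last by exists c.
by exists 0 => _ [c' _ <-]; exact: SL_length_ge0.
Qed.

Theorem corollary4p7 (R : realType) (n d : nat) (N M : topologicalType)
    (p : M -> N) (x0 : M) (Gamma : groupType) (cls : (R -> N) -> Gamma)
    (act : Gamma -> M -> M) (rho : Gamma -> 'M[R]_n)
    (u : M -> grassmannian R n d) :
  ~~ odd n ->
  closed_manifold R d N -> connected [set: N] ->
  universal_cover R p ->
  fundamental_group (p x0) cls ->
  deck_action p x0 cls act ->
  SL_representation rho ->
  continuous u -> (forall x, mixed (u x)) -> equivariant_map act rho u ->
  (exists Phi : R -> sphere_bundle u -> sphere_bundle u,
     fitting_flow Phi /\ equivariant_flow act rho Phi) ->
  [/\ embedding u, globally_fitting u & quasi_isometrically_embedded rho].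
Proof.
move=> _ [hN _ lN cN] _ uc fg da rep cu mu eu [Phi [fPhi ePhi]].
have [covp _] := uc.
have hM := covering_hausdorff covp hN.
have lM := covering_locally_euclidean covp lN.
have pM := cover_path uc.
have Fs := flow_flow_spec cu fPhi.
have [rho_det rho1 rhoM] := rep.
have rho_unit g : rho g \in unitmx by rewrite unitmxE rho_det unitr1.
have eF g x q t := flow_equivariant rho_unit ePhi eu g t (x := x) (q := q).
have in_act g x q := act_in_bundle rho_unit eu g (x := x) (q := q).
have [K cK KP] := deck_cocompact uc da cN lN.
have [C C0 CP] := uniform_expansion cu Fs rho_unit eu eF cK KP.
have flow_trans := flow_transitive cu Fs mu hM lM pM C0 CP.
split; [exact: embedding_u CP|exact: globally_fitting_u CP|].
have [g0 Kx1] := KP x0; set x1 := act g0 x0 in Kx1.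
have [S SP] := deck_proper uc fg da hN cK (flow_image_compact cu Fs (T := 1) cK).
have flow_words m q t g : in_bundle u x1 q -> 0 <= t <= m%:R ->
    (flow Phi (x1, q, t)).1 = act g x1 -> exists2 w, words S g w & (size w <= m.+1)%N.
  move=> xq tm Fg; apply: (flow_word Fs (act1 da) (actM da) eF in_act KP SP Kx1 xq tm).
  by exists x1.
have [s [us sP]] := mu x1.
have [A [B [A0 B0 AB]]] := word_bound Fs eu rho_unit C0 CP flow_trans
  (deck_free uc fg da) flow_words us sP.
split.
  (* The translates joined to the fundamental compact set by flow lines of length 1 generate the
     group, because the flow reaches every [act g x1] from [x1]. *)
  exists S => g; have [gx|] := eqVneq x1 (act g x1).
    have -> : g = 1%g by apply: (deck_free uc fg da (x := x1)).
    by exists [::]; split; rewrite ?big_nil.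
  move=> /flow_trans[q [t [xq t0 Fg]]].
  have [|w wS _] := flow_words (Num.trunc t).+1 q t g xq _ Fg; last by exists w.
  by rewrite (ltW t0) ltW//; have /andP[] := trunc_itv (ltW t0).
move=> S' B' gS' slB.
have [L1 L1P] := words_le S gS'.
have [k k0 kP] := path_comparison slB sP.
have [L2 L20 L2P] := SL_dist_word S' rep slB.
have kA : 0 <= L1%:R * (A * k) :> R by rewrite !mulr_ge0.
(* [L1] rewrites words in [S] as words in [S'], [A * k] bounds their length by that of a path, and
   [L2] bounds a path by a word; adding the terms and 1 gives a common constant at least 1. *)
apply: (@quasi_isometric_from_bounds _ _ _ _ _ _ (1 + L1%:R * (A * k) + L2) (L1%:R * B)) => //.
- by rewrite -addrA lerDl addr_ge0.
- by rewrite mulr_ge0.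
- move=> g h c pc.
  have len0 := SL_length_ge0 B' c.
  have rhoE : rho g *m rho (g^-1 * h)%g = rho h by rewrite -rhoM mulgA mulgV mul1g.
  (* Taking covectors of the form [l *m invmx (rho g)] turns the comparison of the two ends of the
     path into one of [s] with its translate by [g^-1 * h]. *)
  have cmp l := kP _ _ _ pc (l *m invmx (rho g)).
  have qE l : qform (rho (g^-1 * h)%g *m s *m (rho (g^-1 * h)%g)^T) l =
      qform s (l *m rho (g^-1 * h)%g) by rewrite /qform trmx_mul !mulmxA.
  have st : s^T = s by have [] := sP.
  have gst : (rho (g^-1 * h)%g *m s *m (rho (g^-1 * h)%g)^T)^T =
      rho (g^-1 * h)%g *m s *m (rho (g^-1 * h)%g)^T.
    by rewrite !trmx_mul trmxK st mulmxA.
  have {cmp} cmp l : qform s (l *m rho (g^-1 * h)%g) <= expR (k * SL_length B' c) * qform s l /\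
      qform s l <= expR (k * SL_length B' c) * qform s (l *m rho (g^-1 * h)%g).
    by have := cmp l; rewrite -rhoE mulmxA !mulmxKV.
  have [|||w wS sw] := AB (g^-1 * h)%g (expR (k * SL_length B' c)).
  + by rewrite -expR0 ler_expR mulr_ge0.
  + split; first by rewrite /symmetric_tensors /= linearB /= linearZ /= st gst.
    move=> l; rewrite -/(qform _ _) qformD qformZ qformN qE subr_ge0.
    by have [] := cmp l.
  + split; first by rewrite /symmetric_tensors /= linearB /= linearZ /= st gst.
    move=> l; rewrite -/(qform _ _) qformD qformZ qformN qE subr_ge0.
    by have [] := cmp l.
  rewrite expRK in sw.
  have [w' w'S sw'] := L1P _ _ wS.
  rewrite (le_trans (word_dist_le R w'S))// (@le_trans _ _ (L1%:R * (size w)%:R))//.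
    by rewrite -natrM ler_nat.
  rewrite (le_trans (ler_wpM2l _ sw))// mulrDr lerD2r mulrA -mulrA.
  by rewrite !mulrDl -!mulrA -addrA addrCA lerDl addr_ge0 ?mul1r// mulr_ge0.
- move=> g h w /L2P[c pc cw]; exists c => //.
  by rewrite (le_trans cw)// ler_wpM2r// lerDr addr_ge0.
Qed.
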